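(* In the Heisenberg group $\mathbb H^1$ (homogeneous dimension $Q=4$) with coordinates $g=(x,y,\sigma)$, consider the harmonic function $f(x,y,\sigma)=x+6y\sigma-x^3$. Then $$\Delta_H(|\nabla_Hf|^2)(x,y,\sigma)\le0$$ for every $(x,y,\sigma)\in\mathbb H^1$ such that $x^2+y^2\le\frac19$. As a consequence, for any $0<\alpha<Q$ the left-invariant functional $$r\longrightarrow\frac1{r^\alpha}\int_{B_r}\frac{|\nabla_Hf(g)|^2}{\rho(g)^{Q-\alpha}}|\nabla_H\rho(g)|^2\,dg$$ is nonincreasing for $r\in(0,\frac13)$. Instead, with $f_+=\max(f,0)$ and $f_-=\max(-f,0)$, the right-invariant functional $$r\longrightarrow\mathscr D_2(f_+,r)\,\mathscr D_2(f_-,r),\qquad \mathscr D_2(u,r)=\frac1{r^2}\int_{B_r}\frac{|\tilde\nabla_Hu(g)|^2}{\rho(g)^{Q-2}}|\nabla_H\rho(g)|^2\,dg,$$ is nondecreasing on $(0,\infty)$.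
   Context: $\mathbb H^1$ is $\mathbb R^3$ with coordinates $(x,y,\sigma)$ and the group law for which the left-invariant horizontal vector fields are $X_1=\partial_x-\frac y2\partial_\sigma$, $X_2=\partial_y+\frac x2\partial_\sigma$, and the corresponding right-invariant ones are $\tilde X_1=\partial_x+\frac y2\partial_\sigma$, $\tilde X_2=\partial_y-\frac x2\partial_\sigma$. Set $|\nabla_Hu|^2=(X_1u)^2+(X_2u)^2$, $|\tilde\nabla_Hu|^2=(\tilde X_1u)^2+(\tilde X_2u)^2$ (defined a.e. for locally Lipschitz $u$), $\Delta_H=X_1^2+X_2^2$; harmonic means $\Delta_Hf=0$. $dg$ is Lebesgue measure. Let $\tilde\Gamma(g)$ be the unique positive fundamental solution of $-\Delta_H$ with pole at the identity $e=0$ which vanishes at infinity; it is homogeneous of degree $2-Q=-2$ under the dilations $(x,y,\sigma)\mapsto(\lambda x,\lambda y,\lambda^2\sigma)$. The pseudo-gauge is $\rho(g)=\tilde\Gamma(g)^{-1/(Q-2)}$, and $B_r=\{\rho<r\}$. *)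

(* Defs.v *)
From HB Require Import structures.
From mathcomp Require Import all_boot all_order all_algebra.
From mathcomp Require Import all_classical all_reals all_analysis.
Set Implicit Arguments.
Unset Strict Implicit.
Unset Printing Implicit Defensive.
Import Order.TTheory GRing.Theory Num.Theory.
Import numFieldNormedType.Exports.

Local Open Scope classical_set_scope.
Local Open Scope ring_scope.

(* The Heisenberg group H^1 in the coordinates g = (x, y, sigma), written
   ((x, y), sigma). Its identity e is 0, and Haar measure is Lebesgue
   measure. *)
Notation heis R := (R * R * R)%type.

Definition homdim : nat := 4.

Section Heisenberg.
Context {R : realType}.
Implicit Types (u f : heis R -> R) (g : heis R).

Definition leb3 := ((@lebesgue_measure R \x @lebesgue_measure R)
  \x @lebesgue_measure R)%E.

Definition dx u g : R := 'D_(1, 0, 0) u g.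
Definition dy u g : R := 'D_(0, 1, 0) u g.
Definition ds u g : R := 'D_(0, 0, 1) u g.

(* X1, X2 are the left-invariant fields, rX1, rX2 the right-invariant ones,
   for the group law
   g g' = (x + x', y + y', sigma + sigma' + (x y' - x' y) / 2). *)
Definition X1 u g : R := dx u g - g.1.2 / 2 * ds u g.
Definition X2 u g : R := dy u g + g.1.1 / 2 * ds u g.

Definition rX1 u g : R := dx u g + g.1.2 / 2 * ds u g.
Definition rX2 u g : R := dy u g - g.1.1 / 2 * ds u g.

Definition sqgradH u g : R := X1 u g ^+ 2 + X2 u g ^+ 2.
Definition rsqgradH u g : R := rX1 u g ^+ 2 + rX2 u g ^+ 2.

Definition laplH u g : R := X1 (X1 u) g + X2 (X2 u) g.

Definition harmonicH u := forall g, laplH u g = 0.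

Fixpoint Ck (k : nat) u : Prop :=
  continuous u /\
  if k is k'.+1 then
    [/\ forall g, [/\ derivable u g (1, 0, 0), derivable u g (0, 1, 0)
                    & derivable u g (0, 0, 1)],
        Ck k' (dx u), Ck k' (dy u) & Ck k' (ds u)]
  else True.

Definition test_function u :=
  (forall k, Ck k u) /\ compact (closure [set g | u g != 0]).

(* Gam is the positive fundamental solution of - laplH with pole at e that
   vanishes at infinity: - laplH Gam is the Dirac mass at e in the sense of
   distributions (X1 and X2 are divergence free, so laplH is its own formal
   adjoint). A distribution determines Gam only almost everywhere; continuity
   off the pole selects the usual pointwise representative. The value of Gam
   at the pole (classically +oo) is left unconstrained and never used. *)
Record fundamental_solution (Gam : heis R -> R) : Prop := {
  fsol_measurable : measurable_fun setT Gam;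
  fsol_locally_integrable : forall K : set (heis R), compact K ->
    (\int[leb3]_(g in K) `|Gam g|%:E < +oo)%E;
  fsol_continuous : forall g, g != 0 -> {for g, continuous Gam};
  fsol_positive : forall g, g != 0 -> 0 < Gam g;
  fsol_vanishing : forall eps : R, 0 < eps -> exists2 K : set (heis R),
    compact K & forall g, ~ K g -> `|Gam g| < eps;
  fsol_eq : forall phi : heis R -> R, test_function phi ->
    (\int[leb3]_g (Gam g * - laplH phi g)%:E = (phi 0)%:E)%E }.

(* rho = Gam^(-1/(Q-2)), with rho(e) = 0 since Gam(e) = +oo. *)
Definition pgauge (Gam : heis R -> R) g : R :=
  if g == 0 then 0 else Gam g `^ (- (homdim%:R - 2)^-1).

Definition pball (Gam : heis R -> R) (r : R) : set (heis R) :=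
  [set g | pgauge Gam g < r].

Definition left_functional (Gam : heis R -> R) (alpha : R) u (r : R) : \bar R :=
  (((r `^ alpha)^-1)%:E *
   \int[leb3]_(g in pball Gam r)
     (sqgradH u g / pgauge Gam g `^ (homdim%:R - alpha)
       * sqgradH (pgauge Gam) g)%:E)%E.

Definition D2 (Gam : heis R -> R) u (r : R) : \bar R :=
  (((r ^+ 2)^-1)%:E *
   \int[leb3]_(g in pball Gam r)
     (rsqgradH u g / pgauge Gam g `^ (homdim%:R - 2)
       * sqgradH (pgauge Gam) g)%:E)%E.

Definition fcubic g : R := g.1.1 + 6 * g.1.2 * g.2 - g.1.1 ^+ 3.

End Heisenberg.

(* Main.v *)
(* The fundamental solution is identified first: testing [Gam] against
   truncations of [N4^(-1/2)], where [N4 = (x^2 + y^2)^2 + 16 sigma^2], shows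
   that [Gam = C N4^(-1/2)] off the pole, so [rho] is a multiple of [N4^(1/4)]
   and dilations turn both functionals into weighted integrals over the unit
   gauge ball of the dilated integrand.

   On the left, [|grad f|^2] dilated by [l] is
   [1 - 6 l^2 (x^2 + y^2) + l^4 q] with [q >= 0] quartic, and monotonicity for
   [l^2 < C / 9] reduces to comparing the weighted integrals of [C N4] and
   [2 (x^2 + y^2)]. By homogeneity (layer cake) the weight can be dropped from
   this comparison, which then follows from an upper bound for [C] (an explicit
   truncation) and a lower bound for the integral of [(x^2 + y^2)^2] over a box.

   On the right, the reflection [(x, y, sigma) -> (-x, -y, sigma)] exchanges
   [f_+] and [f_-], so both factors are half the functional of [f]; averaging it
   over [(x, y, sigma) -> (y, x, -sigma)] cancels the negative [l^2] term. *)
From HB Require Import structures.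
Require Import Defs.
From mathcomp Require Import all_boot all_order all_algebra.
From mathcomp Require Import all_classical all_reals all_analysis.
From mathcomp Require Import measurable_realfun ring lra.
Import Order.TTheory GRing.Theory Num.Theory.
Import numFieldNormedType.Exports.

Local Open Scope classical_set_scope.
Local Open Scope ring_scope.

(** * Smooth truncations on the line *)

(** [Gam] is known only through its distributional equation, so everything about it has to come from
    smooth compactly supported tests. Functions of the polynomial [N4] are smooth even at the pole,
    and composing them with left translations recovers the value of [Gam] at each [h], not only its
    radial averages. The constant [C] matters because the radius [1/3] is measured by
    [rho = C^(-1/2) N4^(1/4)]. It is never computed: with a perfectly sharp cutoff one has [G = 2/3]
    and [mass = 8 int zsq], hence [C int zsq = 1/12] over the unit gauge ball. The smooth cutoff at
    [21/20] loses little enough for a box estimate to conclude. On the left no pointwise comparison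
    can work: on the sigma axis [zsq] vanishes while the growing quartic term does not. The two
    terms are therefore compared as integrals, for all weight exponents at once. The weighted
    integrals live in the extended reals and are not shown to be finite, so identities between them
    are written with sums only. *)

Section Smooth1.
Context {R : realType}.
Implicit Types (f g : R -> R) (U V : set R) (n : nat).

(** Continuity of the last derivative is not demanded; smoothness is expressed as
    [forall n, nD n setT f]. Since [derive1] is total, a function can be treated on overlapping open
    pieces without being restricted. *)
Fixpoint nD n U f : Prop :=
  if n is m.+1 then (forall x, U x -> derivable f x 1) /\ nD m U (derive1 f)
  else True.

Lemma nD_glue {n U V f} : nD n U f -> nD n V f -> nD n (U `|` V) f.
Proof.
elim: n f => [//|n IH] f [dU nU] [dV nV]; split; last exact: IH.
by move=> x [/dU|/dV].
Qed.

Lemma nD_sub {n U V f} : V `<=` U -> nD n U f -> nD n V f.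
Proof.
move=> VU; elim: n f => [//|n IH] f [dU nU]; split; last exact: IH.
by move=> x /VU /dU.
Qed.

Lemma nD_eq {n U f} g : open U -> (forall x, U x -> g x = f x) ->
  nD n U f -> nD n U g.
Proof.
move=> oU; elim: n f g => [//|n IH] f g gf [dU nU].
have near_gf x : U x -> \near x, f x = g x.
  by move=> Ux; near=> y; apply/esym/gf; near: y; exact: open_nbhs_nbhs.
split; first by move=> x Ux; apply: near_eq_derivable (dU _ Ux); exact: near_gf.
apply: IH nU => x Ux; rewrite !derive1E; apply: near_eq_derive.
by near=> y; apply/esym; near: y; exact: near_gf.
Unshelve. all: by end_near. Qed.

Lemma nD_is_derive {n U f} f' : open U ->
  (forall x, U x -> is_derive x (1 : R) f (f' x)) -> nD n U f' ->
  nD n.+1 U f.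
Proof.
move=> oU df nf'; split; first by move=> x /df[].
apply: (nD_eq _ oU _ nf') => x Ux.
by have h := df x Ux; rewrite derive1E derive_val.
Qed.

Lemma nDW {n U f} : nD n.+1 U f -> nD n U f.
Proof. by elim: n f => [//|n IH] f [dU nU]; split=> //; exact: IH. Qed.

Lemma nD_cst n U c : open U -> nD n U (cst c).
Proof.
move=> oU; elim: n c => [//|n IH] c.
by apply: (nD_is_derive (cst 0)) => // x _.
Qed.

Lemma nD_id n U : open U -> nD n U id.
Proof.
by case: n => [//|n] oU; apply: (nD_is_derive (cst 1)) => // *; exact: nD_cst.
Qed.

Lemma nDD {n U f g} : open U -> nD n U f -> nD n U g -> nD n U (f \+ g).
Proof.
move=> oU; elim: n f g => [//|n IH] f g [df nf] [dg ng].
apply: (nD_is_derive (derive1 f \+ derive1 g) oU); last exact: IH.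
move=> x Ux; rewrite /= !derive1E.
by apply: is_deriveD; apply: derivableP; [exact: df|exact: dg].
Qed.

Lemma nDM {n U f g} : open U -> nD n U f -> nD n U g -> nD n U (f \* g).
Proof.
move=> oU; elim: n f g => [//|n IH] f g nf ng.
have [df nf'] := nf; have [dg ng'] := ng.
apply: (nD_is_derive (f \* derive1 g \+ g \* derive1 f) oU); last first.
  by apply: nDD => //; apply: IH => //; exact: nDW.
move=> x Ux; rewrite /= !derive1E.
by apply: is_deriveM; apply: derivableP; [exact: df|exact: dg].
Qed.

Lemma nD_comp {n U V f} F : open U -> (forall x, U x -> V (f x)) ->
  nD n V F -> nD n U f -> nD n U (F \o f).
Proof.
move=> oU UV; elim: n F => [//|n IH] F [dF nF] nf.
have [df nf'] := nf.
apply: (@nD_is_derive n U (F \o f) ((derive1 F \o f) \* derive1 f) oU); last first.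
  by apply: nDM => //; apply: IH => //; exact: nDW.
move=> x Ux; rewrite /= !derive1E.
apply: is_derive1_comp; apply: derivableP; last exact: df.
by apply: dF; exact: UV.
Qed.

Lemma nD_inv n U : open U -> (forall x, U x -> x != 0) ->
  nD n U (GRing.inv : R -> R).
Proof.
move=> oU U0; elim: n => [//|n IH].
apply: (nD_is_derive (cst (-1) \* (GRing.inv \* GRing.inv)) oU); last first.
  by apply: nDM => //; [exact: nD_cst|exact: nDM].
move=> x Ux /=.
have -> : -1 * (x^-1 * x^-1) = - x ^- 2 *: 1.
  by rewrite /GRing.scale /= mulr1 mulN1r expr2 invfM.
have := @is_deriveV R id x 1 1 (U0 _ Ux) _; exact.
Qed.

Lemma nD_powR n (p : R) : nD n [set x | 0 < x] (fun x => x `^ p).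
Proof.
elim: n p => [//|n IH] p.
have oU : open [set x : R | 0 < x] by exact: open_gt.
apply: (nD_is_derive (cst p \* (fun x => x `^ (p - 1)))) => //.
by apply: nDM => //; exact: nD_cst.
Qed.

(** The difference quotient is at most [C |x - a|]. This settles the derivative of [expinv] at the
    origin, where its two branches meet. *)
Lemma is_derive_quad f (C a : R) :
  (forall x, `|f x - f a| <= C * (x - a) ^+ 2) -> is_derive a (1 : R) f 0.
Proof.
move=> fC.
have cf : h^-1 *: (f (h *: 1 + a) - f a) @[h --> 0^'] --> (0 : R).
  apply/cvgr0Pnorm_lt => e e0.
  near=> h.
  have h0 : h != 0 by near: h; exact: nbhs_dnbhs_neq.
  rewrite normrZ normfV ltr_pdivrMl ?normr_gt0 //.
  apply: le_lt_trans (fC _) _.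
  rewrite addrK [h%:A]mulr1 -(real_normK (num_real h)) expr2 mulrCA.
  rewrite ltr_pM2l ?normr_gt0 //.
  have hC : `|h| < e / (`|C| + 1).
    by near: h; apply: dnbhs0_lt; rewrite divr_gt0 // ltr_wpDl.
  rewrite ltr_pdivlMr ?ltr_wpDl // in hC.
  apply: le_lt_trans hC; rewrite mulrC ler_wpM2l ?normr_ge0 //.
  by rewrite (le_trans (ler_norm C)) // lerDl.
by apply: DeriveDef; [apply/cvg_ex; exists 0|exact: cvg_lim].
Unshelve. all: by end_near. Qed.

(** The flat function [exp(-1/x)] times [x^-k], extended by [0]. The index [k] makes the family
    stable under differentiation up to linear combinations, which is what an induction on the order
    needs. *)
Definition expinv k (x : R) : R :=
  if 0 < x then x ^- k * expR (- x^-1) else 0.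

(** Only the term of order [k + 2] in the series of [expR x^-1] is kept. *)
Lemma expinv_le k (x : R) : 0 < x -> expinv k x <= (k.+2)`!%:R * x ^+ 2.
Proof.
move=> x0; rewrite /expinv x0 expRN -invfM -[leLHS]mul1r ler_pdivrMr; last first.
  by rewrite mulr_gt0 ?exprn_gt0 ?expR_gt0.
have h := @expR_ge1Dxn R x^-1 k.+1 (ltW (etrans (invr_gt0 _) x0)).
have fk0 : (0 : R) < k.+2`!%:R by rewrite ltr0n fact_gt0.
have {h}h : (k.+2`!%:R)^-1 * x ^- k.+2 <= expR x^-1.
  by apply: le_trans h; rewrite exprVn mulrC lerDr ler01.
have -> : (k.+2)`!%:R * x ^+ 2 * (x ^+ k * expR x^-1) =
    (k.+2)`!%:R * (x ^+ k.+2 * expR x^-1) by rewrite !exprS; ring.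
rewrite -ler_pdivrMl // mulr1 mulrC -ler_pdivrMr ?exprn_gt0 //.
Qed.

Lemma expinv_ge0 k (x : R) : 0 <= expinv k x.
Proof.
rewrite /expinv; case: ifP => // x0.
by rewrite mulr_ge0 ?expR_ge0 // invr_ge0 exprn_ge0 // ltW.
Qed.

Lemma is_derive_expinv k (x : R) :
  is_derive x 1 (expinv k) (expinv k.+2 x - k%:R * expinv k.+1 x).
Proof.
have [x0|x0|->] := ltgtP x 0.
- apply: (@near_eq_is_derive _ _ _ (cst 0)).
    near=> y; rewrite /expinv ltNge ltW //; near: y; exact: lt_nbhsl.
  by rewrite /expinv !ltNge !(ltW x0) /= mulr0 subr0; exact: is_derive_cst.
- apply: (@near_eq_is_derive _ _ _ (fun x : R => x ^- k * expR (- x^-1))).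
    near=> y; rewrite /expinv ifT //; near: y; exact: lt_nbhsr.
  rewrite /expinv x0.
  have xn0 : x != 0 by rewrite gt_eqF.
  have d1 : is_derive x (1 : R) (fun x : R => x ^- k)
      (- (x ^+ k) ^- 2 *: (k%:R * x ^+ k.-1 *: (1 : R))).
    apply: is_deriveV; first by rewrite expf_eq0 gt_eqF ?andbF.
    by apply: DeriveDef; [exact: exprn_derivable|rewrite exp_derive].
  have d2 : is_derive x (1 : R) (fun x : R => - x^-1) (- (- x ^- 2 *: (1 : R))).
    by apply: is_deriveN; apply: is_deriveV.
  have d3 : is_derive x 1 (fun x : R => expR (- x^-1))
      (expR (- x^-1) * (- (- x ^- 2 *: (1 : R)))).
    exact: is_derive1_comp.
  apply: is_derive_eq.
  rewrite /GRing.scale /= !mulr1.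
  case: k d1 => [|k] d1.
    by rewrite !expr0 invr1 !mul0r mulr0 subr0 !mul1r mulr0 addr0 opprK mulrC.
  rewrite -pred_Sn !exprS; field.
  by rewrite expf_eq0 (negbTE xn0) andbF.
- rewrite /expinv ltxx mulr0 subr0 -/(expinv k).
  apply: (@is_derive_quad _ (k.+2)`!%:R) => y.
  rewrite [expinv k 0]/expinv ltxx subr0 ger0_norm ?expinv_ge0 //.
  have [y0|y0] := ltP 0 y; first by rewrite subr0 expinv_le.
  by rewrite /expinv ltNge y0 /= mulr_ge0 ?ler0n ?sqr_ge0.
Unshelve. all: by end_near. Qed.

Lemma nD_expinv n k : nD n setT (expinv k).
Proof.
elim: n k => [//|n IH] k.
apply: (@nD_is_derive n setT _ (expinv k.+2 \+ (cst (- k%:R) \* expinv k.+1))).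
- exact: openT.
- move=> x _ /=; rewrite mulNr; exact: is_derive_expinv.
- apply: nDD => //; first exact: openT.
  by apply: nDM => //; [exact: openT|exact/nD_cst/openT].
Qed.

Lemma nD_continuous {f} : nD 1 setT f -> continuous f.
Proof.
by move=> [df _] x; apply/differentiable_continuous/derivable1_diffP/df.
Qed.

(** The open sets [x > 0] and [x < 1] overlap and cover the line. Real powers, singular at [0], thus
    become harmless once multiplied by a function vanishing up to [1]. *)
Lemma nD_glue0 {n f} : nD n [set x | 0 < x] f ->
  (forall x, x <= 1 -> f x = 0) -> nD n setT f.
Proof.
move=> nf f0; apply: (nD_sub _ (nD_glue nf _)) => [x _|]; last first.
  apply: (@nD_eq n [set x | x < 1] (cst 0)); first exact: open_lt.
    by move=> x /= /ltW /f0.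
  by apply: nD_cst; exact: open_lt.
by have [x0|x0] := ltP 0 x; [left|right; rewrite /= (le_lt_trans x0)].
Qed.

(** The primitive based at [0] inherits the vanishing up to [1], so it can again be multiplied by a
    singular power and handed to [nD_glue0]. *)
Lemma antiderivative f : continuous f -> (forall x, x <= 1 -> f x = 0) ->
  exists2 F, (forall x, x <= 1 -> F x = 0) &
    forall x, is_derive x (1 : R) F (f x).
Proof.
move=> cf f0.
pose F (x : R) := (\int[@lebesgue_measure R]_(t in `[0%R, x]) f t)%R.
have F0 x : x <= 1 -> F x = 0.
  move=> x1; rewrite /F; under eq_Rintegral.
    move=> t; rewrite inE /= in_itv /= => /andP[_ tx].
    rewrite f0 ?(le_trans tx) //; over.
  by rewrite Rintegral_cst // mul0r.
exists F => // x.
have [x0|x0] := ltP 0 x; last first.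
  apply: (@near_eq_is_derive _ _ _ (cst 0)).
    near=> y; rewrite F0 //; apply: ltW; near: y; apply: lt_nbhsl.
    exact: le_lt_trans x0 _.
  by rewrite f0 ?(le_trans x0) //; exact: is_derive_cst.
have xx : x < x + 1 by rewrite ltrDl.
have int : (@lebesgue_measure R).-integrable `[0, x + 1] (EFin \o f).
  apply: continuous_compact_integrable; first exact: segment_compact.
  exact: continuous_subspaceT.
have [dF F'] := continuous_FTC1_closed xx int x0 (cf x).
by apply: DeriveDef; [exact: dF|rewrite -F' derive1E].
Unshelve. all: by end_near. Qed.

Lemma le_is_derive f df (a b : R) : a <= b ->
  (forall x, a <= x <= b -> is_derive x (1 : R) f (df x)) ->
  (forall x, a <= x <= b -> 0 <= df x) -> f a <= f b.
Proof.
move=> ab fdf df0.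
have [] := @MVT_segment R f df a b ab.
- by move=> x /[!in_itv] /= /andP[ax xb]; apply: fdf; rewrite !ltW.
- apply: derivable_within_continuous => x; rewrite in_itv /= => xab.
  by have [] := fdf x xab.
move=> x; rewrite in_itv /= => xab e; rewrite -subr_ge0 e.
by rewrite mulr_ge0 ?df0 // subr_ge0.
Qed.

Lemma eq_is_derive f g df (a b : R) : a <= b -> f a = g a ->
  (forall x, a <= x <= b -> is_derive x (1 : R) f (df x)) ->
  (forall x, a <= x <= b -> is_derive x (1 : R) g (df x)) -> f b = g b.
Proof.
move=> ab fga fdf gdf.
have h (u v : R -> R) : (forall x, a <= x <= b -> is_derive x (1 : R) u (df x)) ->
  (forall x, a <= x <= b -> is_derive x (1 : R) v (df x)) -> u a - v a <= u b - v b.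
  move=> hu hv; apply: (@le_is_derive (u \- v) (cst 0)) => // x xab.
  rewrite /= -(subrr (df x)).
  have ? := hu x xab; have ? := hv x xab.
  exact: is_deriveB.
have := h _ _ fdf gdf; have := h _ _ gdf fdf; rewrite fga; lra.
Qed.

(** The standard smooth step, from [0] for [a <= 1] to [1] for [a >= c], as a quotient of flat
    functions whose denominator never vanishes when [1 < c]. *)
Definition stp (c a : R) : R :=
  expinv 0 (a - 1) / (expinv 0 (a - 1) + expinv 0 (c - a)).

Lemma stp_den {c : R} (a : R) : 1 < c -> 0 < expinv 0 (a - 1) + expinv 0 (c - a).
Proof.
move=> c1; have p0 (x : R) : 0 < x -> 0 < expinv 0 x.
  by move=> x0; rewrite /expinv x0 expr0 invr1 mul1r expR_gt0.
have [a1|a1] := ltP 1 a.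
  by rewrite ltr_pwDl ?expinv_ge0 // p0 // subr_gt0.
by rewrite ltr_wpDl ?expinv_ge0 // p0 // subr_gt0 (le_lt_trans a1).
Qed.

Lemma stp0 (c a : R) : a <= 1 -> stp c a = 0.
Proof. by move=> a1; rewrite /stp /expinv subr_gt0 ltNge a1 mul0r. Qed.

Lemma stp1 (c a : R) : 1 < c -> c <= a -> stp c a = 1.
Proof.
move=> c1 ca; rewrite /stp; have := stp_den a c1.
have -> : expinv 0 (c - a) = 0 by rewrite /expinv subr_gt0 ltNge ca.
by rewrite addr0 => h; rewrite divff // gt_eqF.
Qed.

Lemma stp_ge0 (c a : R) : 0 <= stp c a.
Proof. by rewrite divr_ge0 ?addr_ge0 ?expinv_ge0. Qed.

Lemma stp_le1 (c a : R) : 1 < c -> stp c a <= 1.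
Proof.
move=> c1; rewrite ler_pdivrMr ?(stp_den a c1) // mul1r lerDl.
exact: expinv_ge0.
Qed.

Lemma nD_stp n (c : R) : 1 < c -> nD n setT (stp c).
Proof.
move=> c1; have oT := @openT R.
have n1 : nD n setT (fun x : R => x + (-1)).
  by apply: (nDD oT); [exact: nD_id|exact: nD_cst].
have n2 : nD n setT (fun x : R => c + (-1) * x).
  apply: (nDD oT); first exact: nD_cst.
  by apply: (nDM oT); [exact: nD_cst|exact: nD_id].
have e1 : nD n setT (fun x : R => expinv 0 (x - 1)).
  exact: (nD_comp _ oT _ (nD_expinv n 0) n1).
have e2 : nD n setT (fun x : R => expinv 0 (c - x)).
  apply: (nD_eq _ oT _ (nD_comp _ oT _ (nD_expinv n 0) n2)) => // x _ /=.
  by rewrite mulN1r.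
apply: (nDM oT e1).
apply: (nD_comp (V := [set x | 0 < x]) GRing.inv oT _ _ (nDD oT e1 e2)).
  by move=> x _; exact: stp_den.
by apply: nD_inv => [|x /lt0r_neq0//]; exact: open_gt.
Qed.

(* For a function [H (N4 (h^-1 g))] of the gauge, [- laplH] is [8 zsq] times
   [- (3 H' + 2 a H'')] at [a = N4 (h^-1 g)]. Since
   [3 H' + 2 a H'' = 2 a^(-1/2) (a^(3/2) H')'], two integrations yield the
   potential [H] of the smooth cutoff [kap = 1 - stp c]; it is an exact multiple
   of the fundamental solution [a^(-1/2)] beyond [c]. *)
Lemma radial_profile (c : R) : 1 < c ->
  exists (H kap : R -> R) (G : R),
  [/\ forall n, nD n setT H,
      forall a, c <= a -> H a = G * a `^ (- 2^-1),
      [/\ forall a, 0 <= a ->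
           - (3 * derive1 H a + 2 * a * derive1 (derive1 H) a) = kap a,
          continuous kap,
          forall a, 0 <= kap a <= 1,
          forall a, a <= 1 -> kap a = 1 & forall a, c <= a -> kap a = 0]
    & G <= 2 / 3 * c ^+ 2].
Proof.
move=> c1; have oT := @openT R; have c0 : 0 < c by apply: lt_trans c1.
(* The equation to solve is [2 a^(-1/2) (a^(3/2) H')' = stp c a - 1]. The constant [-1] contributes
   the slope [-1/3]; the step contributes [S / 2] with [S = a^(-3/2) L] and [L] the primitive of
   [f1 = a^(1/2) stp]. Every singular power meets a factor that vanishes up to [1]. *)
pose f1 := (fun x : R => x `^ 2^-1) \* stp c.
have nf1 n : nD n setT f1.
  apply: nD_glue0 => [|x x1]; last by rewrite /f1 /= stp0 ?mulr0.
  apply: nDM; [exact: open_gt|exact: nD_powR|].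
  by apply: nD_sub (nD_stp n _ c1).
have [L L0 dL] : exists2 L, (forall x, x <= 1 -> L x = 0) &
    forall x, is_derive x (1 : R) L (f1 x).
  apply: antiderivative => [|x x1]; first exact: nD_continuous (nf1 1%N).
  by rewrite /f1 /= stp0 ?mulr0.
have nL n : nD n setT L.
  by case: n => [//|n]; apply: (nD_is_derive f1 oT) => // x _.
pose S := (fun x : R => x `^ (- (3 / 2))) \* L.
have nS n : nD n setT S.
  apply: nD_glue0 => [|x x1]; last by rewrite /S /= L0 ?mulr0.
  apply: nDM; [exact: open_gt|exact: nD_powR|].
  by apply: nD_sub (nL n).
have S0 (x : R) : x <= 1 -> S x = 0 by move=> x1; rewrite /S /= L0 ?mulr0.
have [M M0 dM] := antiderivative _ (nD_continuous (nS 1%N)) S0.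
have nM n : nD n setT M.
  by case: n => [//|n]; apply: (nD_is_derive S oT) => // x _.
(* [G] is the constant for which [L a = 2/3 a^(3/2) - G] beyond [c], and [c2] is the integration
   constant that makes [H] and [G a^(-1/2)] agree at [a = c]; their derivatives agree from there
   on. *)
pose G := 2 / 3 * c `^ (3 / 2) - L c.
pose c2 := G * c `^ (- 2^-1) + 3^-1 * c - 2^-1 * M c.
pose H := (cst (- 3^-1) \* id) \+ ((cst 2^-1 \* M) \+ cst c2).
have nH n : nD n setT H.
  apply: (nDD oT); first by apply: (nDM oT); [exact: nD_cst|exact: nD_id].
  apply: (nDD oT); last exact: nD_cst.
  by apply: (nDM oT); [exact: nD_cst|exact: nM].
have dH (x : R) : is_derive x (1 : R) H (- 3^-1 + 2^-1 * S x).
  have h1 : is_derive x (1 : R) (fun x : R => - 3^-1 * x) (- 3^-1).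
    by apply: is_derive_eq; rewrite [_%:A]mulr1.
  have h2 := dM x.
  have h3 : is_derive x (1 : R) (fun x : R => 2^-1 * M x) (2^-1 * S x).
    by apply: is_derive_eq.
  have h4 := is_derive_cst c2 x (1 : R).
  have := is_deriveD h1 (is_deriveD h3 h4).
  by rewrite addr0.
have H' : derive1 H = (fun x : R => - 3^-1 + 2^-1 * S x).
  by apply/funext => x; rewrite derive1E; apply: derive_val.
have dS (x : R) : 0 < x -> is_derive x (1 : R) S
    (x `^ (- (3 / 2)) * f1 x + L x * (- (3 / 2) * x `^ (- (3 / 2) - 1))).
  move=> x0; have := dL x; have := is_derive1_powR (- (3 / 2)) x0.
  exact: is_deriveM.
have H'' (x : R) : derive1 (derive1 H) x = 2^-1 * derive1 S x.
  rewrite H' !derive1E.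
  have h : is_derive x (1 : R) S ('D_1 S x).
    by apply: derivableP; have [+ _] := nS 1%N; apply.
  have := is_deriveD (is_derive_cst (- 3^-1 : R) x (1 : R)) (is_deriveZ 2^-1 h).
  by rewrite add0r => /(@derive_val _ _ _ _ _ _ _).
have GH (a : R) : c <= a -> L a = 2 / 3 * a `^ (3 / 2) - G.
  move=> ca; pose g a := 2 / 3 * a `^ (3 / 2) - G.
  apply: (@eq_is_derive L g f1 c a ca).
  - by rewrite /g /G; ring.
  - move=> x /andP[cx _].
    have x0 : 0 < x by apply: lt_le_trans cx.
    have h := is_derive1_powR (3 / 2) x0.
    have := is_deriveB (is_deriveZ (2 / 3) h) (is_derive_cst G x (1 : R)).
    move=> /is_derive_eq; apply; rewrite subr0 /f1 /= stp1 // mulr1.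
    rewrite /GRing.scale /= mulrA.
    have -> : 3 / 2 - 1 = 2^-1 :> R by field.
    by rewrite -[RHS]mul1r; congr (_ * _); field.
exists H, (fun a => 1 - stp c a), G; split => //.
- move=> a ca.
  pose g a := G * a `^ (- 2^-1).
  apply: (@eq_is_derive H g (fun x : R => - 3^-1 + 2^-1 * S x) c a ca).
  + by rewrite /g /H /= /c2; ring.
  + move=> x /andP[cx _].
    have x0 : 0 < x by apply: lt_le_trans cx.
    have h := is_derive1_powR (- 2^-1) x0.
    have := is_deriveZ G h.
    move=> /is_derive_eq; apply.
    rewrite /S /= GH // mulrBr mulrCA -powRD; last by rewrite (gt_eqF x0) implybT.
    have -> : - (3 / 2) + 3 / 2 = 0 :> R by ring.
    rewrite powRr0 /GRing.scale /=.
    have -> : - 2^-1 - 1 = - (3 / 2) :> R by field.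
    by field.
- split.
  (* The point [a = 0] is separate because cancelling [a] against its inverse powers fails there;
     the singular terms vanish with [S]. *)
  + move=> a; rewrite le_eqVlt => /predU1P[<-|a0].
      by rewrite H'' H' S0 ?ler01 // stp0 ?ler01 //; field.
    rewrite H'' H' derive1E; have h := dS a a0; rewrite (derive_val (f:=S)).
    rewrite /S /= /f1 /=.
    set s := stp c a; set l := L a.
    have e1 : a `^ (- (3 / 2) - 1) = a^-1 * a `^ (- (3 / 2)).
      rewrite powRD; last by rewrite (gt_eqF a0) implybT.
      by rewrite powR_inv1 ?ltW // mulrC.
    have e2 : a * (a `^ (- (3 / 2)) * a `^ 2^-1) = 1.
      rewrite -powRD; last by rewrite (gt_eqF a0) implybT.
      have -> : - (3 / 2) + 2^-1 = -1 :> R by field.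
      by rewrite powR_inv1 ?ltW // divff ?gt_eqF.
    rewrite e1; set q := a `^ (- (3 / 2)) in e2 *.
    set p := a `^ 2^-1 in e2 *.
    have an0 : a != 0 by rewrite gt_eqF.
    have -> : - (3 * (- 3^-1 + 2^-1 * (q * l)) +
      2 * a * (2^-1 * (q * (p * s) + l * (- (3 / 2) * (a^-1 * q))))) =
      1 - (a * (q * p)) * s by field.
    by rewrite e2 mul1r.
  + move=> x; apply: continuousB; first exact: cst_continuous.
    exact: (nD_continuous (nD_stp 1%N _ c1)).
  + move=> a; rewrite subr_ge0 stp_le1 //= gerBl; exact: stp_ge0.
  + by move=> a a1; rewrite stp0 ?subr0.
  + by move=> a ca; rewrite stp1 ?subrr.
(* Dropping [L c >= 0] leaves [2/3 c^(3/2)], and [c > 1] allows the exponent to be raised to the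
   integer [2], convenient for numerical evaluation. *)
- have Lc : 0 <= L c.
    rewrite -(L0 1) //; apply: (@le_is_derive L f1); first exact: ltW.
    by move=> x _; rewrite /f1 /= mulr_ge0 ?powR_ge0 ?stp_ge0.
  rewrite /G lerBlDr (le_trans (_ : _ <= 2 / 3 * c ^+ 2)) ?lerDl //.
  rewrite ler_wpM2l ?divr_ge0 // -powR_mulrn ?(ltW c0) //.
  apply: ler_powR; first exact: ltW.
  lra.
Qed.

End Smooth1.

(** * Horizontal derivatives *)

Section Gradient.
Context {R : realType}.
Implicit Types (u v a b c : heis R -> R) (g : heis R).

Lemma is_derive_line (V : normedModType R) (f : V -> R) (x v : V) (d : R) :
  is_derive x v f d <-> is_derive (0 : R) (1 : R) (fun t => f (t *: v + x)) d.
Proof.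
have E : 'D_v f x = 'D_1 (fun t : R => f (t *: v + x)) (0 : R).
  rewrite /derive; set g1 := fun h => h^-1 *: _; set g2 := fun h => h^-1 *: _.
  suff -> : g1 = g2 by [].
  by rewrite funeqE /g1 /g2 => h /=; rewrite addr0 scale0r add0r [_%:A]mulr1.
split=> -[df <-].
  exact: DeriveDef (proj1 (derivable1P f x v) df) (esym E).
exact: DeriveDef (proj2 (derivable1P f x v) df) E.
Qed.

(** Partial derivatives rather than a Frechet differential: the horizontal fields and [Ck] are built
    from them, and every calculus rule reduces to one variable along a coordinate line. *)
Definition grad_at g u (p q r : R) :=
  [/\ is_derive g (1, 0, 0) u p, is_derive g (0, 1, 0) u q
    & is_derive g (0, 0, 1) u r].

Lemma grad_at_eq {g u p q r p' q' r'} : grad_at g u p q r ->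
  p = p' -> q = q' -> r = r' -> grad_at g u p' q' r'.
Proof. by move=> h <- <- <-. Qed.

Lemma grad_at_cst g (k : R) : grad_at g (fun=> k) 0 0 0.
Proof. by split; exact: is_derive_cst. Qed.

Lemma grad_atD {g u v p q r p' q' r'} : grad_at g u p q r ->
  grad_at g v p' q' r' -> grad_at g (fun g => u g + v g) (p + p') (q + q') (r + r').
Proof. by move=> [? ? ?] [? ? ?]; split; exact: is_deriveD. Qed.

Lemma grad_atN {g u p q r} : grad_at g u p q r ->
  grad_at g (fun g => - u g) (- p) (- q) (- r).
Proof. by move=> [? ? ?]; split; exact: is_deriveN. Qed.

Lemma grad_atM {g u v p q r p' q' r'} : grad_at g u p q r ->
  grad_at g v p' q' r' -> grad_at g (fun g => u g * v g)
    (u g * p' + v g * p) (u g * q' + v g * q) (u g * r' + v g * r).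
Proof. by move=> [? ? ?] [? ? ?]; split; exact: is_deriveM. Qed.

Lemma grad_atX {g u p q r} n : grad_at g u p q r -> grad_at g (fun g => u g ^+ n)
  (n%:R * u g ^+ n.-1 * p) (n%:R * u g ^+ n.-1 * q) (n%:R * u g ^+ n.-1 * r).
Proof.
have e : (fun g => u g ^+ n) = u ^+ n.
  by apply/funext => x; elim: n => [|n IH]; rewrite ?expr0// !exprS IH.
by move=> [? ? ?]; rewrite e; split; exact: is_deriveX.
Qed.

Lemma grad_at_comp {g u p q r} {F : R -> R} {d : R} : grad_at g u p q r ->
  is_derive (u g) (1 : R) F d ->
  grad_at g (fun g => F (u g)) (d * p) (d * q) (d * r).
Proof.
move=> [/is_derive_line h1 /is_derive_line h2 /is_derive_line h3] hF.
by split; apply/is_derive_line; apply: is_derive1_comp => //=;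
   rewrite scale0r add0r.
Qed.

Lemma grad_at_near {g u v p q r} : (\forall x \near g, u x = v x) ->
  grad_at g u p q r -> grad_at g v p q r.
Proof. by move=> uv [? ? ?]; split; apply: near_eq_is_derive uv _. Qed.

Lemma grad_at_line u (k : R) w g :
  (forall t g, u (t *: w + g) = t * k + u g) -> is_derive g w u k.
Proof.
move=> h; apply/is_derive_line; under eq_fun do rewrite h.
apply: is_derive_eq; by rewrite addr0 [_%:A]mulr1 /GRing.scale /= ?mulr1 ?mulr0 ?add0r.
Qed.

Lemma grad_at_x g : grad_at g (fun g => g.1.1) 1 0 0.
Proof. by split; apply: grad_at_line => t h; rewrite /= ?scaler0 ?mulr1 ?mulr0 // [_%:A]mulr1. Qed.
Lemma grad_at_y g : grad_at g (fun g => g.1.2) 0 1 0.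
Proof. by split; apply: grad_at_line => t h; rewrite /= ?scaler0 ?mulr1 ?mulr0 // [_%:A]mulr1. Qed.
Lemma grad_at_s g : grad_at g (fun g => g.2) 0 0 1.
Proof. by split; apply: grad_at_line => t h; rewrite /= ?scaler0 ?mulr1 ?mulr0 // [_%:A]mulr1. Qed.

Lemma grad_at_val {g u p q r} : grad_at g u p q r ->
  [/\ dx u g = p, dy u g = q & ds u g = r].
Proof. by move=> [h1 h2 h3]; split; exact: derive_val. Qed.

Lemma grad_at_derivable g u : derivable u g (1, 0, 0) ->
  derivable u g (0, 1, 0) -> derivable u g (0, 0, 1) ->
  grad_at g u (dx u g) (dy u g) (ds u g).
Proof. by move=> *; split; exact: derivableP. Qed.

Lemma X_val {g u p q r} : grad_at g u p q r ->
  [/\ X1 u g = p - g.1.2 / 2 * r, X2 u g = q + g.1.1 / 2 * r,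
      rX1 u g = p + g.1.2 / 2 * r & rX2 u g = q - g.1.1 / 2 * r].
Proof.
by move=> /grad_at_val[h1 h2 h3]; rewrite /X1 /X2 /rX1 /rX2 h1 h2 h3.
Qed.

Lemma CkS {k u a b c} : continuous u -> (forall g, grad_at g u (a g) (b g) (c g)) ->
  Ck k a -> Ck k b -> Ck k c -> Ck k.+1 u.
Proof.
move=> cu gu ca cb cc; split=> //.
have -> : dx u = a by apply/funext => g; have [] := grad_at_val (gu g).
have -> : dy u = b by apply/funext => g; have [] := grad_at_val (gu g).
have -> : ds u = c by apply/funext => g; have [] := grad_at_val (gu g).
by split=> [g||//|//] //; have [[? ?] [? ?] [? ?]] := gu g.
Qed.

Lemma CkS_inv {k u} : Ck k.+1 u -> continuous u /\
  [/\ forall g, grad_at g u (dx u g) (dy u g) (ds u g),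
      Ck k (dx u), Ck k (dy u) & Ck k (ds u)].
Proof.
move=> [cu [h ua ub uc]]; split; first exact: cu.
apply: And4 ua ub uc => g; have [h1 h2 h3] := h g.
exact: grad_at_derivable h1 h2 h3.
Qed.

Lemma CkW {k u} : Ck k.+1 u -> Ck k u.
Proof.
elim: k u => [|k IH] u; first by case.
by move=> [cu [du ca cb cc]]; exact: conj cu (And4 du (IH _ ca) (IH _ cb) (IH _ cc)).
Qed.

Lemma Ck_cst k (r : R) : Ck k (fun=> r).
Proof.
elim: k r => [|k IH] r; first by split=> // x; exact: cst_continuous.
apply: (CkS _ _ (IH 0) (IH 0) (IH 0)); first by move=> x; exact: cst_continuous.
by move=> g; exact: grad_at_cst.
Qed.

Lemma CkD {k u v} : Ck k u -> Ck k v -> Ck k (fun g => u g + v g).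
Proof.
elim: k u v => [|k IH] u v hu hv.
  by split=> // x; apply: continuousD; [apply: hu.1|apply: hv.1].
have [cu [du ua ub uc]] := CkS_inv hu; have [cv [dv va vb vc]] := CkS_inv hv.
apply: (CkS _ _ (IH _ _ ua va) (IH _ _ ub vb) (IH _ _ uc vc)).
  by move=> x; apply: continuousD; [apply: cu|apply: cv].
by move=> g; apply: grad_atD; [exact: du|exact: dv].
Qed.

Lemma CkM {k u v} : Ck k u -> Ck k v -> Ck k (fun g => u g * v g).
Proof.
elim: k u v => [|k IH] u v hu hv.
  by split=> // x; apply: continuousM; [apply: hu.1|apply: hv.1].
have [cu [du ua ub uc]] := CkS_inv hu; have [cv [dv va vb vc]] := CkS_inv hv.
have := CkW hu; have := CkW hv => hv' hu'.
have P p q (hp : Ck k p) (hq : Ck k q) := CkD (IH _ _ hu' hp) (IH _ _ hv' hq).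
apply: (CkS _ _ (P _ _ va ua) (P _ _ vb ub) (P _ _ vc uc)).
  by move=> x; apply: continuousM; [apply: cu|apply: cv].
by move=> g; apply: grad_atM; [exact: du|exact: dv].
Qed.

Lemma Ck_comp {k u} (F : R -> R) : (forall n, nD n setT F) -> Ck k u ->
  Ck k (fun g => F (u g)).
Proof.
elim: k F u => [|k IH] F u nF hu.
  split=> // x; apply: continuous_comp; first exact: hu.1.
  exact: (nD_continuous (nF 1%N)).
have [cu [du ua ub uc]] := CkS_inv hu.
have IF : Ck k (fun g => derive1 F (u g)).
  by apply: IH (CkW hu) => n; have [] := nF n.+1.
apply: (CkS _ _ (CkM IF ua) (CkM IF ub) (CkM IF uc)).
  move=> x; apply: continuous_comp; first exact: cu.
  exact: (nD_continuous (nF 1%N)).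
move=> g; apply: grad_at_comp; first exact: du.
by rewrite derive1E; apply: derivableP; have [+ _] := nF 1%N; apply.
Qed.

Lemma Ck_x k : Ck k (fun g : heis R => g.1.1).
Proof.
have c : continuous (fun g : heis R => g.1.1).
  by move=> g; apply: continuous_comp; [exact: cvg_fst|exact: cvg_fst].
by case: k => [//|k]; apply: CkS c grad_at_x _ _ _; exact: Ck_cst.
Qed.

Lemma Ck_y k : Ck k (fun g : heis R => g.1.2).
Proof.
have c : continuous (fun g : heis R => g.1.2).
  by move=> g; apply: continuous_comp; [exact: cvg_fst|exact: cvg_snd].
by case: k => [//|k]; apply: CkS c grad_at_y _ _ _; exact: Ck_cst.
Qed.

Lemma Ck_s k : Ck k (fun g : heis R => g.2).
Proof.
have c : continuous (fun g : heis R => g.2) by move=> g; exact: cvg_snd.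
by case: k => [//|k]; apply: CkS c grad_at_s _ _ _; exact: Ck_cst.
Qed.

End Gradient.

(** The partial derivatives of a polynomial expression are synthesised from its syntax by
    unification; [grad] then leaves the three comparisons with the announced values. *)
Ltac grad_step := first
  [ eapply grad_at_x | eapply grad_at_y | eapply grad_at_s
  | eapply grad_at_cst | eapply grad_atD | eapply grad_atN
  | eapply grad_atX | eapply grad_atM ].
Ltac grad := eapply grad_at_eq; [repeat grad_step | | | ].

(** * Horizontal Laplacians of functions of the gauge and of the cubic *)

Section Gauge.
Context {R : realType}.
Implicit Types g h : heis R.

Definition zsq g : R := g.1.1 ^+ 2 + g.1.2 ^+ 2.

(* [N4 g = N g ^ 4] for the homogeneous gauge
   [N = ((x^2 + y^2)^2 + 16 sigma^2)^(1/4)]. *)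
Definition N4 g : R := zsq g ^+ 2 + 16 * g.2 ^+ 2.

(* [ltr h g = h^-1 g] *)
Definition ltr h g : heis R :=
  (g.1.1 - h.1.1, g.1.2 - h.1.2,
   g.2 - h.2 - (h.1.1 * g.1.2 - g.1.1 * h.1.2) / 2).

(** At the identity translate, [X1 N4] and [X2 N4] have sum of squares [16 zsq N4], and
    [laplH N4 = 24 zsq]; the chain rule gives [24 zsq F' + 16 zsq N4 F'']. Left invariance of [X1]
    and [X2] replaces [g] by [h^-1 g]. *)
Lemma laplH_radial (h : heis R) (F : R -> R) g : nD 2 setT F ->
  let a := N4 (ltr h g) in
  laplH (fun g => F (N4 (ltr h g))) g =
    8 * zsq (ltr h g) * (3 * derive1 F a + 2 * a * derive1 (derive1 F) a).
Proof.
move=> [dF [dF' _]] a; rewrite /a {a}.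
have iF x : is_derive x (1 : R) F (derive1 F x).
  by rewrite derive1E; apply: derivableP; exact: dF.
have iF' x : is_derive x (1 : R) (derive1 F) (derive1 (derive1 F) x).
  by rewrite derive1E; apply: derivableP; exact: dF'.
pose p g := 4 * zsq (ltr h g) * (ltr h g).1.1 - 16 * (ltr h g).2 * (ltr h g).1.2.
pose q g := 4 * zsq (ltr h g) * (ltr h g).1.2 + 16 * (ltr h g).2 * (ltr h g).1.1.
have gA g1 : grad_at g1 (fun g => N4 (ltr h g))
   (4 * zsq (ltr h g1) * (ltr h g1).1.1 + 16 * (ltr h g1).2 * h.1.2)
   (4 * zsq (ltr h g1) * (ltr h g1).1.2 - 16 * (ltr h g1).2 * h.1.1)
   (32 * (ltr h g1).2).
  by rewrite /N4 /zsq /ltr /=; grad; rewrite /=; field.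
have X1F : X1 (fun g => F (N4 (ltr h g))) =
    (fun g => derive1 F (N4 (ltr h g)) * p g).
  apply/funext => g1.
  have [-> _ _ _] := X_val (grad_at_comp (gA g1) (iF _)).
  by rewrite /p /zsq /ltr /=; field.
have X2F : X2 (fun g => F (N4 (ltr h g))) =
    (fun g => derive1 F (N4 (ltr h g)) * q g).
  apply/funext => g1.
  have [_ -> _ _] := X_val (grad_at_comp (gA g1) (iF _)).
  by rewrite /q /zsq /ltr /=; field.
rewrite /laplH X1F X2F.
(* The individual partials of [p] and [q] are left to unification; only the combinations forming
   [X1 p] and [X2 q] have readable values. *)
have gp : exists a b c, [/\ grad_at g p a b c &
    a - g.1.2 / 2 * c = 8 * (ltr h g).1.1 ^+ 2 + 4 * zsq (ltr h g) + 8 * (ltr h g).1.2 ^+ 2].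
  do 3 eexists; split; first by rewrite /p /zsq /ltr /=; repeat grad_step.
  by rewrite /zsq /ltr /=; field.
have gq : exists a b c, [/\ grad_at g q a b c &
    b + g.1.1 / 2 * c = 8 * (ltr h g).1.2 ^+ 2 + 4 * zsq (ltr h g) + 8 * (ltr h g).1.1 ^+ 2].
  do 3 eexists; split; first by rewrite /q /zsq /ltr /=; repeat grad_step.
  by rewrite /zsq /ltr /=; field.
have [a1 [b1 [c1 [hp ep]]]] := gp; have [a2 [b2 [c2 [hq eq]]]] := gq.
have [-> _ _ _] := X_val (grad_atM (grad_at_comp (gA g) (iF' _)) hp).
have [_ -> _ _] := X_val (grad_atM (grad_at_comp (gA g) (iF' _)) hq).
move: (derive1 F _) (derive1 (derive1 F) _) => D1 D2.
transitivity (D1 * (a1 - g.1.2 / 2 * c1) + D1 * (b2 + g.1.1 / 2 * c2) +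
   D2 * (p g ^+ 2 + q g ^+ 2)); last first.
  by rewrite ep eq /p /q /N4 /zsq; ring.
by rewrite /p /q /zsq /ltr /=; field.
Qed.

Lemma harmonicH_fcubic : harmonicH (@fcubic R).
Proof.
have gf g : grad_at g (@fcubic R) (1 - 3 * g.1.1 ^+ 2) (6 * g.2) (6 * g.1.2).
  by rewrite /fcubic; grad; rewrite /=; ring.
move=> g.
have X1F : X1 fcubic = (fun g : heis R => 1 - 3 * (g.1.1 ^+ 2 + g.1.2 ^+ 2)).
  by apply/funext => g1; have [-> _ _ _] := X_val (gf g1); field.
have X2F : X2 fcubic = (fun g : heis R => 6 * g.2 + 3 * g.1.1 * g.1.2).
  by apply/funext => g1; have [_ -> _ _] := X_val (gf g1); field.
rewrite /laplH X1F X2F.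
have gp : grad_at g (fun g : heis R => 1 - 3 * (g.1.1 ^+ 2 + g.1.2 ^+ 2)) (-6 * g.1.1) (- 6 * g.1.2) 0.
  by grad; rewrite /=; ring.
have gq : grad_at g (fun g : heis R => 6 * g.2 + 3 * g.1.1 * g.1.2) (3 * g.1.2) (3 * g.1.1) 6.
  by grad; rewrite /=; ring.
have [-> _ _ _] := X_val gp; have [_ -> _ _] := X_val gq.
by field.
Qed.

Lemma sqgradH_fcubic (g : heis R) : sqgradH fcubic g =
  (1 - 3 * (g.1.1 ^+ 2 + g.1.2 ^+ 2)) ^+ 2 + (6 * g.2 + 3 * g.1.1 * g.1.2) ^+ 2.
Proof.
have gf : grad_at g (@fcubic R) (1 - 3 * g.1.1 ^+ 2) (6 * g.2) (6 * g.1.2).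
  by rewrite /fcubic; grad; rewrite /=; ring.
by rewrite /sqgradH; have [-> -> _ _] := X_val gf; field.
Qed.

(** As [x^2 <= zsq], the value is at most [216 zsq - 24], with equality for [y = 0]: this is the
    origin of the threshold [1/9]. *)
Lemma laplH_sqgradH_fcubic (g : heis R) : laplH (sqgradH fcubic) g =
  144 * zsq g + 72 * g.1.1 ^+ 2 - 24.
Proof.
have -> : sqgradH fcubic = (fun g : heis R =>
  (1 - 3 * (g.1.1 ^+ 2 + g.1.2 ^+ 2)) ^+ 2 + (6 * g.2 + 3 * g.1.1 * g.1.2) ^+ 2).
  by apply/funext => h; exact: sqgradH_fcubic.
set v := fun g => _.
have gv k : grad_at k v
   (-12 * (1 - 3 * zsq k) * k.1.1 + 6 * (6 * k.2 + 3 * k.1.1 * k.1.2) * k.1.2)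
   (-12 * (1 - 3 * zsq k) * k.1.2 + 6 * (6 * k.2 + 3 * k.1.1 * k.1.2) * k.1.1)
   (12 * (6 * k.2 + 3 * k.1.1 * k.1.2)).
  by rewrite /v /zsq; grad; rewrite /=; ring.
have X1v : X1 v = fun g : heis R => -12 * (1 - 3 * (g.1.1 ^+ 2 + g.1.2 ^+ 2)) * g.1.1.
  by apply/funext => g1; have [-> _ _ _] := X_val (gv g1); rewrite /zsq; field.
have X2v : X2 v = fun g : heis R => -12 * (1 - 3 * (g.1.1 ^+ 2 + g.1.2 ^+ 2)) * g.1.2 + 12 * (6 * g.2 + 3 * g.1.1 * g.1.2) * g.1.1.
  by apply/funext => g1; have [_ -> _ _] := X_val (gv g1); rewrite /zsq; field.
rewrite /laplH X1v X2v.
have g1 : exists a b c, [/\ grad_at g (fun g : heis R => -12 * (1 - 3 * (g.1.1 ^+ 2 + g.1.2 ^+ 2)) * g.1.1) a b c &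
    a - g.1.2 / 2 * c = -12 * (1 - 3 * zsq g) + 72 * g.1.1 ^+ 2].
  do 3 eexists; split; first by repeat grad_step.
  by rewrite /zsq /=; field.
have g2 : exists a b c, [/\ grad_at g (fun g : heis R => -12 * (1 - 3 * (g.1.1 ^+ 2 + g.1.2 ^+ 2)) * g.1.2 + 12 * (6 * g.2 + 3 * g.1.1 * g.1.2) * g.1.1) a b c &
    b + g.1.1 / 2 * c = -12 * (1 - 3 * zsq g) + 72 * zsq g].
  do 3 eexists; split; first by repeat grad_step.
  by rewrite /zsq /=; field.
have [a1 [b1 [c1 [hp ep]]]] := g1; have [a2 [b2 [c2 [hq eq]]]] := g2.
have [-> _ _ _] := X_val hp; have [_ -> _ _] := X_val hq.
by rewrite ep eq /zsq; ring.
Qed.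

End Gauge.

(** * Test functions of the gauge and their rescaling *)

Section Test.
Context {R : realType}.
Implicit Types g h : heis R.

Lemma Ck_N4_ltr k h : Ck k (fun g => N4 (ltr h g)).
Proof.
have hx : Ck k (fun g : heis R => (ltr h g).1.1) by apply: CkD (Ck_x k) (Ck_cst k _).
have hy : Ck k (fun g : heis R => (ltr h g).1.2) by apply: CkD (Ck_y k) (Ck_cst k _).
have hs : Ck k (fun g : heis R => (ltr h g).2).
  have -> : (fun g : heis R => (ltr h g).2) =
     (fun g => g.2 + (- h.2 + (- (h.1.1 / 2) * g.1.2 + (h.1.2 / 2) * g.1.1))).
    by apply/funext => g; rewrite /ltr /=; field.
  apply: CkD (Ck_s k) _; apply: CkD (Ck_cst k _) _.
  by apply: CkD (CkM (Ck_cst k _) (Ck_y k)) (CkM (Ck_cst k _) (Ck_x k)).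
have hz : Ck k (fun g => zsq (ltr h g)) by exact: CkD (CkM hx hx) (CkM hy hy).
exact: CkD (CkM hz hz) (CkM (Ck_cst k _) (CkM hs hs)).
Qed.

Lemma continuous_N4_ltr h : continuous (fun g => N4 (ltr h g)).
Proof. by have [] := Ck_N4_ltr 0 h. Qed.

(** The gauge bounds the coordinates of [h^-1 g], and the group law turns this into bounds for those
    of [g]. The last summand of [L] covers the term [(x y' - x' y) / 2] of the law. *)
Lemma N4_ltr_compact h (M : R) : compact [set g | N4 (ltr h g) <= M].
Proof.
have M2 (a : R) : a ^+ 2 <= M -> `|a| <= M + 1.
  by move=> aM; rewrite ler_norml; apply/andP; split; nra.
pose K := (M + 1) + 1.
pose L := (M + 1) + `|h.2| + (`|h.1.1| * (`|h.1.2| + K) + `|h.1.2| * (`|h.1.1| + K)).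
pose B := (`[h.1.1 - K, h.1.1 + K] `*` `[h.1.2 - K, h.1.2 + K]) `*` `[- L, L] : set (heis R).
apply: (@subclosed_compact _ _ B).
- by apply: closed_comp (@closed_le _ M) => g _; exact: continuous_N4_ltr.
- by apply: compact_setX; first apply: compact_setX; exact: segment_compact.
move=> g /= gM.
have t0 : 0 <= zsq (ltr h g) by rewrite addr_ge0 ?sqr_ge0.
have z1 : zsq (ltr h g) <= M + 1.
  apply: le_trans (ler_norm _) (M2 _ _); apply: le_trans gM.
  by rewrite lerDl mulr_ge0 ?sqr_ge0.
have s1 : `|(ltr h g).2| <= M + 1.
  apply: M2; apply: le_trans gM; rewrite /N4.
  by have := sqr_ge0 (ltr h g).2; have := sqr_ge0 (zsq (ltr h g)); lra.
have x1 : `|(ltr h g).1.1| <= K.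
  rewrite ler_norml /K; have := z1; rewrite /zsq => z2; apply/andP; split; nra.
have y1 : `|(ltr h g).1.2| <= K.
  rewrite ler_norml /K; have := z1; rewrite /zsq => z2; apply/andP; split; nra.
split; first split.
- by rewrite /= in_itv /=; move: x1; rewrite ler_norml /= => /andP[? ?]; apply/andP; split; lra.
- by rewrite /= in_itv /=; move: y1; rewrite ler_norml /= => /andP[? ?]; apply/andP; split; lra.
suff : `|g.2| <= L by rewrite /= in_itv /= ler_norml.
have -> : g.2 = (ltr h g).2 + h.2 + (h.1.1 * g.1.2 - h.1.2 * g.1.1) / 2.
  by rewrite /ltr /=; field.
have gx : `|g.1.1| <= `|h.1.1| + K.
  by rewrite (_ : g.1.1 = h.1.1 + (ltr h g).1.1) ?(le_trans (ler_normD _ _)) ?lerD2l // /ltr /=; ring.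
have gy : `|g.1.2| <= `|h.1.2| + K.
  by rewrite (_ : g.1.2 = h.1.2 + (ltr h g).1.2) ?(le_trans (ler_normD _ _)) ?lerD2l // /ltr /=; ring.
rewrite (le_trans (ler_normD _ _)) // lerD //.
  by rewrite (le_trans (ler_normD _ _)) // lerD2r.
rewrite normrM normfV (ger0_norm (_ : 0 <= 2)) // ler_pdivrMr //.
rewrite (le_trans (ler_normB _ _)) // !normrM.
have h1 := ler_wpM2l (normr_ge0 h.1.1) gy; have h2 := ler_wpM2l (normr_ge0 h.1.2) gx.
apply: le_trans (lerD h1 h2) _; rewrite ler_peMr ?ler1n //.
by rewrite (le_trans _ (lerD h1 h2)) // addr_ge0 // mulr_ge0.
Qed.

Lemma test_function_radial h (F : R -> R) (M : R) :
  (forall n, nD n setT F) -> (forall a, M <= a -> F a = 0) ->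
  test_function (fun g => F (N4 (ltr h g))).
Proof.
move=> nF F0; split; first by move=> k; exact/Ck_comp/Ck_N4_ltr.
apply: (subclosed_compact _ (N4_ltr_compact h M)); first exact: closed_closure.
have cl : closed [set g | N4 (ltr h g) <= M].
  by apply: closed_comp (@closed_le _ M) => g _; exact: continuous_N4_ltr.
rewrite [X in _ `<=` X](closure_id _).1 //; apply: closure_subset => g /=.
by rewrite leNgt; apply: contra_neqN => /ltW; exact: F0.
Qed.

End Test.

Section Scaled.
Context {R : realType}.
Variables (H : R -> R).
Hypothesis nH : forall n, nD n setT H.

(** The scaling of a function of [N4] that is homogeneous of degree [2 - Q = -2]: it leaves
    [G a^(-1/2)] unchanged, so all rescaled potentials share the same tail. *)
Definition rescale (l a : R) : R := l ^- 2 * H (a / l ^+ 4).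

Lemma nD_rescale n (l : R) : nD n setT (rescale l).
Proof.
have oT := @openT R.
have n1 : nD n setT (fun a : R => a * l ^- 4).
  by apply: (nDM oT); [exact: nD_id|exact: nD_cst].
exact: (nDM oT (nD_cst n setT (l ^- 2) oT) (nD_comp _ oT (fun _ _ => I) (nH n) n1)).
Qed.

Lemma derive1_scale f (k q : R) : nD 1 setT f ->
  derive1 (fun a => k * f (a * q)) = (fun a => (k * q) * derive1 f (a * q)).
Proof.
move=> [df _]; apply/funext => a; rewrite !derive1E.
have h : is_derive (a * q) (1 : R) f ('D_1 f (a * q)) by apply/derivableP/df.
have h1 : is_derive a (1 : R) (fun a => a * q) q.
  by apply: is_derive_eq; rewrite scaler0 add0r [_ *: _]mulr1.
have h2 : is_derive a (1 : R) (fun a => f (a * q)) ('D_1 f (a * q) * q).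
  exact: is_derive1_comp.
have := is_deriveZ k h2.
by move=> /(@derive_val _ _ _ _ _ _ _) ->; rewrite /GRing.scale /=; ring.
Qed.

Lemma rescale_radial (kap : R -> R) (l a : R) : 0 < l ->
  (forall a, 0 <= a ->
     - (3 * derive1 H a + 2 * a * derive1 (derive1 H) a) = kap a) -> 0 <= a ->
  - (3 * derive1 (rescale l) a + 2 * a * derive1 (derive1 (rescale l)) a) =
  l ^- 6 * kap (a / l ^+ 4).
Proof.
move=> l0 Hk a0.
have l0' : l != 0 by rewrite gt_eqF.
rewrite -Hk; last by rewrite divr_ge0 // exprn_ge0 // ltW.
have n1 : nD 1 setT (derive1 H) by have [] := nH 2.
rewrite [derive1 (rescale l)](derive1_scale _ _ _ (nH 1%N)) (derive1_scale _ _ _ n1).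
by field.
Qed.

End Scaled.

(** * Lebesgue measure on the Heisenberg group *)

Section Affine.
Context {R : realType}.
Local Notation leb := (@lebesgue_measure R).
Local Notation mR := (measurableTypeR R).

Lemma measurable_affine (r c : R) :
  measurable_fun setT (fun x : mR => r * x + c : mR).
Proof. by apply: (@measurable_funD _ mR R); first apply: (@measurable_funM _ mR R). Qed.

(** Lebesgue measure is determined by its values on the intervals []a, b]]. For [r < 0] the preimage
    of such an interval is closed on the other side, with the same length. *)
Lemma lebesgue_measure_affine (r c : R) (A : set mR) : r != 0 -> measurable A ->
  leb A = (`|r|%:E * pushforward leb (fun x : mR => r * x + c : mR)%R A)%E.
Proof.
move=> r0 mA.
have r0' : 0 <= `|r| by [].
have mf := measurable_affine r c.
apply: (@lebesgue_measure_unique R (mscale (NngNum r0') (measure_function_pushforward__canonical__measure_function_Measure leb mf))) => //= _ [[a b]] _ <-.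
rewrite /mscale /= /pushforward.
have [rn|rp|/eqP] := ltgtP r 0; last by rewrite (negbTE r0).
- have -> : (fun x : R => r * x + c) @^-1` `]a, b] = `[(b - c) / r, (a - c) / r[%classic.
    apply/seteqP; split => x /=; rewrite !in_itv /= ler_ndivrMr // ltr_ndivlMr //;
    by rewrite lerBrDr ltrBlDr [x * r]mulrC andbC.
  rewrite !lebesgue_measure_itv /= !lte_fin ltr_nM2r ?invr_lt0 // ltrD2r.
  case: ifP => _; last by rewrite mule0.
  rewrite -!EFinB -EFinM ltr0_norm // -mulrBl.
  by rewrite (_ : _ * (_ / _) = b - a) //; field; rewrite lt_eqF.
- have -> : (fun x : R => r * x + c) @^-1` `]a, b] = `](a - c) / r, (b - c) / r]%classic.
    apply/seteqP; split => x /=; rewrite !in_itv /= ler_pdivlMr // ltr_pdivrMr //;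
    by rewrite lerBrDr ltrBlDr [x * r]mulrC.
  rewrite !lebesgue_measure_itv /= !lte_fin ltr_pM2r ?invr_gt0 // ltrD2r.
  case: ifP => _; last by rewrite mule0.
  rewrite -!EFinB -EFinM gtr0_norm // -mulrBl.
  by rewrite (_ : _ * (_ / _) = b - a) //; field; rewrite gt_eqF.
Qed.

Lemma ge0_integral_affine (r c : R) (f : mR -> \bar R) : r != 0 ->
  measurable_fun setT f -> (forall x, 0 <= f x)%E ->
  (\int[leb]_x f x = `|r|%:E * \int[leb]_x f (r * x + c)%R)%E.
Proof.
move=> r0 mf f0; have mg := measurable_affine r c.
have r0' : 0 <= `|r| by [].
pose mu := measure_function_pushforward__canonical__measure_function_Measure leb mg.
rewrite (@eq_measure_integral _ _ _ _ (mscale (NngNum r0') mu)); last first.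
  by move=> A mA _; rewrite [LHS](lebesgue_measure_affine r c).
by rewrite ge0_integral_mscale //= ge0_integral_pushforward.
Qed.

End Affine.

Section Leb3.
Context {R : realType}.
Local Notation leb := (@lebesgue_measure R).
Local Notation mR := (measurableTypeR R).
Local Notation H3 := (mR * mR * mR)%type.
Implicit Types f : H3 -> \bar R.
Local Open Scope ereal_scope.

(** Named so that a sigma-finite measure structure can be attached to it, as Tonelli for the triple
    product requires. *)
Definition leb2 : set (mR * mR)%type -> \bar R := leb \x leb.

HB.instance Definition _ := Measure.on leb2.

Lemma leb2_sigma_finite : sigma_finite setT leb2.
Proof.
pose I (n : nat) : set mR := [set` `[- n%:R, n%:R]%R].
exists (fun n => I n `*` I n).
  apply/seteqP; split => // -[x y] _ /=.
  exists (Num.truncn (Num.max `|x| `|y|)%R).+1 => //; rewrite /I /= !in_itv /= -!ler_norml.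
  by split; apply: le_trans (ltW (truncnS_gt _)); rewrite le_max lexx ?orbT.
move=> n; have mI : measurable (I n) by exact: measurable_itv.
split; first exact: (measurableX mI mI).
have fI : leb (I n) < +oo.
  by rewrite lebesgue_measure_itv /=; case: ifP => // _; rewrite -EFinB ltry.
by rewrite /leb2 (product_measure1E leb leb mI mI) lte_mul_pinfty ?ge0_fin_numE.
Qed.

HB.instance Definition _ :=
  Measure_isSigmaFinite.Build _ _ _ leb2 leb2_sigma_finite.

Lemma leb3E f : measurable_fun setT f -> (forall g, 0 <= f g) ->
  \int[leb3]_g f g = \int[leb]_x \int[leb]_y \int[leb]_s f (x, y, s).
Proof.
move=> mf f0.
transitivity (\int[leb2]_p \int[leb]_s f (p, s)).
  exact: (@fubini_tonelli1 _ _ _ _ R leb2 leb f mf f0).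
have mF := measurable_fun_fubini_tonelli_F f mf f0.
apply: (@fubini_tonelli1 _ _ _ _ R leb leb (fun p => \int[leb]_s f (p, s))).
  exact: mF.
by move=> p; apply: integral_ge0.
Qed.

HB.instance Definition _ := Measure.on (@leb3 R).

Lemma leb3_cube (r : R) :
  let I := [set` `[- r, r]%R] : set mR in
  measurable ((I `*` I) `*` I : set H3) /\ leb3 ((I `*` I) `*` I) < +oo.
Proof.
move=> I; have mI : measurable I by exact: measurable_itv.
have mII := measurableX mI mI.
split; first exact: (measurableX mII mI).
have fI : leb I < +oo.
  by rewrite lebesgue_measure_itv /=; case: ifP => // _; rewrite -EFinB ltry.
rewrite /leb3 (product_measure1E leb2 leb mII mI).
have f2 : leb2 (I `*` I) < +oo.
  by rewrite /leb2 (product_measure1E leb leb mI mI) lte_mul_pinfty ?ge0_fin_numE.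
apply: lte_mul_pinfty; [exact: measure_ge0| |exact: fI].
rewrite ge0_fin_numE; [exact: f2|exact: measure_ge0].
Qed.

Lemma leb3_sigma_finite : sigma_finite setT (@leb3 R).
Proof.
exists (fun n => let I := [set` `[- n%:R, n%:R]%R] : set mR in (I `*` I) `*` I).
  apply/seteqP; split => // -[[x y] s] _ /=.
  exists (Num.truncn (Num.max (Num.max `|x| `|y|) `|s|)%R).+1 => //.
  rewrite /= !in_itv /= -!ler_norml.
  by split; first split; apply: le_trans (ltW (truncnS_gt _)); rewrite !le_max lexx ?orbT.
by move=> n; exact: leb3_cube.
Qed.

HB.instance Definition _ :=
  Measure_isSigmaFinite.Build _ _ _ (@leb3 R) leb3_sigma_finite.

Lemma measurable_hx : measurable_fun setT (fun g : H3 => g.1.1).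
Proof. exact: (measurableT_comp measurable_fst measurable_fst). Qed.

Lemma measurable_hy : measurable_fun setT (fun g : H3 => g.1.2).
Proof. exact: (measurableT_comp measurable_snd measurable_fst). Qed.

Lemma measurable_hs : measurable_fun setT (fun g : H3 => g.2).
Proof. exact: measurable_snd. Qed.

Lemma measurable_heis (u v w : H3 -> mR) : measurable_fun setT u ->
  measurable_fun setT v -> measurable_fun setT w ->
  measurable_fun setT (fun g => (u g, v g, w g) : H3).
Proof. by move=> mu mv mw; do 2 apply: measurable_fun_pair => //. Qed.

(** Integrating in [sigma] first, the shear [a x + b y] is a mere translation. One statement thus
    covers the dilations, the left translations and the reflections. *)
Lemma leb3_affine (r1 r2 r3 c1 c2 c3 a b : R) f :
  (r1 != 0)%R -> (r2 != 0)%R -> (r3 != 0)%R ->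
  measurable_fun setT f -> (forall g, 0 <= f g) ->
  \int[leb3]_g f g = `|r1 * r2 * r3|%:E *
    \int[leb3]_g f (r1 * g.1.1 + c1, r2 * g.1.2 + c2,
       r3 * g.2 + (a * g.1.1 + b * g.1.2 + c3))%R.
Proof.
move=> r10 r20 r30 mf f0.
pose T (g : H3) : H3 := (r1 * g.1.1 + c1, r2 * g.1.2 + c2,
  r3 * g.2 + (a * g.1.1 + b * g.1.2 + c3))%R.
have mx := measurable_hx; have my := measurable_hy; have ms := measurable_hs.
have mT : measurable_fun setT T.
  have mZ (k : R) (u : H3 -> mR) : measurable_fun setT u ->
      measurable_fun setT (fun g => k * u g : mR)%R.
    by move=> mu; apply: (@measurable_funM _ H3 R) => //; exact: measurable_cst.
  have mC (k : R) (u : H3 -> mR) : measurable_fun setT u ->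
      measurable_fun setT (fun g => u g + k : mR)%R.
    by move=> mu; apply: (@measurable_funD _ H3 R) => //; exact: measurable_cst.
  apply: measurable_heis.
  - exact: (mC c1 _ (mZ r1 _ mx)).
  - exact: (mC c2 _ (mZ r2 _ my)).
  apply: (@measurable_funD _ H3 R); first exact: (mZ r3 _ ms).
  have mab := @measurable_funD _ H3 R _ _ _ (mZ a _ mx) (mZ b _ my).
  exact: (mC c3 _ mab).
have mg : measurable_fun setT (f \o T) by exact: measurableT_comp mf mT.
have g0 h : 0 <= (f \o T) h by exact: f0.
have mF2 := measurable_fun_fubini_tonelli_F (m2 := leb) f mf f0.
have mG2 := measurable_fun_fubini_tonelli_F (m2 := leb) (f \o T) mg g0.
set F2 := fubini_F _ _ in mF2; set G2 := fubini_F _ _ in mG2.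
have F20 p : 0 <= F2 p by exact: integral_ge0.
have G20 p : 0 <= G2 p by exact: integral_ge0.
have mF1 := measurable_fun_fubini_tonelli_F (m2 := leb) F2 mF2 F20.
have mG1 := measurable_fun_fubini_tonelli_F (m2 := leb) G2 mG2 G20.
set F1 := fubini_F _ _ in mF1; set G1 := fubini_F _ _ in mG1.
have F10 x : 0 <= F1 x by exact: integral_ge0.
have G10 x : 0 <= G1 x by exact: integral_ge0.
rewrite (leb3E f) // (leb3E (f \o T)) //.
have E2 x y : F2 (r1 * x + c1, r2 * y + c2)%R = `|r3|%:E * G2 (x, y).
  apply: (ge0_integral_affine r3 (a * x + b * y + c3)%R (fun s => f (_, _, s))) => //.
  exact: (measurableT_comp mf (measurable_pair1 _)).
have E1 x : F1 (r1 * x + c1)%R = (`|r2| * `|r3|)%:E * G1 x.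
  transitivity (`|r2|%:E * \int[leb]_y F2 (r1 * x + c1, r2 * y + c2)%R).
    apply: (ge0_integral_affine r2 c2 (fun y => F2 (_, y))) => //.
    exact: (measurableT_comp mF2 (measurable_pair1 _)).
  rewrite EFinM -muleA; congr (_ * _).
  transitivity (\int[leb]_y (`|r3|%:E * G2 (x, y))).
    by apply: eq_integral => y _; exact: E2.
  apply: ge0_integralZl => //.
  exact: (measurableT_comp mG2 (measurable_pair1 _)).
transitivity (`|r1|%:E * \int[leb]_x F1 (r1 * x + c1)%R).
  exact: (ge0_integral_affine r1 c1 F1).
rewrite normrM normrM -mulrA EFinM -muleA; congr (_ * _).
transitivity (\int[leb]_x ((`|r2| * `|r3|)%:E * G1 x)).
  by apply: eq_integral => x _; exact: E1.
exact: ge0_integralZl.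
Qed.

Lemma leb3_swap f : measurable_fun setT f -> (forall g, 0 <= f g) ->
  \int[leb3]_g f g = \int[leb3]_g f (g.1.2, g.1.1, g.2).
Proof.
move=> mf f0.
have mx := measurable_hx; have my := measurable_hy; have ms := measurable_hs.
pose h (g : H3) := f (g.1.2, g.1.1, g.2).
have mh : measurable_fun setT h.
  by apply: (measurableT_comp mf); exact: measurable_heis.
have h0 g : 0 <= h g by exact: f0.
rewrite (leb3E f mf f0) (leb3E h mh h0).
have mF2 := measurable_fun_fubini_tonelli_F (m2 := leb) f mf f0.
apply: (fubini_tonelli (m1 := leb) (m2 := leb) _ mF2) => p.
exact: integral_ge0.
Qed.

End Leb3.

(** * Integrals of a function against concentrated and spread-out bumps *)

Section Kernel.
Context d (T : measurableType d) (R : realType).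
Variable mu : {measure set T -> \bar R}.
Implicit Types G psi : T -> R.

Lemma integrable_kernel G psi (K : set T) (b : R) : measurable K ->
  measurable_fun setT G -> measurable_fun setT psi ->
  (\int[mu]_(x in K) `|G x|%:E < +oo)%E ->
  (forall x, `|psi x| <= b) -> (forall x, ~ K x -> psi x = 0) ->
  mu.-integrable setT (EFin \o (fun x => G x * psi x)).
Proof.
move=> mK mG mpsi fG bpsi psi0.
have mGp : measurable_fun setT (fun x => G x * psi x) by exact: measurable_funM.
have iG : mu.-integrable setT (EFin \o (G \_ K)).
  rewrite -restrict_EFin; apply: (proj1 (integrable_mkcond _ mK)).
  apply/integrableP; split; first by apply/measurable_EFinP; exact: measurable_funTS.
  exact: fG.
apply: (le_integrable measurableT _ _ (integrableZl measurableT b iG)) => //; first exact/measurable_EFinP.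
move=> x _; rewrite /= lee_fin normrM /patch; case: ifPn => [xK|xK].
  by rewrite normrM mulrC ler_wpM2r // (le_trans (bpsi x)) // ler_norm.
rewrite psi0; first by rewrite normr0 mulr0 mulr0 normr0.
by move=> /mem_set; apply/negP.
Qed.

(** For bumps concentrating at a point of continuity: on the support of [psi] the function [G] is
    within [e] of its value [v] there. *)
Lemma kernel_close G psi (v e : R) :
  mu.-integrable setT (EFin \o psi) ->
  mu.-integrable setT (EFin \o (fun x => G x * psi x)) ->
  (forall x, 0 <= psi x) -> (forall x, psi x != 0 -> `|G x - v| <= e) ->
  `|\int[mu]_x (G x * psi x) - v * \int[mu]_x psi x|%R <=
    e * \int[mu]_x psi x.
Proof.
move=> ip iGp p0 Gv.
have ivp : mu.-integrable setT (EFin \o (fun x => v * psi x)).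
  have := integrableZl measurableT v ip; apply: eq_integrable => // x _.
have iep : mu.-integrable setT (EFin \o (fun x => e * psi x)).
  have := integrableZl measurableT e ip; apply: eq_integrable => // x _.
have iB : mu.-integrable setT (EFin \o (fun x => G x * psi x - v * psi x)).
  have := integrableB measurableT iGp ivp; apply: eq_integrable => // x _.
rewrite -(RintegralZl v) // -RintegralB // -(RintegralZl e) //.
apply: le_trans (le_normr_Rintegral _ iB) _ => //.
apply: le_Rintegral => //; first exact: integrable_norm iB.
move=> x _; rewrite -mulrBl normrM (ger0_norm (p0 x)).
have [->|px] := eqVneq (psi x) 0; first by rewrite !mulr0.
by rewrite ler_wpM2r // Gv.
Qed.

(** For bumps spreading out: on [K] the smallness comes from the height [b] of [psi], off [K] from
    that of [G]. *)
Lemma kernel_small G psi (K : set T) (b e : R) : measurable K ->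
  measurable_fun setT G -> (\int[mu]_(x in K) `|G x|%:E < +oo)%E ->
  mu.-integrable setT (EFin \o psi) ->
  mu.-integrable setT (EFin \o (fun x => G x * psi x)) ->
  (forall x, 0 <= psi x <= b) -> (forall x, ~ K x -> `|G x| <= e) -> 0 <= e ->
  `|\int[mu]_x (G x * psi x)|%R <=
    b * \int[mu]_(x in K) `|G x| + e * \int[mu]_x psi x.
Proof.
move=> mK mG fG ip iGp pb Ge e0.
have iG : mu.-integrable setT (EFin \o ((Num.norm \o G) \_ K)).
  rewrite -restrict_EFin; apply: (proj1 (integrable_mkcond _ mK)).
  apply/integrableP; split.
    by apply/measurable_EFinP; apply: measurable_funTS; exact: measurableT_comp.
  by under eq_integral do rewrite /= normr_id.
have ibG : mu.-integrable setT (EFin \o (fun x => b * ((Num.norm \o G) \_ K) x)).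
  have := integrableZl measurableT b iG; apply: eq_integrable => // x _.
have iep : mu.-integrable setT (EFin \o (fun x => e * psi x)).
  have := integrableZl measurableT e ip; apply: eq_integrable => // x _.
have iD : mu.-integrable setT (EFin \o (fun x => b * ((Num.norm \o G) \_ K) x + e * psi x)).
  have := integrableD measurableT ibG iep; apply: eq_integrable => // x _.
rewrite [X in b * X](Rintegral_mkcond mu K) -(RintegralZl b) // -(RintegralZl e) // -RintegralD //.
apply: le_trans (le_normr_Rintegral _ iGp) _ => //.
apply: le_Rintegral => //; first exact: integrable_norm iGp.
move=> x _; have /andP[p0 p1] := pb x.
rewrite normrM (ger0_norm p0) /patch; case: ifPn => [xK|xK].
  by rewrite /= mulrC ler_wpDr ?mulr_ge0 // ler_wpM2r.
rewrite mulr0 add0r ler_wpM2r // Ge //.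
by move=> /mem_set; apply/negP.
Qed.

End Kernel.

Section Measurability.
Context {R : realType}.
Local Notation mR := (measurableTypeR R).
Local Notation H3 := (mR * mR * mR)%type.

Lemma measurable_H3 d (U : measurableType d) (f : heis R -> U) :
  measurable_fun setT f -> measurable_fun setT (f : H3 -> U).
Proof. by []. Qed.

Lemma measurable_zsq : measurable_fun setT (fun g : H3 => zsq g).
Proof.
apply: (@measurable_funD _ H3 R); apply: (@measurable_funX _ H3 R).
  exact: measurable_hx.
exact: measurable_hy.
Qed.

Lemma measurable_N4 : measurable_fun setT (fun g : H3 => N4 g).
Proof.
apply: (@measurable_funD _ H3 R).
  by apply: (@measurable_funX _ H3 R); exact: measurable_zsq.
apply: (@measurable_funM _ H3 R); first exact: measurable_cst.
by apply: (@measurable_funX _ H3 R); exact: measurable_hs.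
Qed.

Lemma measurable_ltr (h : heis R) : measurable_fun setT (fun g : H3 => ltr h g : H3).
Proof.
have mx := @measurable_hx R; have my := @measurable_hy R; have ms := @measurable_hs R.
have mC (k : R) (u : H3 -> R) : measurable_fun setT u ->
    measurable_fun setT (fun g => u g - k).
  by move=> mu; apply: (@measurable_funB _ H3 R) => //; exact: measurable_cst.
have mZ (k : R) (u : H3 -> R) : measurable_fun setT u ->
    measurable_fun setT (fun g => k * u g).
  by move=> mu; apply: (@measurable_funM _ H3 R) => //; exact: measurable_cst.
have mZr (k : R) (u : H3 -> R) : measurable_fun setT u ->
    measurable_fun setT (fun g => u g * k).
  by move=> mu; apply: (@measurable_funM _ H3 R) => //; exact: measurable_cst.
apply: measurable_heis; [exact: (mC _ _ mx)|exact: (mC _ _ my)|].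
apply: (@measurable_funB _ H3 R); first exact: (mC _ _ ms).
apply: (mZr _ (fun g => _ - _)).
by apply: (@measurable_funB _ H3 R); [exact: (mZ _ _ my)|exact: (mZr _ _ mx)].
Qed.

End Measurability.

(** * Dilations, left translations and gauge bumps *)

Section Bump.
Context {R : realType}.
Local Notation mR := (measurableTypeR R).
Local Notation H3 := (mR * mR * mR)%type.
Implicit Types g h : heis R.

Lemma zsq_ge0 g : 0 <= zsq g.
Proof. by rewrite addr_ge0 ?sqr_ge0. Qed.

Lemma N4_ge0 g : 0 <= N4 g.
Proof. by apply: addr_ge0; [exact: sqr_ge0|exact: mulr_ge0 (ler0n _ _) (sqr_ge0 _)]. Qed.

Lemma N4_eq0 g : N4 g = 0 -> g = 0.
Proof.
move: g => [[x y] s]; rewrite /N4 /zsq /= => h.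
have x2 := sqr_ge0 x; have y2 := sqr_ge0 y; have s2 := sqr_ge0 s.
have z4 := sqr_ge0 (x ^+ 2 + y ^+ 2).
have /eqP : (x ^+ 2 + y ^+ 2) ^+ 2 = 0 by lra.
rewrite expf_eq0 /= => /eqP z0.
have /eqP : x ^+ 2 = 0 by lra.
have /eqP : y ^+ 2 = 0 by lra.
have /eqP : s ^+ 2 = 0 by lra.
by rewrite !expf_eq0 /= => /eqP -> /eqP -> /eqP ->.
Qed.

Lemma zsq_le_N4 g : zsq g ^+ 2 <= N4 g.
Proof. by rewrite lerDl; exact: mulr_ge0 (ler0n _ _) (sqr_ge0 _). Qed.

Definition dil (l : R) g : heis R := (l * g.1.1, l * g.1.2, l ^+ 2 * g.2).

Lemma zsq_dil l g : zsq (dil l g) = l ^+ 2 * zsq g.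
Proof. by rewrite /zsq /=; ring. Qed.

Lemma N4_dil l g : N4 (dil l g) = l ^+ 4 * N4 g.
Proof. by rewrite /N4 zsq_dil /=; ring. Qed.

Lemma measurable_dil (l : R) : measurable_fun setT (fun g : H3 => dil l g : H3).
Proof.
apply: measurable_heis.
- by apply: (@measurable_funM _ H3 R); [exact: measurable_cst|exact: measurable_hx].
- by apply: (@measurable_funM _ H3 R); [exact: measurable_cst|exact: measurable_hy].
- by apply: (@measurable_funM _ H3 R); [exact: measurable_cst|exact: measurable_hs].
Qed.

Lemma leb3_dil (l : R) (f : H3 -> \bar R) : 0 < l ->
  measurable_fun setT f -> (forall g, 0 <= f g)%E ->
  (\int[leb3]_g f g = (l ^+ 4)%:E * \int[leb3]_g f (dil l g))%E.
Proof.
move=> l0 mf f0; have ln0 : l != 0 by rewrite gt_eqF.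
have l2 : l ^+ 2 != 0 by rewrite expf_eq0 /= (negbTE ln0).
rewrite (leb3_affine l l (l ^+ 2) 0 0 0 0 0) //.
have -> : `|l * l * l ^+ 2| = l ^+ 4.
  by rewrite ger0_norm ?mulr_ge0 ?exprn_ge0 // ?ltW //; ring.
congr (_ * _)%E; apply: eq_integral => g _; congr (f _).
by rewrite /dil !addr0 !mul0r !addr0.
Qed.

(** In these coordinates a left translation is a shear followed by a shift, of Jacobian [1]. *)
Lemma leb3_translate (h : heis R) (f : H3 -> \bar R) :
  measurable_fun setT f -> (forall g, 0 <= f g)%E ->
  (\int[leb3]_g f (ltr h g) = \int[leb3]_g f g)%E.
Proof.
move=> mf f0; apply/esym.
rewrite (leb3_affine 1 1 1 (- h.1.1) (- h.1.2) (- h.2) (h.1.2 / 2) (- h.1.1 / 2)) //.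
rewrite !mulr1 normr1 mul1e; apply: eq_integral => g _; congr (f _).
by rewrite /ltr !mul1r; congr (_, _, _); field.
Qed.

Variables (kap : R -> R) (c : R).
Hypotheses (c4 : c <= 4) (kap_cont : continuous kap)
  (kap01 : forall a, 0 <= kap a <= 1) (kap0 : forall a, c <= a -> kap a = 0).

(** This is [- laplH] of the potential rescaled by [l]. Its integral does not depend on [l]: the
    Jacobian gives [l^4], the factor [zsq] gives [l^2], and both are absorbed by [l^-6]. *)
Definition hbump (l : R) g : R := 8 * zsq g * (l ^- 6 * kap (N4 g / l ^+ 4)).

Lemma bump_bound (l : R) g : 0 < l -> 0 <= hbump l g <= 16 * l ^- 4.
Proof.
move=> l0; have /andP[k0 k1] := kap01 (N4 g / l ^+ 4).
have lX n : 0 < l ^+ n by rewrite exprn_gt0.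
rewrite /hbump; apply/andP; split.
  by rewrite !mulr_ge0 ?zsq_ge0 // invr_ge0 exprn_ge0 // ltW.
have [ca|ac] := leP c (N4 g / l ^+ 4).
  by rewrite kap0 // !mulr0 mulr_ge0 // invr_ge0 exprn_ge0 // ltW.
(* On the support, [zsq^2 <= N4 < c l^4 <= 4 l^4]; this gives the height [8 * 2 l^2 * l^-6]. *)
have z2 : zsq g <= 2 * l ^+ 2.
  rewrite -(ler_pXn2r (ltn0Sn 1)) ?nnegrE ?zsq_ge0 ?mulr_ge0 ?(ltW l0) //.
  apply: le_trans (zsq_le_N4 g) _.
  rewrite ltr_pdivrMr // in ac; apply: le_trans (ltW ac) _.
  have -> : (2 * l ^+ 2) ^+ 2 = 4 * l ^+ 4 by ring.
  by rewrite ler_wpM2r // ltW.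
have -> : 16 * l ^- 4 = 8 * (2 * l ^+ 2) * (l ^- 6 * 1).
  by field; rewrite gt_eqF.
rewrite ler_pM //; last 2 first.
- by rewrite ler_pM2l.
- by rewrite ler_pM2l // invr_gt0.
- by rewrite mulr_ge0 ?zsq_ge0.
- by rewrite mulr_ge0 // invr_ge0 ltW.
Qed.

Lemma bump_supp (l : R) g : 0 < l -> hbump l g != 0 -> N4 g < c * l ^+ 4.
Proof.
move=> l0; apply: contraNlt; rewrite -ler_pdivlMr ?exprn_gt0 // => /kap0 h.
by rewrite /hbump h !mulr0.
Qed.

Lemma measurable_bump (l : R) : measurable_fun setT (hbump l : H3 -> R).
Proof.
apply: (@measurable_funM _ H3 R).
  by apply: (@measurable_funM _ H3 R); [exact: measurable_cst|exact: measurable_zsq].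
apply: (@measurable_funM _ H3 R); first exact: measurable_cst.
have mk : measurable_fun setT kap by exact: continuous_measurable_fun.
have mq : measurable_fun setT (fun g : H3 => N4 g / l ^+ 4).
  by apply: (@measurable_funM _ H3 R); [exact: measurable_N4|exact: measurable_cst].
exact: (measurableT_comp mk mq).
Qed.

Lemma bump_mass (l : R) : 0 < l ->
  (\int[leb3]_g (hbump l g)%:E = \int[leb3]_g (hbump 1 g)%:E)%E.
Proof.
move=> l0; have ln0 : l != 0 by rewrite gt_eqF.
have m l' : measurable_fun setT (EFin \o hbump l' : H3 -> \bar R).
  by apply/measurable_EFinP; exact: measurable_bump.
have p l' g : 0 < l' -> (0 <= (hbump l' g)%:E)%E.
  by move=> l'0; rewrite lee_fin; have /andP[] := bump_bound l' g l'0.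
rewrite (leb3_dil l (EFin \o hbump l)) //; last by move=> g; exact: p.
transitivity ((l ^+ 4)%:E * \int[leb3]_g ((l ^- 4)%:E * (hbump 1 g)%:E))%E.
  congr (_ * _)%E; apply: eq_integral => g _; rewrite /= -EFinM; congr EFin.
  rewrite /hbump zsq_dil N4_dil !expr1n invr1 mul1r mulr1.
  have -> : l ^+ 4 * N4 g / l ^+ 4 = N4 g by field.
  by field.
rewrite ge0_integralZl //; last 3 first.
- exact: m.
- by move=> g _; exact: p.
- by rewrite lee_fin invr_ge0 exprn_ge0 // ltW.
by rewrite muleA -EFinM divff ?mul1e // expf_eq0.
Qed.

End Bump.

Section Mass.
Context {R : realType}.
Local Notation mR := (measurableTypeR R).
Local Notation H3 := (mR * mR * mR)%type.

Definition gball (r : R) : set H3 := [set g | N4 g < r ^+ 4].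

Lemma measurable_gball r : measurable (gball r).
Proof.
rewrite (_ : gball r = setT `&` (fun g : H3 => N4 g) @^-1` `]-oo, r ^+ 4[).
  by apply: measurable_N4 => //; exact: measurable_itv.
by rewrite setTI; apply/seteqP; split => g; rewrite /gball /= in_itv.
Qed.

Lemma leb3_gball_lty r : (leb3 (gball r) < +oo)%E.
Proof.
have [mB fB] := leb3_cube (r ^+ 4 + 2).
apply: le_lt_trans fB; apply: le_measure; rewrite ?inE //; first exact: measurable_gball.
move=> g; rewrite /gball /= => gr.
have r0 : 0 < r ^+ 4 by apply: le_lt_trans gr; exact: N4_ge0.
have z0 := zsq_ge0 g; have z1 := zsq_le_N4 g.
have z2 : zsq g <= r ^+ 4 + 1 by nra.
have s1 : `|g.2| <= r ^+ 4 + 2.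
  rewrite ler_norml; have := gr; rewrite /N4 => gr2.
  have := sqr_ge0 (zsq g); have := sqr_ge0 g.2 => s0 z4; apply/andP; split; nra.
have x1 : `|g.1.1| <= r ^+ 4 + 2.
  rewrite ler_norml; have := z2; rewrite /zsq => gr2.
  have := sqr_ge0 g.1.1; have := sqr_ge0 g.1.2 => s0 z4; apply/andP; split; nra.
have y1 : `|g.1.2| <= r ^+ 4 + 2.
  rewrite ler_norml; have := z2; rewrite /zsq => gr2.
  have := sqr_ge0 g.1.1; have := sqr_ge0 g.1.2 => s0 z4; apply/andP; split; nra.
by rewrite /= !in_itv /= -!ler_norml.
Qed.

Variables (kap : R -> R) (c : R).
Hypotheses (c4 : c <= 4) (kap_cont : continuous kap)
  (kap01 : forall a, 0 <= kap a <= 1) (kap0 : forall a, c <= a -> kap a = 0).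

Lemma integrable_bump (l : R) : 0 < l ->
  (@leb3 R).-integrable setT (EFin \o (hbump kap l : H3 -> R)).
Proof.
move=> l0.
have mb := measurable_bump kap kap_cont l.
have i1 : (@leb3 R).-integrable (gball (2 * l)) (EFin \o (hbump kap l : H3 -> R)).
  apply: measurable_bounded_integrable.
  - exact: measurable_gball.
  - exact: leb3_gball_lty.
  - exact: measurable_funTS.
  - exists (16 * l ^- 4); split; first exact: num_real.
    move=> M /ltW cM g _ /=; have /andP[b0 b1] := bump_bound kap c c4 kap01 kap0 l g l0.
    by rewrite ger0_norm // (le_trans b1).
apply: eq_integrable (proj1 (integrable_mkcond _ (measurable_gball _)) i1) => //.
move=> g _; rewrite /patch; case: ifPn => // /negP gn; apply/esym; congr EFin.
apply/eqP; apply: contra_notT gn => /(bump_supp kap c kap0 l g l0) h.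
rewrite inE /gball /= exprMn; apply: lt_le_trans h _.
rewrite ler_wpM2r ?exprn_ge0 ?(ltW l0) //; apply: le_trans c4 _.
by rewrite -natrX ler_nat.
Qed.

Lemma bump_mass_ge : (forall a, a <= 1 -> kap a = 1) ->
  (8%:E * \int[leb3]_(g in gball 1) (zsq g)%:E <=
   \int[leb3]_g (hbump kap 1 g : R)%:E)%E.
Proof.
move=> k1; rewrite -ge0_integralZl //; last 3 first.
- exact: measurable_gball.
- by apply/measurable_EFinP; apply: measurable_funTS; exact: measurable_zsq.
- by move=> g _; rewrite lee_fin zsq_ge0.
have b0 g : (0 <= (hbump kap 1 g)%:E)%E.
  by rewrite lee_fin; have /andP[] := bump_bound kap c c4 kap01 kap0 1 g ltr01.
apply: (@le_trans _ _ (\int[leb3]_(g in gball 1) (hbump kap 1 g : R)%:E)%E).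
  apply: ge0_le_integral => //.
  - exact: measurable_gball.
  - by move=> g _; rewrite mule_ge0 // lee_fin zsq_ge0.
  - apply: measurable_funTS; apply/measurable_EFinP.
    by apply: (@measurable_funM _ H3 R); [exact: measurable_cst|exact: measurable_zsq].
  - apply: measurable_funTS; apply/measurable_EFinP.
    exact: measurable_bump.
  - move=> g; rewrite /gball /= expr1n => gr; rewrite -EFinM lee_fin /hbump !expr1n invr1 mul1r.
    by rewrite k1 mulr1 // ltW.
apply: ge0_subset_integral => //; first exact: measurable_gball.
by apply/measurable_EFinP; exact: measurable_bump.
Qed.

End Mass.

(** * The fundamental solution *)

Lemma derive1B {R : realType} (f g : R -> R) : nD 1 setT f -> nD 1 setT g ->
  derive1 (fun a => f a - g a) = (fun a => derive1 f a - derive1 g a).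
Proof.
move=> [df _] [dg _]; apply/funext => a; rewrite !derive1E.
have h1 : is_derive a (1 : R) f ('D_1 f a) by apply/derivableP/df.
have h2 : is_derive a (1 : R) g ('D_1 g a) by apply/derivableP/dg.
by have := is_deriveB h1 h2; move=> /(@derive_val _ _ _ _ _ _ _).
Qed.

Section Representation.
Context {R : realType}.
Local Notation mR := (measurableTypeR R).
Local Notation H3 := (mR * mR * mR)%type.
Variables (Gam : heis R -> R) (hGam : fundamental_solution Gam).
Variables (H kap : R -> R) (c G : R).
Hypotheses (c1 : 1 < c) (c4 : c <= 4) (nH : forall n, nD n setT H)
  (HG : forall a, c <= a -> H a = G * a `^ (- 2^-1))
  (Hk : forall a, 0 <= a ->
     - (3 * derive1 H a + 2 * a * derive1 (derive1 H) a) = kap a)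
  (kc : continuous kap) (k01 : forall a, 0 <= kap a <= 1)
  (k1 : forall a, a <= 1 -> kap a = 1) (k0 : forall a, c <= a -> kap a = 0).

(** A nonnegative bump of width [l] around [h] with integral [mass], hence [mass] times an
    approximate identity as [l] tends to [0]. *)
Definition psi (h : heis R) (l : R) (g : H3) : R := hbump kap l (ltr h g).

Let mass : R := \int[leb3]_g (hbump kap 1 g).

Lemma rescale_far (l a : R) : 0 < l -> c * l ^+ 4 <= a ->
  rescale H l a = G * a `^ (- 2^-1).
Proof.
move=> l0 ca; rewrite /rescale HG; last by rewrite ler_pdivlMr ?exprn_gt0.
have a0 : 0 < a by apply: lt_le_trans ca; rewrite mulr_gt0 ?exprn_gt0 ?(lt_trans _ c1).
have l4 : (l ^+ 4)^-1 `^ (- 2^-1) = l ^+ 2.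
  rewrite powRN -(powR_inv1 (exprn_ge0 4 (ltW l0))) -powRrM mulN1r powRN invrK.
  rewrite powR12_sqrt ?exprn_ge0 ?ltW // (_ : l ^+ 4 = (l ^+ 2) ^+ 2) -?exprM //.
  by rewrite exprM sqrtr_sqr ger0_norm // exprn_ge0 // ltW.
rewrite powRM ?(ltW a0) ?invr_ge0 ?exprn_ge0 ?(ltW l0) // l4.
by field; rewrite gt_eqF.
Qed.

Lemma N4_ltr0 (h : heis R) : N4 (ltr h 0) = N4 h.
Proof. by rewrite /N4 /zsq /ltr /=; field. Qed.

Lemma measurable_psi h l : measurable_fun setT (psi h l).
Proof. exact: (measurableT_comp (measurable_bump kap kc l) (measurable_ltr h)). Qed.

Lemma psi_bound h l g : 0 < l -> 0 <= psi h l g <= 16 * l ^- 4.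
Proof. by move=> l0; exact: (bump_bound kap c). Qed.

Lemma integral_psi h l : 0 < l ->
  (\int[leb3]_g (psi h l g)%:E = \int[leb3]_g (hbump kap 1 g : R)%:E)%E.
Proof.
move=> l0; rewrite -(bump_mass kap c c4 kc k01 k0 l l0).
apply: (leb3_translate h (fun g => (hbump kap l g)%:E)).
  by apply/measurable_EFinP; exact: measurable_bump.
by move=> g; rewrite lee_fin; have /andP[] := bump_bound kap c c4 k01 k0 l g l0.
Qed.

Lemma integrable_psi h l : 0 < l ->
  (@leb3 R).-integrable setT (EFin \o psi h l).
Proof.
move=> l0; apply/integrableP; split.
  by apply/measurable_EFinP; exact: measurable_psi.
have /integrableP[_] := integrable_bump kap c c4 kc k01 k0 1 ltr01.
have ab (f : H3 -> R) : (forall g, 0 <= f g) -> (\int[leb3]_g `|(EFin \o f) g| = \int[leb3]_g (f g)%:E)%E.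
  by move=> f0; apply: eq_integral => g _; rewrite /= ger0_norm.
rewrite ab; last by move=> g; have /andP[] := bump_bound kap c c4 k01 k0 1 g ltr01.
rewrite ab; last by move=> g; have /andP[] := psi_bound h l g l0.
by rewrite integral_psi.
Qed.

Lemma Rintegral_psi h l : 0 < l -> (\int[leb3]_g psi h l g)%R = mass.
Proof. by move=> l0; rewrite /mass /Rintegral integral_psi. Qed.

Lemma measurable_Gam : measurable_fun setT (Gam : H3 -> R).
Proof. exact: (measurable_H3 _ _ _ (fsol_measurable hGam)). Qed.

(** The pole meant here is the centre [h] of the translated potential, not the pole [0] of [Gam]. *)
Definition near_pole h l : set H3 := [set g | N4 (ltr h g) <= c * l ^+ 4].

Lemma measurable_near_pole h l : measurable (near_pole h l).
Proof.
rewrite (_ : near_pole h l = setT `&` (fun g : H3 => N4 (ltr h g)) @^-1` `]-oo, c * l ^+ 4]).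
  have mc : measurable_fun setT (fun g : H3 => N4 (ltr h g)).
    exact: (measurableT_comp measurable_N4 (measurable_ltr h)).
  by apply: mc => //; exact: measurable_itv.
by rewrite setTI; apply/seteqP; split => g; rewrite /near_pole /= in_itv.
Qed.

Lemma psi_supp h l g : 0 < l -> ~ near_pole h l g -> psi h l g = 0.
Proof.
move=> l0 ng; apply/eqP; apply: contra_notT ng => /(bump_supp kap c k0 _ _ l0).
exact: ltW.
Qed.

Lemma integrable_Gam_psi h l : 0 < l ->
  (@leb3 R).-integrable setT (EFin \o (fun g => Gam g * psi h l g)).
Proof.
move=> l0; apply: (@integrable_kernel _ H3 R leb3 Gam (psi h l) (near_pole h l) (16 * l ^- 4)).
- exact: measurable_near_pole.
- exact: measurable_Gam.
- exact: measurable_psi.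
- apply: (fsol_locally_integrable hGam); exact: N4_ltr_compact.
- by move=> g; have /andP[p0 p1] := psi_bound h l g l0; rewrite ger0_norm.
- by move=> g; exact: psi_supp.
Qed.

(* Beyond [c m^4] the two rescaled potentials coincide, so their difference is a
   test function. *)
Lemma representation h (l m : R) : 0 < l -> l <= m ->
  (\int[leb3]_g (Gam g * psi h l g) - \int[leb3]_g (Gam g * psi h m g) =
   rescale H l (N4 h) - rescale H m (N4 h))%R.
Proof.
move=> l0 lm; have m0 : 0 < m by apply: lt_le_trans lm.
rewrite -RintegralB //; last 2 first.
- exact: integrable_Gam_psi.
- exact: integrable_Gam_psi.
pose F (a : R) : R := rescale H l a - rescale H m a.
have nF n : nD n setT F.
  have oT := @openT R.
  have -> : F = rescale H l \+ (cst (-1) \* rescale H m).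
    by apply/funext => a; rewrite /F /= mulN1r.
  apply: (nDD oT); first exact: nD_rescale.
  by apply: (nDM oT); [exact: nD_cst|exact: nD_rescale].
have F0 a : c * m ^+ 4 <= a -> F a = 0.
  move=> ca; rewrite /F !rescale_far ?subrr //.
  apply: le_trans ca; rewrite ler_wpM2l ?(ltW (lt_trans _ c1)) //.
  by rewrite lerXn2r ?nnegrE // ltW.
(* The test function is evaluated at the identity, where its argument is [N4 (h^-1) = N4 h]. *)
have := fsol_eq hGam (test_function_radial h F _ nF F0).
rewrite N4_ltr0 => e.
have {e} : (\int[leb3]_g (Gam g * psi h l g - Gam g * psi h m g)%:E = (F (N4 h))%:E)%E.
  rewrite -e; apply: eq_integral => g _; congr EFin.
  rewrite laplH_radial // -mulrBr; congr (_ * _).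
  set a := N4 (ltr h g); have a0 : 0 <= a by exact: N4_ge0.
  have n1 l' : nD 1 setT (rescale H l') by exact: nD_rescale.
  have n1' l' : nD 1 setT (derive1 (rescale H l')) by have [] := nD_rescale H nH 2 l'.
  rewrite (derive1B _ _ (n1 l) (n1 m)) (derive1B _ _ (n1' l) (n1' m)).
  have el := rescale_radial H nH kap l a l0 Hk a0.
  have em := rescale_radial H nH kap m a m0 Hk a0.
  rewrite /psi /hbump -/a -el -em.
  move: (derive1 (rescale H l) a) (derive1 (rescale H m) a)
    (derive1 (derive1 (rescale H l)) a) (derive1 (derive1 (rescale H m)) a).
  by move: (zsq _) a {a0 el em} => z a p q r s; ring.
by rewrite /Rintegral => ->.
Qed.


Lemma small_support (h : heis R) (e : R) : h != 0 -> 0 < e ->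
  exists l, [/\ 0 < l, c * l ^+ 4 <= N4 h &
    forall g : heis R, N4 (ltr h g) < c * l ^+ 4 -> `|Gam g - Gam h| <= e].
Proof.
move=> h0 e0; have /cvgrPdist_le/(_ e e0) := fsol_continuous hGam h0.
rewrite -nbhs_ballE => -[d /= d0 hd].
have N0 : 0 < N4 h.
  by rewrite lt_def N4_ge0 andbT; apply: contra_neq h0; exact: N4_eq0.
(* With [|x|, |y| <= 2 l] and [|sigma| <= l^2 <= l] for [h^-1 g], the coordinates of [g - h] are at
   most [2 l], [2 l] and [l + l |h.1.1| + l |h.1.2|], all below [l D]. The other entries of the
   minimum give [l^4 <= l] and [c l^4 <= N4 h]. *)
pose D := 4 + 2 * `|h.1.1| + 2 * `|h.1.2|.
have D0 : 0 < D by rewrite /D -addrA ltr_pwDl // addr_ge0 // mulr_ge0.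
pose l := Num.min 1 (Num.min (d / D) (N4 h / 4)).
have l0 : 0 < l by rewrite /l !lt_min ltr01 !divr_gt0.
have l1 : l <= 1 by rewrite /l ge_min lexx.
have ld : l * D <= d by rewrite -ler_pdivlMr // /l !ge_min lexx orbT.
have lN : l * 4 <= N4 h by rewrite -ler_pdivlMr // /l !ge_min lexx !orbT.
have l2 : l ^+ 2 <= l by rewrite expr2 ler_piMr // ltW.
have l4 : l ^+ 4 <= l.
  apply: (le_trans _ l2); rewrite (_ : l ^+ 4 = l ^+ 2 * l ^+ 2); last by ring.
  by apply: ler_piMr; [exact/exprn_ge0/ltW|exact: le_trans l2 l1].
have l40 : 0 < l ^+ 4 by rewrite exprn_gt0.
have cl4 : c * l ^+ 4 <= 4 * l ^+ 4 by rewrite ler_pM2r.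
exists l; split=> //; first by lra.
move=> g gl; rewrite distrC; apply: hd.
have z0 := zsq_ge0 (ltr h g); have z4 := zsq_le_N4 (ltr h g).
have s0 := sqr_ge0 (ltr h g).2.
have z2 : zsq (ltr h g) <= 2 * l ^+ 2.
  rewrite -(ler_pXn2r (ltn0Sn 1)) ?nnegrE ?mulr_ge0 ?exprn_ge0 ?(ltW l0) //.
  have -> : (2 * l ^+ 2) ^+ 2 = 4 * l ^+ 4 by ring.
  by apply: le_trans z4 (ltW (lt_le_trans gl _)).
have l20 : 0 < l ^+ 2 by rewrite exprn_gt0.
have s2 : `|(ltr h g).2| <= l ^+ 2.
  rewrite -(ler_pXn2r (ltn0Sn 1)) ?nnegrE ?normr_ge0 ?(ltW l20) //.
  rewrite real_normK ?num_real // (_ : (l ^+ 2) ^+ 2 = l ^+ 4); last by ring.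
  have := gl; rewrite {1}/N4; have := sqr_ge0 (zsq (ltr h g)); lra.
have bnd (u v : R) : zsq (ltr h g) = u ^+ 2 + v ^+ 2 -> `|u| <= 2 * l.
  move=> zE; rewrite -(ler_pXn2r (ltn0Sn 1)) ?nnegrE ?normr_ge0 ?mulr_ge0 ?(ltW l0) //.
  rewrite real_normK ?num_real // exprMn; have := sqr_ge0 v; lra.
have x2 := bnd (ltr h g).1.1 (ltr h g).1.2 erefl.
have y2 : `|(ltr h g).1.2| <= 2 * l.
  by apply: (bnd _ (ltr h g).1.1); rewrite /zsq addrC.
have lD : 4 * l <= d.
  apply: le_trans ld; rewrite mulrC ler_pM2l // /D -addrA lerDl.
  by rewrite addr_ge0 ?mulr_ge0.
have dd : 2 * l < d by lra.
split; first split => /=.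
- rewrite /ball /= distrC; apply: le_lt_trans dd; exact: x2.
- rewrite /ball /= distrC; apply: le_lt_trans dd; exact: y2.
rewrite /ball /= distrC.
have -> : g.2 - h.2 = (ltr h g).2 + (h.1.1 * (ltr h g).1.2 - (ltr h g).1.1 * h.1.2) / 2.
  by rewrite /ltr /=; field.
apply: le_lt_trans (ler_normD _ _) _.
have t1 : `|(h.1.1 * (ltr h g).1.2 - (ltr h g).1.1 * h.1.2) / 2| <= l * `|h.1.1| + l * `|h.1.2|.
  rewrite normrM normfV (ger0_norm (_ : 0 <= 2)) // ler_pdivrMr //.
  apply: le_trans (ler_normB _ _) _; rewrite !normrM.
  have := ler_wpM2l (normr_ge0 h.1.1) y2; have := ler_wpM2r (normr_ge0 h.1.2) x2.
  lra.
have h1 := normr_ge0 h.1.1; have h2 := normr_ge0 h.1.2.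
have : l * D = 4 * l + 2 * (l * `|h.1.1|) + 2 * (l * `|h.1.2|) by rewrite /D; ring.
have := mulr_ge0 (ltW l0) h1; have := mulr_ge0 (ltW l0) h2.
lra.
Qed.

(** The gauge is continuous, hence bounded on the compact set outside which [Gam] is small. *)
Lemma vanishing_gauge (e : R) : 0 < e ->
  exists M : R, forall g : heis R, M < N4 g -> `|Gam g| <= e.
Proof.
move=> e0; have [K cK hK] := fsol_vanishing hGam e0.
have [M [_ hM]] : bounded_set ((fun g => N4 (ltr 0 g)) @` K).
  apply: compact_bounded; apply: continuous_compact cK.
  by apply: continuous_subspaceT => g; exact: continuous_N4_ltr.
exists (M + 1) => g Mg; apply/ltW/hK => Kg.
have := hM (M + 1) (ltr_pwDr ltr01 (lexx M)) (N4 g).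
rewrite /= ger0_norm ?N4_ge0 // => h.
have /h : exists2 x, K x & N4 (ltr 0 x) = N4 g.
  by exists g => //; congr N4; rewrite /ltr /= !subr0 !mul0r mulr0 subr0 mul0r subr0; case: g {Mg h Kg} => [[]].
by rewrite leNgt Mg.
Qed.

(* Let [l -> 0] and [m -> oo] in [representation]: the first integral tends to
   [mass * Gam h] by continuity, the second to [0] because [Gam] vanishes at
   infinity. *)
Lemma mass_formula h : h != 0 -> mass * Gam h = G * N4 h `^ (- 2^-1).
Proof.
move=> h0; pose D := mass * Gam h - G * N4 h `^ (- 2^-1).
have mass0 : 0 <= mass.
  by apply: Rintegral_ge0 => g _; have /andP[] := bump_bound kap c c4 k01 k0 1 g ltr01.
have N0 : 0 < N4 h.
  by rewrite lt_def N4_ge0 andbT; apply: contra_neq h0; exact: N4_eq0.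
(* The error budget is [e mass] for the concentrated bump, [e mass] for the spread bump away from
   the pole, and [e] for the remaining terms, which decay in [m]. *)
suff De e : 0 < e -> `|D| <= e * (2 * mass + 2).
  have : `|D| <= 0.
    apply/ler_addgt0Pr => e e0; rewrite add0r.
    have m2 : 0 < 2 * mass + 2 by rewrite ltr_wpDl // mulr_ge0.
    by have := De (e / (2 * mass + 2)); rewrite divfK ?gt_eqF //; apply; exact: divr_gt0.
  by rewrite normr_le0 subr_eq0 => /eqP.
move=> e0.
have [l [l0 cl hl]] := small_support h e h0 e0.
have [M hM] := vanishing_gauge e e0.
pose K : set H3 := [set g | N4 (ltr 0 g) <= M].
have mK : measurable K.
  rewrite (_ : K = setT `&` (fun g : H3 => N4 (ltr 0 g)) @^-1` `]-oo, M]).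
    have mc : measurable_fun setT (fun g : H3 => N4 (ltr 0 g)).
      exact: (measurableT_comp measurable_N4 (measurable_ltr 0)).
    by apply: mc => //; exact: measurable_itv.
  by rewrite setTI; apply/seteqP; split => g; rewrite /K /= in_itv.
have fK : (\int[leb3]_(g in K) `|Gam g|%:E < +oo)%E.
  by apply: (fsol_locally_integrable hGam); exact: N4_ltr_compact.
pose I := (\int[leb3]_(g in K) `|Gam g|)%R.
have I0 : 0 <= I by apply: Rintegral_ge0.
have [B HB] : exists B : R, forall a, 0 <= a <= 1 -> `|H a| <= B.
  have [B [_ HB]] : bounded_set (H @` `[0, 1]).
    apply: compact_bounded; apply: continuous_compact (@segment_compact R 0 1).
    by apply: continuous_subspaceT; exact: nD_continuous (nH 1%N).
  exists (B + 1) => a a01; apply: (HB (B + 1)); first by rewrite ltrDl.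
  by exists a => //; rewrite /= in_itv.
have B0 : 0 <= B by apply: le_trans (HB 0 _); rewrite ?lexx ?ler01.
(* [1 <= m] allows every negative power of [m] to be bounded by [m^-1]; [N4 h <= m] puts
   [N4 h / m^4] in [[0, 1]], where [H] is bounded by [B]; the last entry brings the sum of the
   decaying terms below [e]. *)
pose m := Num.max (Num.max 1 l) (Num.max (N4 h) ((16 * I + B) / e)).
have m1 : 1 <= m by rewrite /m !le_max lexx.
have lm : l <= m by rewrite /m !le_max lexx orbT.
have Nm : N4 h <= m by rewrite /m !le_max lexx !orbT.
have Im : (16 * I + B) / e <= m by rewrite /m !le_max lexx !orbT.
have m0 : 0 < m by apply: lt_le_trans m1.
have mX n : m <= m ^+ n.+1 by rewrite exprS ler_peMr ?exprn_ege1 // ltW.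
have mV n : m ^- n.+1 <= m^-1 by rewrite lef_pV2 ?posrE ?exprn_gt0.
have rep := representation h l m l0 lm.
rewrite (rescale_far l _ l0 cl) in rep.
have close : `|\int[leb3]_g (Gam g * psi h l g) - Gam h * mass|%R <= e * mass.
  rewrite -(Rintegral_psi h l l0).
  apply: (@kernel_close _ H3 R leb3 Gam (psi h l) (Gam h) e).
  - exact: integrable_psi.
  - exact: integrable_Gam_psi.
  - by move=> g; have /andP[] := psi_bound h l g l0.
  - by move=> g /(bump_supp kap c k0 _ _ l0); exact: hl.
have small : `|\int[leb3]_g (Gam g * psi h m g)|%R <= 16 * m ^- 4 * I + e * mass.
  rewrite -(Rintegral_psi h m m0).
  apply: (@kernel_small _ H3 R leb3 Gam (psi h m) K) => //.
  - exact: measurable_Gam.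
  - exact: integrable_psi.
  - exact: integrable_Gam_psi.
  - by move=> g; exact: psi_bound.
  - move=> g /negP; rewrite -ltNge => Mg; apply: hM; apply: lt_le_trans Mg _.
    by rewrite /ltr /N4 /zsq /= !subr0 !mul0r !mulr0 subr0 mul0r subr0.
  - exact: ltW.
have resc : `|rescale H m (N4 h)| <= m ^- 2 * B.
  rewrite /rescale normrM ger0_norm ?invr_ge0 ?exprn_ge0 ?(ltW m0) //.
  rewrite ler_wpM2l ?invr_ge0 ?exprn_ge0 ?(ltW m0) // HB //.
  rewrite divr_ge0 ?exprn_ge0 ?(ltW m0) ?(ltW N0) //=.
  by rewrite ler_pdivrMr ?exprn_gt0 // mul1r (le_trans Nm).
have tail : 16 * m ^- 4 * I + m ^- 2 * B <= e.
  have h4 : 16 * m ^- 4 * I <= 16 * I * m^-1.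
    by rewrite mulrAC ler_wpM2l ?mV // mulr_ge0.
  have h2 : m ^- 2 * B <= B * m^-1 by rewrite mulrC ler_wpM2l ?mV.
  apply: le_trans (lerD h4 h2) _.
  rewrite ler_pdivrMr // in Im.
  by rewrite -mulrDl ler_pdivrMr // (mulrC e).
rewrite /D; move: close small resc rep tail; rewrite !ler_norml.
set J1 := (\int[_]_ _ _)%R; set J2 := (\int[_]_ _ _)%R.
set r2 := rescale _ _ _; set q := G * _.
move: (16 * m ^- 4 * I) (m ^- 2 * B) => u v.
rewrite (mulrC (Gam h)).
move=> /andP[? ?] /andP[? ?] /andP[? ?] ? ?; apply/andP; split; lra.
Qed.

End Representation.

(** * A lower bound by explicit integration over a box *)

Section Box.
Context {R : realType}.
Local Notation leb := (@lebesgue_measure R).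
Local Notation mR := (measurableTypeR R).
Local Notation H3 := (mR * mR * mR)%type.

Lemma integral_FTC (f F : R -> R) (a b : R) : a < b ->
  (forall x, is_derive x (1 : R) F (f x)) -> continuous f ->
  (\int[leb]_(x in `[a, b]) (f x)%:E = (F b - F a)%:E)%E.
Proof.
move=> ab dF cf.
have cF : continuous F.
  by move=> x; apply/differentiable_continuous/derivable1_diffP; have [] := dF x.
rewrite (@continuous_FTC2 R f F a b) ?EFinB //.
- exact: continuous_subspaceT.
- split => [x _||]; first by have [] := dF x.
  + exact/cvg_at_right_filter/cF.
  + exact/cvg_at_left_filter/cF.
- by move=> x _; rewrite derive1E; apply: derive_val.
Qed.

Lemma integral_quartic (a b d h : R) : 0 < h ->
  (\int[leb]_(y in `[(- h)%R, h]) (a + b * y ^+ 2 + d * y ^+ 4)%:E =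
    (2 * (a * h + b * h ^+ 3 / 3 + d * h ^+ 5 / 5))%:E)%E.
Proof.
move=> h0; have hh : - h < h by lra.
pose p : {poly R} := a%:P * 'X + (b / 3)%:P * 'X^3 + (d / 5)%:P * 'X^5.
have dp y : (p^`()%R).[y] = a + b * y ^+ 2 + d * y ^+ 4.
  rewrite /p !poly.derivE !hornerE /=.
  by field.
pose q y := a + b * y ^+ 2 + d * y ^+ 4.
have dq x : is_derive x (1 : R) (horner p) (q x).
  by rewrite /q -dp; exact: is_derive_poly.
have cq : continuous q.
  have -> : q = horner p^`()%R by apply/funext => y; rewrite dp.
  exact: continuous_horner.
rewrite (integral_FTC q (horner p) _ _ hh dq cq).
have ph y : p.[y] = a * y + b / 3 * y ^+ 3 + d / 5 * y ^+ 5.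
  by rewrite /p !hornerE /=; field.
by rewrite !ph; congr (_%:E); field.
Qed.

Lemma integral_indic_mul (f : R -> R) (A : set mR) : measurable A ->
  (\int[leb]_x (\1_A x * f x)%:E = \int[leb]_(x in A) (f x)%:E)%E.
Proof.
move=> mA; rewrite [RHS]integral_mkcond; apply: eq_integral => x _.
by rewrite /patch indicE; case: ifPn => _; rewrite ?mul1r ?mul0r.
Qed.

(** The box [|x|, |y| <= h], [|sigma| <= k] lies in the unit gauge ball, because [zsq <= 2 h^2] on
    it. The factor [112/45 h^6] is the integral of [(x^2 + y^2)^2] over the square, and [2 k] is the
    height. *)
Lemma box_integral (h k : R) : 0 < h -> 0 < k -> 4 * h ^+ 4 + 16 * k ^+ 2 < 1 ->
  ((2 * k * (112 / 45 * h ^+ 6))%:E <= \int[leb3]_(g in gball 1) (zsq g ^+ 2)%:E)%E.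
Proof.
move=> h0 k0 hk.
pose I : set mR := `[- h, h]%classic; pose J : set mR := `[- k, k]%classic.
have mI : measurable I by exact: measurable_itv.
have mJ : measurable J by exact: measurable_itv.
have lJ : leb J = (2 * k)%:E.
  rewrite /J lebesgue_measure_itv /= lte_fin ifT; last by lra.
  by rewrite -EFinB; congr (_%:E); ring.
pose f (g : H3) : R := \1_I g.1.1 * (\1_I g.1.2 * (\1_J g.2 * zsq g ^+ 2)).
have i0 (A : set mR) x : 0 <= (\1_A x : R) by rewrite indicE ler0n.
have f0 g : (0 <= (f g)%:E)%E.
  rewrite lee_fin; exact: mulr_ge0 (i0 _ _) (mulr_ge0 (i0 _ _) (mulr_ge0 (i0 _ _) (sqr_ge0 _))).
have mz : measurable_fun setT (fun g : H3 => zsq g ^+ 2).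
  by apply: (@measurable_funX _ H3 R); exact: measurable_zsq.
have mf : measurable_fun setT (fun g => (f g)%:E).
  apply/measurable_EFinP.
  have mi (A : set mR) (p : H3 -> mR) : measurable A -> measurable_fun setT p ->
      measurable_fun setT (fun g => \1_A (p g) : R).
    by move=> mA mp; exact: (measurableT_comp (measurable_indic mA) mp).
  apply: (@measurable_funM _ H3 R); first exact: (mi _ _ mI measurable_hx).
  apply: (@measurable_funM _ H3 R); first exact: (mi _ _ mI measurable_hy).
  by apply: (@measurable_funM _ H3 R); first exact: (mi _ _ mJ measurable_hs).
have le : (\int[leb3]_g (f g)%:E <= \int[leb3]_(g in gball 1) (zsq g ^+ 2)%:E)%E.
  rewrite [leRHS]integral_mkcond; apply: ge0_le_integral => //.
  - apply/(measurable_restrictT _ _).1; first exact: measurable_gball.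
    by apply: measurable_funTS; apply/measurable_EFinP.
  - move=> g _; rewrite /patch /f !indicE.
    have sq (r u : R) : u \in `[- r, r] -> u ^+ 2 <= r ^+ 2.
      by rewrite in_itv /= -ler_norml => ur; rewrite -real_normK ?num_real // lerXn2r ?nnegrE // (le_trans _ ur).
    have z2 := sqr_ge0 (zsq g).
    case: (boolP (g.1.1 \in I)) => [/[!inE] xI|_]; last first.
      by rewrite mul0r; case: ifPn; rewrite lee_fin.
    case: (boolP (g.1.2 \in I)) => [/[!inE] yI|_]; last first.
      by rewrite mul0r mulr0; case: ifPn; rewrite lee_fin.
    case: (boolP (g.2 \in J)) => [/[!inE] sJ|_]; last first.
      by rewrite mul0r !mulr0; case: ifPn; rewrite lee_fin.
    rewrite ifT ?mul1r // inE /gball /= expr1n; apply: le_lt_trans hk.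
    have x2 := sq _ _ xI; have y2 := sq _ _ yI; have s2 := sq _ _ sJ.
    rewrite /N4 lerD ?ler_pM2l //.
    have -> : 4 * h ^+ 4 = (2 * h ^+ 2) ^+ 2 by ring.
    rewrite lerXn2r ?nnegrE ?zsq_ge0 ?mulr_ge0 ?(ltW h0) // /zsq.
    by lra.
apply: le_trans le.
rewrite leb3E //.
have E (x y : R) : (\int[leb]_s (f (x, y, s))%:E =
   (2 * k * (\1_I x * (\1_I y * (x ^+ 2 + y ^+ 2) ^+ 2)))%:E)%E.
  transitivity (\int[leb]_s ((\1_I x * (\1_I y * (x ^+ 2 + y ^+ 2) ^+ 2))%:E * (\1_J s)%:E))%E.
    by apply: eq_integral => s _; rewrite -EFinM /f /zsq /=; congr (_%:E); ring.
  rewrite ge0_integralZl //; last 2 first.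
  - exact/measurable_EFinP/measurable_indic.
  - rewrite lee_fin; exact: mulr_ge0 (i0 _ _) (mulr_ge0 (i0 _ _) (sqr_ge0 _)).
  have iJ : (\int[leb]_s (\1_J s)%:E = (2 * k)%:E)%E.
    by rewrite -lJ; have := integral_indic leb measurableT mJ; rewrite setIT.
  transitivity ((\1_I x * (\1_I y * (x ^+ 2 + y ^+ 2) ^+ 2))%:E * (2 * k)%:E)%E.
    by congr (_ * _)%E; exact: iJ.
  by rewrite -EFinM; congr (_%:E); ring.
have hh : - h < h by lra.
pose P (x y : R) := x ^+ 4 * y + 2 * x ^+ 2 * (y ^+ 3 / 3) + y ^+ 5 / 5.
have Ey (x : R) : (\int[leb]_y \int[leb]_s (f (x, y, s))%:E =
    (2 * k * \1_I x * (P x h - P x (- h)))%:E)%E.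
  transitivity (\int[leb]_y (\1_I y * (2 * k * \1_I x * (x ^+ 2 + y ^+ 2) ^+ 2))%:E)%E.
    by apply: eq_integral => y _; rewrite E; congr (_%:E); ring.
  rewrite integral_indic_mul //.
  transitivity (\int[leb]_(y in I) (2 * k * \1_I x * x ^+ 4 +
      2 * k * \1_I x * (2 * x ^+ 2) * y ^+ 2 + 2 * k * \1_I x * y ^+ 4)%:E)%E.
    by apply: eq_integral => y _; congr (_%:E); ring.
  by rewrite integral_quartic //; congr (_%:E); rewrite /P; field.
rewrite le_eqVlt; apply/orP; left; apply/eqP.
transitivity (\int[leb]_x (\1_I x * (2 * k * (2 * h ^+ 5 / 5) +
    2 * k * (4 * h ^+ 3 / 3) * x ^+ 2 + 2 * k * (2 * h) * x ^+ 4))%:E)%E; last first.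
  by apply: eq_integral => x _; rewrite Ey; congr (_%:E); rewrite /P; field.
rewrite integral_indic_mul // integral_quartic //.
by congr (_%:E); field.
Qed.

End Box.

Section Identification.
Context {R : realType}.
Local Notation mR := (measurableTypeR R).
Local Notation H3 := (mR * mR * mR)%type.

(* Since [mass >= 8 int zsq] and [G <= 2/3 (21/20)^2], [C = G / mass] satisfies
   [C int zsq <= (21/20)^2 / 12 < 0.092], whereas [2 int zsq^2 > 0.097] by
   integrating over a box. *)
Lemma fundamental_solutionE (Gam : heis R -> R) : fundamental_solution Gam ->
  exists C : R, [/\ 0 < C, C <= 2, forall g, g != 0 -> Gam g = C * N4 g `^ (- 2^-1) &
    (\int[leb3]_(g in gball 1) (C * zsq g)%:E <=
     \int[leb3]_(g in gball 1) (2 * zsq g ^+ 2)%:E)%E].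
Proof.
move=> hGam; pose c : R := 21 / 20.
have c1 : 1 < c by rewrite /c; lra.
have c4 : c <= 4 by rewrite /c; lra.
have [H [kap [G [nH HG [Hk kc k01 k1 k0] Gle]]]] := radial_profile c c1.
have mg := @measurable_gball R 1.
have mz : measurable_fun (gball 1) (fun g : H3 => (zsq g)%:E).
  by apply: measurable_funTS; apply/measurable_EFinP; exact: measurable_zsq.
have mz2 : measurable_fun (gball 1) (fun g : H3 => (zsq g ^+ 2)%:E).
  apply: measurable_funTS; apply/measurable_EFinP.
  by apply: (@measurable_funX _ H3 R); exact: measurable_zsq.
have z0 (g : H3) : (0 <= (zsq g)%:E)%E by rewrite lee_fin; exact: zsq_ge0.
have z20 (g : H3) : (0 <= (zsq g ^+ 2)%:E)%E by rewrite lee_fin sqr_ge0.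
pose T1 : \bar R := (\int[leb3]_(g in gball 1) (zsq g)%:E)%E.
pose T2 : \bar R := (\int[leb3]_(g in gball 1) (zsq g ^+ 2)%:E)%E.
have T10 : (0 <= T1)%E by exact: integral_ge0.
have T20 : (0 <= T2)%E by exact: integral_ge0.
have T21 : (T2 <= T1)%E.
  apply: ge0_le_integral => // g gb; rewrite lee_fin expr2 ler_piMl ?zsq_ge0 //.
  move: gb; rewrite /gball /= expr1n => gb.
  rewrite -(ler_pXn2r (ltn0Sn 1)) ?nnegrE ?zsq_ge0 // expr1n.
  exact: le_trans (zsq_le_N4 g) (ltW gb).
pose mass : R := (\int[leb3]_g (hbump kap 1 g))%R.
have massE : (\int[leb3]_g (hbump kap 1 g : R)%:E = mass%:E)%E.
  rewrite /mass /Rintegral fineK //; apply: integrable_fin_num => //.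
  exact: (integrable_bump kap c c4 kc k01 k0 1 ltr01).
have m1 := bump_mass_ge kap c c4 kc k01 k0 k1; rewrite massE -/T1 in m1.
(* The box just fits: [4 (2/3)^4 + 16 (1/9)^2 = 80/81]. *)
have box := box_integral (2 / 3) (1 / 9) _ _ _; rewrite -/T2 in box.
have {}box : ((2 * (1 / 9) * (112 / 45 * (2 / 3) ^+ 6))%:E <= T2)%E by apply: box; lra.
(* Finiteness comes from the finite mass, which dominates [8 T1]. *)
have fT1 : T1 \is a fin_num.
  rewrite ge0_fin_numE // ltNge leye_eq; apply/eqP => T1y.
  by move: m1; rewrite T1y gt0_muley ?lte_fin.
have fT2 : T2 \is a fin_num.
  by rewrite ge0_fin_numE // (le_lt_trans T21) // -ge0_fin_numE.
have [t1 T1E] : exists t, T1 = t%:E by exists (fine T1); rewrite fineK.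
have [t2 T2E] : exists t, T2 = t%:E by exists (fine T2); rewrite fineK.
rewrite T1E -EFinM lee_fin in m1; rewrite T2E lee_fin in box.
rewrite T1E T2E lee_fin in T21.
(* Precisely the bound that the final comparison [C t1 <= c^2 / 12 <= 2 t2] asks for; it is what
   forces [c] to be close to [1]. *)
have t2l : c ^+ 2 / 24 <= t2 by apply: le_trans box; rewrite /c; lra.
have t20 : 0 < t2 by apply: lt_le_trans t2l; rewrite /c; lra.
have t10 : 0 < t1 by apply: lt_le_trans T21.
have mass0 : 0 < mass by apply: lt_le_trans m1; rewrite mulr_gt0.
have GamE g : g != 0 -> Gam g = G / mass * N4 g `^ (- 2^-1).
  move=> g0; have := mass_formula Gam hGam H kap c G c1 c4 nH HG Hk kc k01 k0 g g0.
  rewrite -/mass => e; rewrite -mulrA [_ * (N4 g `^ _)]mulrC mulrA -e.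
  by rewrite mulrC mulrA mulVf ?mul1r // gt_eqF.
have C0 : 0 < G / mass.
  have g0 : (1, 0, 0) != 0 :> heis R.
    by apply/eqP => -[/eqP]; rewrite oner_eq0.
  have := fsol_positive hGam g0; rewrite GamE // pmulr_lgt0 //.
  by rewrite powR_gt0 // /N4 /zsq /=; lra.
have Ct1 : G / mass * t1 <= c ^+ 2 / 12.
  have G0 : 0 < G by move: C0; rewrite pmulr_lgt0 // invr_gt0.
  rewrite mulrAC ler_pdivrMr //.
  have h1 := ler_wpM2r (ltW t10) Gle.
  have h2 : c ^+ 2 / 12 * (8 * t1) <= c ^+ 2 / 12 * mass.
    by rewrite ler_wpM2l // divr_ge0 ?sqr_ge0.
  lra.
exists (G / mass); split => //.
  (* The same chain yields [C <= 2]: [C t2 <= C t1 <= c^2 / 12 <= 2 t2], and [t2 > 0] cancels. *)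
  have h1 : G / mass * t2 <= G / mass * t1 by rewrite ler_wpM2l // ltW.
  have h2 : G / mass * t2 <= 2 * t2 by lra.
  by rewrite ler_pM2r in h2.
have -> : (\int[leb3]_(g in gball 1) (G / mass * zsq g)%:E = (G / mass * t1)%:E)%E.
  under eq_integral do rewrite EFinM.
  by rewrite ge0_integralZl // -/T1 ?T1E // lee_fin ltW.
have -> : (\int[leb3]_(g in gball 1) (2 * zsq g ^+ 2)%:E = (2 * t2)%:E)%E.
  under eq_integral do rewrite EFinM.
  by rewrite ge0_integralZl // -/T2 ?T2E.
by rewrite lee_fin; lra.
Qed.

End Identification.

(** * Homogeneity *)

Section Homogeneous.
Context {R : realType}.
Local Notation leb := (@lebesgue_measure R).
Local Notation mR := (measurableTypeR R).
Local Notation H3 := (mR * mR * mR)%type.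
Implicit Types k : H3 -> R.

Lemma gball_dil (l t : R) (g : heis R) : 0 < l -> gball (l * t) (dil l g) = gball t g.
Proof. by move=> l0; rewrite /gball /= N4_dil exprMn ltr_pM2l // exprn_gt0. Qed.

Lemma integral_gball_dil (t : R) k : 0 < t -> measurable_fun setT k ->
  (forall g, 0 <= k g) ->
  (\int[leb3]_(g in gball t) (k g)%:E =
   (t ^+ 4)%:E * \int[leb3]_(g in gball 1) (k (dil t g))%:E)%E.
Proof.
move=> t0 mk k0; rewrite integral_mkcond.
rewrite (leb3_dil t) //; last 2 first.
- apply/(measurable_restrictT _ _).1; first exact: measurable_gball.
  by apply: measurable_funTS; apply/measurable_EFinP.
- by move=> g; rewrite /patch; case: ifP => // _; rewrite lee_fin.
congr (_ * _)%E; rewrite [RHS]integral_mkcond; apply: eq_integral => g _.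
rewrite /patch; congr (if _ then _ else _).
by apply/idP/idP; rewrite !inE -{1}(mulr1 t) gball_dil.
Qed.

(** Both sides scale by the same factor [t^8]: [t^4] from the Jacobian and [t^4] from the degree of
    the integrands. *)
Lemma le_integral_gball (k1 k2 : H3 -> R) (t : R) : 0 < t ->
  measurable_fun setT k1 -> measurable_fun setT k2 ->
  (forall g, 0 <= k1 g) -> (forall g, 0 <= k2 g) ->
  (forall g, k1 (dil t g) = t ^+ 4 * k1 g) ->
  (forall g, k2 (dil t g) = t ^+ 4 * k2 g) ->
  (\int[leb3]_(g in gball 1) (k1 g)%:E <= \int[leb3]_(g in gball 1) (k2 g)%:E)%E ->
  (\int[leb3]_(g in gball t) (k1 g)%:E <= \int[leb3]_(g in gball t) (k2 g)%:E)%E.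
Proof.
move=> t0 m1 m2 k10 k20 h1 h2 le1;
have E k : measurable_fun setT k -> (forall g, 0 <= k g) -> (forall g, k (dil t g) = t ^+ 4 * k g) ->
    (\int[leb3]_(g in gball t) (k g)%:E =
     (t ^+ 4)%:E * ((t ^+ 4)%:E * \int[leb3]_(g in gball 1) (k g)%:E))%E.
  move=> mk k0 hk; etransitivity; first exact: integral_gball_dil.
  congr (_ * _)%E; rewrite -ge0_integralZl //; last 4 first.
  - exact: measurable_gball.
  - by apply: measurable_funTS; apply/measurable_EFinP.
  - by move=> g _; rewrite lee_fin.
  - by rewrite lee_fin exprn_ge0 // ltW.
  by apply: eq_integral => g _; rewrite hk EFinM.
have t4 : (0 <= (t ^+ 4)%:E)%E by rewrite lee_fin exprn_ge0 // ltW.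
by rewrite (E k1 m1 k10 h1) (E k2 m2 k20 h2) !lee_wpmul2l.
Qed.

Lemma powR_lt_root (a v s : R) : 0 < s -> 0 <= a -> 0 <= v ->
  (a `^ s < v) = (a < v `^ s^-1).
Proof.
move=> s0 a0 v0.
have sV0 : 0 < s^-1 by rewrite invr_gt0.
have K (x : R) : 0 <= x -> (x `^ s) `^ s^-1 = x.
  by move=> x0; rewrite -powRrM divff ?gt_eqF // powRr1.
have K' (x : R) : 0 <= x -> (x `^ s^-1) `^ s = x.
  by move=> x0; rewrite -powRrM mulVf ?gt_eqF // powRr1.
apply/idP/idP => h.
  by rewrite -(K a a0); apply: gt0_ltr_powR => //; rewrite nnegrE ?powR_ge0.
by rewrite -(K' v v0); apply: gt0_ltr_powR => //; rewrite nnegrE ?powR_ge0.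
Qed.

Lemma integral_indic_itv (w : R) : 0 <= w ->
  (\int[leb]_u (\1_(`]0%R, w[%classic : set mR) u)%:E = w%:E)%E.
Proof.
move=> w0; have mw : measurable (`]0%R, w[%classic : set mR) by exact: measurable_itv.
have := integral_indic leb measurableT mw; rewrite setIT => e.
have lw : leb (`]0%R, w[%classic : set mR) = w%:E.
  rewrite lebesgue_measure_itv /= lte_fin.
  case: ifPn; first by rewrite sube0.
  by rewrite -leNgt => w0'; congr (_%:E); apply/eqP; rewrite eq_le w0 w0'.
exact: (etrans e lw).
Qed.

(* The superlevel set [{u < N4^(-s)} `&` gball 1], for [u > 0], is the punctured
   gauge ball of this radius. *)
Definition layer_radius (s u : R) : R := Num.min 1 (u `^ (- s^-1)) `^ 4^-1.

(** Layer cake: [N4^(-s)] is the length of []0, N4^(-s)[], and Tonelli exchanges the two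
    integrations. The slice at height [u] is a gauge ball without its centre. *)
Lemma integral_gball_layer k (s : R) : 0 < s -> measurable_fun setT k ->
  (forall g, 0 <= k g) -> k 0 = 0 ->
  exists A : mR -> \bar R, [/\ measurable_fun setT A,
    (\int[leb3]_(g in gball 1) (k g * N4 g `^ (- s))%:E = \int[leb]_u A u)%E,
    forall u, 0 < u -> A u = (\int[leb3]_(g in gball (layer_radius s u)) (k g)%:E)%E &
    forall u, u <= 0 -> A u = 0%E].
Proof.
move=> s0 mk k0 kO.
pose S : set (H3 * mR) := [set p | gball 1 p.1 /\ 0 < p.2 < N4 p.1 `^ (- s)].
have mS : measurable S.
  have mN : measurable_fun setT (fun p : H3 * mR => N4 p.1).
    exact: (measurableT_comp measurable_N4 measurable_fst).
  have mw : measurable_fun setT (fun p : H3 * mR => N4 p.1 `^ (- s)).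
    exact: (measurableT_comp (measurable_powR (- s)) mN).
  have m2 : measurable_fun setT (fun p : H3 * mR => p.2 : R) by exact: measurable_snd.
  have m3 : measurable_fun setT (fun p : H3 * mR => N4 p.1 `^ (- s) - p.2).
    exact: (@measurable_funB _ (H3 * mR)%type R).
  have mp (f : H3 * mR -> R) (i : interval R) : measurable_fun setT f ->
      measurable (f @^-1` [set` i]).
    by move=> mf; rewrite -[X in measurable X]setTI; apply: mf => //; exact: measurable_itv.
  rewrite (_ : S = (fun p : H3 * mR => N4 p.1) @^-1` `]-oo, 1[ `&`
     ((fun p : H3 * mR => p.2 : R) @^-1` `]0, +oo[ `&`
      (fun p : H3 * mR => N4 p.1 `^ (- s) - p.2) @^-1` `]0, +oo[)).
    by apply: measurableI; [exact: mp|apply: measurableI; exact: mp].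
  apply/seteqP; split => p; rewrite /S /gball /= !in_itv /= expr1n !andbT subr_gt0.
    by move=> [-> /andP[-> ->]].
  by move=> [-> [-> ->]].
pose F (p : H3 * mR) : \bar R := (k p.1 * \1_S p)%:E.
have mF : measurable_fun setT F.
  apply/measurable_EFinP; apply: (@measurable_funM _ (H3 * mR)%type R).
    exact: (measurableT_comp mk measurable_fst).
  exact: measurable_indic.
have F0 p : (0 <= F p)%E by rewrite lee_fin mulr_ge0 // indicE ler0n.
exists (fun u => \int[leb3]_g F (g, u))%E; split.
- exact: (measurable_fun_fubini_tonelli_G (m1 := leb3) F mF F0).
- transitivity (\int[leb3]_g \int[leb]_u F (g, u))%E; last first.
    exact: (@fubini_tonelli _ _ H3 mR R leb3 leb F mF F0).
  rewrite [LHS]integral_mkcond; apply: eq_integral => g _.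
  rewrite /patch; case: ifPn => [|/negP] gb; rewrite inE in gb; last first.
    rewrite integral0_eq // => u _; rewrite /F indicE memNset ?mulr0 //.
    by move=> [].
  transitivity (\int[leb]_u ((k g)%:E * (\1_(`]0, N4 g `^ (- s)[%classic) u)%:E))%E.
    rewrite ge0_integralZl //; last 2 first.
    - exact/measurable_EFinP/measurable_indic.
    - by rewrite lee_fin.
    rewrite EFinM; congr (_ * _)%E.
    by apply/esym; apply: integral_indic_itv; exact: powR_ge0.
  apply: eq_integral => u _; rewrite /F -EFinM; congr (_ * _)%:E.
  rewrite !indicE; congr (nat_of_bool _)%:R.
  apply/idP/idP; rewrite !inE /S /= in_itv /=; first by move=> ->; split.
  by case.
- move=> u u0; rewrite [RHS]integral_mkcond; apply: eq_integral => g _.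
rewrite /F indicE /patch.
(* At the pole the power [N4^(-s)] is [0] by convention instead of infinite, so the slice misses the
   centre of the ball; [k 0 = 0] hides the difference. *)
have [->|g0] := eqVneq g 0; first by rewrite kO mul0r; case: ifP.
have N0 : 0 < N4 g.
  by rewrite lt_def N4_ge0 andbT; apply: contra_neq g0; exact: N4_eq0.
suff -> : ((g, u) \in S) = (g \in gball (layer_radius s u)).
  by case: ifP => _; rewrite ?mulr1 ?mulr0.
have t4 : layer_radius s u ^+ 4 = Num.min 1 (u `^ (- s^-1)).
  by rewrite /layer_radius -powR_mulrn ?powR_ge0 // -powRrM mulVf // powRr1 // le_min ler01 powR_ge0.
have uN : (u < N4 g `^ (- s)) = (N4 g < u `^ (- s^-1)).
  rewrite powRN -[X in X < _]invrK ltf_pV2 ?posrE ?invr_gt0 ?powR_gt0 //.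
  rewrite powR_lt_root ?invr_ge0 ?(ltW u0) ?(ltW N0) //.
  by rewrite -(powR_inv1 (ltW u0)) -powRrM mulN1r.
apply/idP/idP; rewrite !inE /S /gball /= expr1n t4 lt_min u0 uN.
  by move=> [-> ->].
by move=> /andP[-> ->].
- move=> u u0; rewrite integral0_eq // => g _; rewrite /F indicE memNset ?mulr0 //.
  by move=> [_ /andP[]]; rewrite ltNge u0.
Qed.

(** All slices of the weight are gauge balls up to a point, and by homogeneity the unweighted
    comparison on the unit ball carries over to each of them. *)
Lemma layer_cake_le (k1 k2 : H3 -> R) (s : R) : 0 < s ->
  measurable_fun setT k1 -> measurable_fun setT k2 ->
  (forall g, 0 <= k1 g) -> (forall g, 0 <= k2 g) -> k1 0 = 0 -> k2 0 = 0 ->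
  (forall t g, 0 < t -> k1 (dil t g) = t ^+ 4 * k1 g) ->
  (forall t g, 0 < t -> k2 (dil t g) = t ^+ 4 * k2 g) ->
  (\int[leb3]_(g in gball 1) (k1 g)%:E <= \int[leb3]_(g in gball 1) (k2 g)%:E)%E ->
  (\int[leb3]_(g in gball 1) (k1 g * N4 g `^ (- s))%:E <=
   \int[leb3]_(g in gball 1) (k2 g * N4 g `^ (- s))%:E)%E.
Proof.
move=> s0 m1 m2 k10 k20 k1O k2O h1 h2 le1.
have [A1 [mA1 -> A1p A1n]] := integral_gball_layer k1 s s0 m1 k10 k1O.
have [A2 [mA2 -> A2p A2n]] := integral_gball_layer k2 s s0 m2 k20 k2O.
apply: ge0_le_integral => //.
- move=> u _; have [u0|u0] := ltP 0 u; last by rewrite A1n.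
  by rewrite A1p //; apply: integral_ge0 => g _; rewrite lee_fin.
move=> u _; have [u0|u0] := ltP 0 u; last by rewrite A1n // A2n.
rewrite A1p // A2p //.
have t0 : 0 < layer_radius s u by rewrite powR_gt0 // lt_min ltr01 powR_gt0.
by apply: le_integral_gball => // g; [exact: h1|exact: h2].
Qed.

End Homogeneous.

(** * Both functionals in terms of the explicit gauge *)

Section GaugeFunctional.
Context {R : realType}.
Local Notation leb := (@lebesgue_measure R).
Local Notation mR := (measurableTypeR R).
Local Notation H3 := (mR * mR * mR)%type.
Implicit Types (g : heis R) (v : H3 -> R).

Lemma N4_0 : N4 (0 : heis R) = 0.
Proof. by rewrite /N4 /zsq /=; ring. Qed.

Lemma N4_gt0 g : g != 0 -> 0 < N4 g.
Proof. by move=> g0; rewrite lt_def N4_ge0 andbT; apply: contra_neq g0; exact: N4_eq0. Qed.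

Lemma powR_gtD (x a b : R) : 0 < x -> x `^ (a + b) = x `^ a * x `^ b.
Proof. by move=> x0; rewrite powRD //; apply/implyP => _; rewrite gt_eqF. Qed.

(** The squared horizontal gradient of [N4] is [16 zsq N4]; the chain rule multiplies it by
    [(k a)^2 N4^(2 a - 2)]. *)
Lemma sqgradH_N4_powR (k a : R) g : g != 0 ->
  sqgradH (fun g => k * N4 g `^ a) g =
    16 * (k * a) ^+ 2 * zsq g * N4 g `^ (2 * a - 1).
Proof.
move=> g0; have N0 := N4_gt0 g g0.
have gN : grad_at g N4 (4 * zsq g * g.1.1) (4 * zsq g * g.1.2) (32 * g.2).
  by rewrite /N4 /zsq; grad; rewrite /=; ring.
have hF := is_derive1_powR a N0.
have gF := grad_atM (grad_at_cst g k) (grad_at_comp gN hF).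
rewrite /sqgradH; have [-> -> _ _] := X_val gF.
have -> : 2 * a - 1 = (a - 1) + (a - 1) + 1 by ring.
move: (a - 1) => e; rewrite !powR_gtD // powRr1 ?N4_ge0 //.
by rewrite /N4 /zsq; move: (_ `^ e) => w; field.
Qed.

Variables (Gam : heis R -> R) (C : R).
Hypotheses (C0 : 0 < C) (GamE : forall g, g != 0 -> Gam g = C * N4 g `^ (- 2^-1)).

Let k := C `^ (- 2^-1).

Let k0 : 0 < k. Proof. exact: powR_gt0. Qed.

Let homdimB : (homdim%:R - 2 : R) = 2.
Proof. by rewrite /homdim; ring. Qed.

Lemma pgaugeE : pgauge Gam = fun g => k * N4 g `^ 4^-1.
Proof.
apply/funext => g; rewrite /pgauge; case: eqP => [->|/eqP g0].
  by rewrite N4_0 powR0 ?mulr0 // invr_eq0.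
rewrite GamE // homdimB powRM ?powR_ge0 ?(ltW C0) // -powRrM.
by congr (_ * _ `^ _); field.
Qed.

Lemma pballE (r : R) : 0 < r -> pball Gam r = gball (r / k).
Proof.
move=> r0; apply/seteqP; split => g; rewrite /pball /gball /= pgaugeE;
  rewrite -ltr_pdivlMl // powR_lt_root ?N4_ge0 ?mulr_ge0 ?invr_ge0 ?(ltW k0) ?(ltW r0) ?invr_gt0 //;
  by rewrite invrK (mulrC k^-1) powR_mulrn // divr_ge0 // ltW.
Qed.

Let ksq : k ^+ 2 = C^-1.
Proof.
by rewrite -powR_mulrn ?powR_ge0 // -powRrM mulNr mulVf // powR_inv1 // ltW.
Qed.

(** For [s = (6 - alpha) / 4] this is, up to a constant, [rho^(alpha - Q)] times the squared
    horizontal gradient of [rho]: the first factor gives the exponent [(alpha - 4) / 4], the second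
    gives [zsq N4^(-1/2)]. *)
Definition gweight (s : R) g : R := zsq g * N4 g `^ (- s).

Lemma gweight_ge0 s g : 0 <= gweight s g.
Proof. by rewrite mulr_ge0 ?zsq_ge0 ?powR_ge0. Qed.

Lemma measurable_gweight s : measurable_fun setT (gweight s : H3 -> R).
Proof.
apply: (@measurable_funM _ H3 R); first exact: measurable_zsq.
exact: (measurableT_comp (measurable_powR (- s)) measurable_N4).
Qed.

Lemma gweight_dil (s t : R) g : 0 < t ->
  gweight s (dil t g) = t `^ (2 - 4 * s) * gweight s g.
Proof.
move=> t0; rewrite /gweight zsq_dil N4_dil powRM ?exprn_ge0 ?N4_ge0 ?ltW //.
rewrite -powR_mulrn ?ltW // -powR_mulrn ?ltW // -powRrM.
rewrite (powR_gtD t 2 (- (4 * s))) // mulrN; ring.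
Qed.

Lemma pgauge_weight (alpha : R) v g : alpha < 4 ->
  v g / pgauge Gam g `^ (homdim%:R - alpha) * sqgradH (pgauge Gam) g =
  k `^ (alpha - 2) * (v g * gweight ((6 - alpha) / 4) g).
Proof.
move=> a4; rewrite pgaugeE; have [->|g0] := eqVneq g 0.
  (* At the pole the left side is a division by [0], equal to [0] by convention, provided the
     exponent [4 - alpha] is nonzero; the right side vanishes through [zsq]. *)
  rewrite N4_0 powR0 ?invr_eq0 // mulr0 powR0 ?invr0 ?mulr0 ?mul0r ?gweight_ge0 //.
    by rewrite /gweight /zsq /= expr0n /= addr0 mul0r !mulr0.
  by rewrite subr_eq0 gt_eqF.
have N0 := N4_gt0 g g0.
rewrite sqgradH_N4_powR // powRM ?powR_ge0 ?(ltW k0) // -powRrM.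
have -> : k `^ (alpha - 2) = (k `^ (homdim%:R - alpha))^-1 * k ^+ 2.
  rewrite -powRN -powR_mulrn ?(ltW k0) // -powR_gtD //.
  by congr (_ `^ _); rewrite /homdim; ring.
rewrite /gweight.
have -> : N4 g `^ (- ((6 - alpha) / 4)) =
  (N4 g `^ (4^-1 * (homdim%:R - alpha)))^-1 * N4 g `^ (2 / 4 - 1).
  rewrite -powRN -powR_gtD //.
  by congr (_ `^ _); rewrite /homdim; field.
have := powR_gt0 (homdim%:R - alpha) k0.
have := powR_gt0 (4^-1 * (homdim%:R - alpha)) N0.
move: (k `^ (homdim%:R - alpha)) (N4 g `^ (4^-1 * (homdim%:R - alpha))) (N4 g `^ _) => X Y Z hY hX.
by field; rewrite !gt_eqF.
Qed.

(** With [l = r / k], the Jacobian gives [l^4] and the weight gives [l^(alpha - 4)], so the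
    normalisation by [r^alpha] cancels and [r] survives only in the dilated [v]. The remaining
    powers of [k] combine to [k^-2 = C]. *)
Lemma pgauge_functional (alpha r : R) v : alpha < 4 -> 0 < r ->
  measurable_fun setT v -> (forall g, 0 <= v g) ->
  (((r `^ alpha)^-1)%:E * \int[leb3]_(g in pball Gam r)
     (v g / pgauge Gam g `^ (homdim%:R - alpha) * sqgradH (pgauge Gam) g)%:E =
   C%:E * \int[leb3]_(g in gball 1)
     (v (dil (r / k) g) * gweight ((6 - alpha) / 4) g)%:E)%E.
Proof.
move=> a4 r0 mv v0; set s := (6 - alpha) / 4; set l := r / k.
have l0 : 0 < l by rewrite divr_gt0.
rewrite pballE // -/l.
have m1 : measurable_fun setT (fun g : H3 => v g * gweight s g).
  by apply: (@measurable_funM _ H3 R) => //; exact: measurable_gweight.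
have p1 g : 0 <= v g * gweight s g by rewrite mulr_ge0 ?gweight_ge0.
have md := @measurable_dil R l.
have m2 : measurable_fun setT (fun g : H3 => v (dil l g) * gweight s g).
  apply: (@measurable_funM _ H3 R); last exact: measurable_gweight.
  exact: (measurableT_comp mv md).
have p2 g : 0 <= v (dil l g) * gweight s g by rewrite mulr_ge0 ?gweight_ge0.
transitivity ((((r `^ alpha)^-1)%:E * ((k `^ (alpha - 2))%:E * \int[leb3]_(g in gball l)
   (v g * gweight s g)%:E)))%E.
  congr (_ * _)%E; rewrite -ge0_integralZl //; last 4 first.
  - exact: measurable_gball.
  - by apply: measurable_funTS; apply/measurable_EFinP.
  - by move=> g _; rewrite lee_fin.
  - by rewrite lee_fin powR_ge0.
  by apply: eq_integral => g _; rewrite -EFinM pgauge_weight.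
have -> : (\int[leb3]_(g in gball l) (v g * gweight s g)%:E = (l ^+ 4)%:E * ((l `^ (2 - 4 * s))%:E *
    \int[leb3]_(g in gball 1) (v (dil l g) * gweight s g)%:E))%E.
  etransitivity; first exact: integral_gball_dil.
  congr (_ * _)%E; rewrite -ge0_integralZl //; last 4 first.
  - exact: measurable_gball.
  - by apply: measurable_funTS; apply/measurable_EFinP.
  - by move=> g _; rewrite lee_fin.
  - by rewrite lee_fin powR_ge0.
  by apply: eq_integral => g _; rewrite gweight_dil // -EFinM; congr _%:E; ring.
rewrite !muleA -!EFinM; congr (_%:E * _)%E.
have -> : 2 - 4 * s = alpha - 4 by rewrite /s; field.
rewrite -(mulrA _ (l ^+ 4)) -powR_mulrn ?(ltW l0) // -powR_gtD //.
have -> : 4%:R + (alpha - 4) = alpha by ring.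
have -> : l `^ alpha = r `^ alpha * k `^ (- alpha).
  rewrite /l powRM ?invr_ge0 ?(ltW k0) ?(ltW r0) //.
  by rewrite -(powR_inv1 (ltW k0)) -(powRrM k) mulN1r.
have -> : k `^ (alpha - 2) = k `^ alpha * C.
  by rewrite -[C]invrK -ksq -powR_mulrn ?(ltW k0) // -(powRN k) -powR_gtD.
rewrite powRN; have := powR_gt0 alpha k0; have := powR_gt0 alpha r0.
by move: (r `^ _) (k `^ _) => X Y hX hY; field; rewrite !gt_eqF.
Qed.

End GaugeFunctional.

(** * The left-invariant functional *)

Section WeightedIntegral.
Context {R : realType}.
Local Notation leb := (@lebesgue_measure R).
Local Notation mR := (measurableTypeR R).
Local Notation H3 := (mR * mR * mR)%type.
Implicit Types (g : heis R) (u v : H3 -> R).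

Definition gint (s : R) u : \bar R :=
  (\int[leb3]_(g in gball 1) (u g * gweight s g)%:E)%E.

Let mgw (s : R) u : measurable_fun setT u ->
  measurable_fun (gball 1) (fun g : H3 => (u g * gweight s g)%:E).
Proof.
move=> mu; apply: measurable_funTS; apply/measurable_EFinP.
by apply: (@measurable_funM _ H3 R) => //; exact: measurable_gweight.
Qed.

Lemma gint_ge0 s u : (forall g, 0 <= u g) -> (0 <= gint s u)%E.
Proof.
by move=> u0; apply: integral_ge0 => g _; rewrite lee_fin mulr_ge0 ?gweight_ge0.
Qed.

Lemma le_gint s u v : measurable_fun setT u -> measurable_fun setT v ->
  (forall g, 0 <= u g) -> (forall g, 0 <= v g) ->
  (forall g, N4 g < 1 -> u g <= v g) -> (gint s u <= gint s v)%E.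
Proof.
move=> mu mv u0 v0 uv; apply: ge0_le_integral.
- exact: measurable_gball.
- by move=> g _; rewrite lee_fin mulr_ge0 ?gweight_ge0.
- exact: mgw.
- exact: mgw.
move=> g; rewrite /gball /= expr1n => g1.
by rewrite lee_fin ler_wpM2r ?gweight_ge0 ?uv.
Qed.

Lemma eq_gint s u v : u =1 v -> gint s u = gint s v.
Proof. by move=> uv; apply: eq_integral => g _; rewrite uv. Qed.

Lemma gintZ s (a : R) u : 0 <= a -> measurable_fun setT u ->
  (forall g, 0 <= u g) -> gint s (fun g => a * u g) = (a%:E * gint s u)%E.
Proof.
move=> a0 mu u0; rewrite /gint -ge0_integralZl //.
- by apply: eq_integral => g _; rewrite -EFinM -mulrA.
- exact: measurable_gball.
- exact: mgw.
- by move=> g _; rewrite lee_fin mulr_ge0 ?gweight_ge0.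
Qed.

Lemma gintD s u v : measurable_fun setT u -> measurable_fun setT v ->
  (forall g, 0 <= u g) -> (forall g, 0 <= v g) ->
  gint s (fun g => u g + v g) = (gint s u + gint s v)%E.
Proof.
move=> mu mv u0 v0; rewrite /gint -ge0_integralD //.
- by apply: eq_integral => g _; rewrite -EFinD mulrDl.
- exact: measurable_gball.
- by move=> g _; rewrite lee_fin mulr_ge0 ?gweight_ge0.
- exact: mgw.
- by move=> g _; rewrite lee_fin mulr_ge0 ?gweight_ge0.
- exact: mgw.
Qed.

Definition vquartic g : R := 9 * zsq g ^+ 2 + (6 * g.2 + 3 * g.1.1 * g.1.2) ^+ 2.

Lemma measurable_vquartic : measurable_fun setT (vquartic : H3 -> R).
Proof.
have mxy : measurable_fun setT (fun g : H3 => 3 * g.1.1 * g.1.2).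
  apply: (@measurable_funM _ H3 R); last exact: measurable_hy.
  by apply: (@measurable_funM _ H3 R); [exact: measurable_cst|exact: measurable_hx].
apply: (@measurable_funD _ H3 R).
  apply: (@measurable_funM _ H3 R); first exact: measurable_cst.
  by apply: (@measurable_funX _ H3 R); exact: measurable_zsq.
apply: (@measurable_funX _ H3 R); apply: (@measurable_funD _ H3 R) => //.
by apply: (@measurable_funM _ H3 R); [exact: measurable_cst|exact: measurable_hs].
Qed.

Lemma vquartic_ge0 g : 0 <= vquartic g.
Proof. by apply: addr_ge0; [exact: mulr_ge0 (ler0n _ _) (sqr_ge0 _)|exact: sqr_ge0]. Qed.

(** [(6 s + 3 x y)^2 <= 72 s^2 + 18 x^2 y^2] and [x^2 y^2 <= zsq^2 / 4], so [zsq^2] receives the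
    coefficient [9 + 9/2 = 27/2]. *)
Lemma vquartic_le_N4 g : vquartic g <= 27 / 2 * N4 g.
Proof.
rewrite /vquartic /N4 /zsq; move: g => [[x y] s] /=.
by have := sqr_ge0 (6 * s - 3 * x * y); have := sqr_ge0 s; have := sqr_ge0 (x ^+ 2 - y ^+ 2); nra.
Qed.

Lemma sqgradH_fcubic_dil (l : R) g : sqgradH fcubic (dil l g) =
  (1 - 3 * l ^+ 2 * zsq g) ^+ 2 + l ^+ 4 * (6 * g.2 + 3 * g.1.1 * g.1.2) ^+ 2.
Proof. by rewrite sqgradH_fcubic /zsq /=; ring. Qed.

Lemma measurable_sqgradH_fcubic : measurable_fun setT (sqgradH fcubic : H3 -> R).
Proof.
have -> : sqgradH fcubic = fun g : heis R => 1 + (- 6) * zsq g + vquartic g.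
  by apply/funext => g; rewrite sqgradH_fcubic /vquartic /zsq; ring.
apply: (@measurable_funD _ H3 R); last exact: measurable_vquartic.
apply: (@measurable_funD _ H3 R); first exact: measurable_cst.
by apply: (@measurable_funM _ H3 R); [exact: measurable_cst|exact: measurable_zsq].
Qed.

(* [N4 <= N4^(1/2)] on the unit ball, and [C N4^(1/2) zsq] and [2 zsq^2] are both
   homogeneous of degree 4, so that [layer_cake_le] applies. *)
Lemma gint_N4_le (C s : R) : 0 <= C -> 0 < s ->
  (\int[leb3]_(g in gball 1%R) (C * zsq g)%:E <=
   \int[leb3]_(g in gball 1%R) (2 * zsq g ^+ 2)%:E)%E ->
  (C%:E * gint s N4 <= 2%:E * gint s zsq)%E.
Proof.
move=> C0 s0 hC.
pose k1 (g : H3) := C * (zsq g * N4 g `^ 2^-1).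
pose k2 (g : H3) := 2 * zsq g ^+ 2.
have mp : measurable_fun setT (fun g : H3 => zsq g * N4 g `^ 2^-1).
  apply: (@measurable_funM _ H3 R); first exact: measurable_zsq.
  exact: (measurableT_comp (measurable_powR 2^-1) measurable_N4).
have m1 : measurable_fun setT k1.
  by apply: (@measurable_funM _ H3 R) => //; exact: measurable_cst.
have m2 : measurable_fun setT k2.
  apply: (@measurable_funM _ H3 R); first exact: measurable_cst.
  by apply: (@measurable_funX _ H3 R); exact: measurable_zsq.
have k10 g : 0 <= k1 g by rewrite !mulr_ge0 ?zsq_ge0 ?powR_ge0.
have k20 g : 0 <= k2 g by exact: mulr_ge0 (ler0n _ _) (sqr_ge0 _).
have z0 : zsq (0 : heis R) = 0 by rewrite /zsq /= expr0n addr0.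
have h1 t g : 0 < t -> k1 (dil t g) = t ^+ 4 * k1 g.
  move=> t0; rewrite /k1 zsq_dil N4_dil powRM ?exprn_ge0 ?N4_ge0 ?(ltW t0) //.
  have -> : (t ^+ 4) `^ 2^-1 = t ^+ 2.
    by rewrite -!powR_mulrn ?(ltW t0) // -powRrM; congr (_ `^ _); field.
  ring.
have h2 t g : 0 < t -> k2 (dil t g) = t ^+ 4 * k2 g.
  by move=> _; rewrite /k2 zsq_dil; ring.
have le1 : (\int[leb3]_(g in gball 1%R) (k1 g)%:E <= \int[leb3]_(g in gball 1%R) (k2 g)%:E)%E.
  apply: le_trans hC; apply: ge0_le_integral.
  - exact: measurable_gball.
  - by move=> g _; rewrite lee_fin.
  - by apply: measurable_funTS; apply/measurable_EFinP.
  - apply: measurable_funTS; apply/measurable_EFinP.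
    by apply: (@measurable_funM _ H3 R); [exact: measurable_cst|exact: measurable_zsq].
  move=> g; rewrite /gball /= expr1n => g1; rewrite lee_fin /k1 ler_wpM2l //.
  rewrite ler_piMr ?zsq_ge0 //.
  apply: le_trans (_ : 1 `^ 2^-1 <= _); last by rewrite powR1.
  by apply: ge0_ler_powR; rewrite ?invr_ge0 ?nnegrE ?N4_ge0 ?(ltW g1).
have := layer_cake_le k1 k2 s s0 m1 m2 k10 k20 _ _ h1 h2 le1.
rewrite {1}/k1 {1}/k2 z0 mul0r mulr0 expr0n mulr0 => /(_ erefl erefl).
rewrite -(gintZ s C N4 C0 measurable_N4 N4_ge0) -(gintZ s 2 zsq (ler0n _ _) measurable_zsq zsq_ge0).
move=> le2; apply: le_trans (le_trans le2 _); last first.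
  rewrite le_eqVlt; apply/orP; left; apply/eqP/eq_integral => g _.
  by rewrite /k2 /gweight; congr _%:E; ring.
apply: ge0_le_integral.
- exact: measurable_gball.
- by move=> g _; rewrite lee_fin; exact: mulr_ge0 (mulr_ge0 C0 (N4_ge0 g)) (gweight_ge0 s g).
- apply: mgw; apply: (@measurable_funM _ H3 R); first exact: measurable_cst.
  exact: measurable_N4.
- apply: measurable_funTS; apply/measurable_EFinP.
  apply: (@measurable_funM _ H3 R) => //.
  exact: (measurableT_comp (measurable_powR (- s)) measurable_N4).
move=> g; rewrite /gball /= expr1n => g1; rewrite lee_fin /gweight.
rewrite -!mulrA ler_wpM2l // mulrCA ler_wpM2l ?zsq_ge0 // ler_wpM2r ?powR_ge0 //.
have [->|N0] := eqVneq (N4 g) 0; first by rewrite powR_ge0.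
apply: le_trans (_ : N4 g `^ 1 <= _); first by rewrite powRr1 ?N4_ge0.
apply: ger_powR; last by lra.
by rewrite lt_def N0 N4_ge0 (ltW g1).
Qed.

(* The integrand is [1 - 6 l^2 zsq + l^4 vquartic]. If [zsq] has infinite
   integral, so has the integrand at [l1], which stays above [zsq / 9];
   otherwise the decrease of the quadratic term absorbs the growth of the
   quartic one. *)
Lemma gint_sqgradH_fcubic_decr (C s l1 l2 : R) : 0 < C -> C <= 2 -> 0 < s ->
  (\int[leb3]_(g in gball 1%R) (C * zsq g)%:E <=
   \int[leb3]_(g in gball 1%R) (2 * zsq g ^+ 2)%:E)%E ->
  0 < l1 -> l1 <= l2 -> l2 ^+ 2 <= C / 9 ->
  (gint s (fun g => sqgradH fcubic (dil l2 g)) <=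
   gint s (fun g => sqgradH fcubic (dil l1 g)))%E.
Proof.
move=> C0 C2 s0 hC l10 l12 l2C.
have l1l2 : l1 ^+ 2 <= l2 ^+ 2 by rewrite ler_pXn2r ?nnegrE ?(ltW l10) // (le_trans (ltW l10)).
pose v l g := sqgradH fcubic (dil l g : heis R).
have mv l : measurable_fun setT (v l : H3 -> R).
  exact: (measurableT_comp measurable_sqgradH_fcubic (measurable_dil l)).
have v0 l g : 0 <= v l g by rewrite addr_ge0 ?sqr_ge0.
change (gint s (v l2) <= gint s (v l1))%E.
have mz := @measurable_zsq R; have z0 := @zsq_ge0 R.
have mN := @measurable_N4 R; have N0 := @N4_ge0 R.
have mq := measurable_vquartic; have q0 := vquartic_ge0.
have mZ (a : R) (u : H3 -> R) : measurable_fun setT u -> measurable_fun setT (fun g => a * u g).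
  by move=> mu; apply: (@measurable_funM _ H3 R) => //; exact: measurable_cst.
have z1 g : N4 g < 1 -> zsq g <= 1.
  move=> g1; rewrite -(ler_pXn2r (ltn0Sn 1)) ?nnegrE // expr1n.
  exact: le_trans (zsq_le_N4 g) (ltW g1).
have [fX|iX] := boolP (gint s zsq \is a fin_num); last first.
  have {}iX : gint s zsq = +oo%E.
    by move: iX; rewrite ge0_fin_numE ?gint_ge0 // -leNgt leye_eq => /eqP.
  rewrite [leRHS](_ : _ = +oo%E) ?leey //; apply/eqP; rewrite -leye_eq.
  (* On the unit ball [3 l1^2 zsq <= C / 3 <= 2/3], so the first square in the integrand is at least
     [1/9], hence at least [zsq / 9]. *)
  have <- : (9^-1%:E * gint s zsq = +oo)%E by rewrite iX gt0_muley // lte_fin invr_gt0.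
  have h9 : 0 <= 9^-1 :> R by rewrite invr_ge0.
  have p9 g : 0 <= 9^-1 * zsq g by exact: mulr_ge0.
  rewrite -(gintZ s _ zsq h9 mz z0).
  apply: (le_gint s _ _ (mZ _ _ mz) (mv l1) p9 (v0 l1)) => g g1.
  rewrite /v sqgradH_fcubic_dil.
  have z1' := z1 g g1; have := sqr_ge0 (6 * g.2 + 3 * g.1.1 * g.1.2).
  have l4 : 0 <= l1 ^+ 4 by rewrite exprn_ge0 // ltW.
  move=> h; apply: (@le_trans _ _ ((1 - 3 * l1 ^+ 2 * zsq g) ^+ 2)); last first.
    by rewrite lerDl; exact: mulr_ge0.
  have : l1 ^+ 2 * zsq g <= 2 / 9.
    apply: le_trans (_ : l1 ^+ 2 * 1 <= _); last by rewrite mulr1; move: l2C l1l2 C2; clear; lra.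
    by rewrite ler_wpM2l ?sqr_ge0.
  by move: (l1 ^+ 2) (zsq g) z1'; clear => a b b1 ab; nra.
(* The quadratic and quartic changes are placed on opposite sides so that all integrands are
   nonnegative; of the four integrals, only that of [zsq] is known to be finite here. *)
have E : (gint s (v l2) + (6 * (l2 ^+ 2 - l1 ^+ 2))%:E * gint s zsq =
    gint s (v l1) + (l2 ^+ 4 - l1 ^+ 4)%:E * gint s vquartic)%E.
  have h6 : 0 <= 6 * (l2 ^+ 2 - l1 ^+ 2) by rewrite mulr_ge0 // subr_ge0.
  have h4 : 0 <= l2 ^+ 4 - l1 ^+ 4.
    by rewrite subr_ge0 ler_pXn2r ?nnegrE ?(ltW l10) // (le_trans (ltW l10)).
  have p6 g : 0 <= 6 * (l2 ^+ 2 - l1 ^+ 2) * zsq g by exact: mulr_ge0.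
  have p4 g : 0 <= (l2 ^+ 4 - l1 ^+ 4) * vquartic g by exact: mulr_ge0.
  rewrite -(gintZ s _ zsq h6 mz z0) -(gintZ s _ vquartic h4 mq q0).
  etransitivity; first exact: (esym (gintD s (v l2) _ (mv l2) (mZ _ _ mz) (v0 l2) p6)).
  etransitivity; last exact: (gintD s (v l1) _ (mv l1) (mZ _ _ mq) (v0 l1) p4).
  by apply: eq_gint => g; rewrite /v !sqgradH_fcubic_dil /vquartic; ring.
have le6 : ((l1 ^+ 2 + l2 ^+ 2)%:E * gint s vquartic <= 6%:E * gint s zsq)%E.
  have le27 : (gint s vquartic <= (27 / 2)%:E * gint s N4)%E.
    have h27 : 0 <= 27 / 2 :> R by exact: mulr_ge0.
    have p27 g : 0 <= 27 / 2 * N4 g by exact: mulr_ge0.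
    rewrite -(gintZ s _ N4 h27 mN N0).
    apply: (le_gint s _ _ mq (mZ _ _ mN) q0 p27) => g _.
    exact: vquartic_le_N4.
  (* [l1^2 + l2^2 <= 2 C / 9], and [2 C / 9 * 27/2 = 3 C] is three times the left coefficient in
     [gint_N4_le]. This is where the radius [1/3] enters. *)
  apply: le_trans (_ : (2 * C / 9)%:E * ((27 / 2)%:E * gint s N4) <= _)%E.
    apply: lee_pmul => //; first by rewrite lee_fin addr_ge0 ?sqr_ge0.
      exact: gint_ge0.
    by rewrite lee_fin; lra.
  rewrite muleA -EFinM.
  have -> : 2 * C / 9 * (27 / 2) = 3 * C by field.
  have -> : (6%:E = 3%:E * 2%:E :> \bar R)%E by rewrite -EFinM; congr _%:E; ring.
  rewrite (EFinM 3 C) -!muleA; apply: lee_wpmul2l; first by rewrite lee_fin.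
  exact: gint_N4_le (ltW C0) s0 hC.
have fX6 : ((6 * (l2 ^+ 2 - l1 ^+ 2))%:E * gint s zsq)%E \is a fin_num by rewrite fin_numM.
move: E le6 fX6; move: (gint s (v l2)) (gint s (v l1)) (gint s zsq) (gint s vquartic) => A B X Y E le6 fX6.
rewrite -(leeD2rE _ _ fX6) E leeD2l //.
have -> : l2 ^+ 4 - l1 ^+ 4 = (l2 ^+ 2 - l1 ^+ 2) * (l1 ^+ 2 + l2 ^+ 2) by ring.
by rewrite EFinM -muleA (mulrC 6) EFinM -muleA lee_wpmul2l // lee_fin subr_ge0.
Qed.

End WeightedIntegral.

(** * The right-invariant functional *)

Section PositivePart.
Context {R : realType}.

(* At a minimum, a directional derivative vanishes if it exists, and is
   otherwise the limit of a divergent filter, hence the junk value [0]. *)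
Lemma derive_at_min (V : normedModType R) (f : V -> R) (x v : V) :
  (forall y, f x <= f y) -> 'D_v f x = 0.
Proof.
move=> fx; have [df|] := pselect (derivable f x v); last exact: dvgP.
apply/eqP; apply: contrapT => /negP d0; set d := 'D_v f x in d0.
have e0 : 0 < `|d| by rewrite normr_gt0.
have /cvgrPdist_lt/(_ _ e0) : h^-1 *: (f (h *: v + x) - f x) @[h --> 0^'] --> d by exact: df.
rewrite /dnbhs /prop_near1 /within /= => /nbhs_ballP[e /= e1 he].
have key (h : R) : `|h| = e / 2 -> `|d - h^-1 * (f (h *: v + x) - f x)| < `|d|.
  move=> hE; apply: he.
    by rewrite /ball /= sub0r normrN hE ltr_pdivrMr // ltr_pMr // ltr1n.
  by rewrite -normr_gt0 hE divr_gt0.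
have f0 h : 0 <= f (h *: v + x) - f x by rewrite subr_ge0.
have e2 : 0 < (e / 2)^-1 by rewrite invr_gt0 divr_gt0.
have [dn|dp] := ltP d 0.
  have /key : `|e / 2| = e / 2 by rewrite ger0_norm // ltW // divr_gt0.
  rewrite (ltr0_norm dn) ltNge => /negP; apply.
  rewrite ler_normr; apply/orP; right; rewrite opprB lerDr.
  exact: mulr_ge0 (ltW e2) (f0 _).
have /key : `|- (e / 2)| = e / 2 by rewrite normrN ger0_norm // ltW // divr_gt0.
rewrite (ger0_norm dp) ltNge => /negP; apply.
rewrite ler_normr; apply/orP; left.
rewrite lerDl invrN mulNr opprK.
exact: mulr_ge0 (ltW e2) (f0 _).
Qed.

Implicit Types (u : heis R -> R) (g : heis R).

(** Where [u > 0], the positive part coincides with [u] nearby; elsewhere [g] is a global minimum of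
    it, so [derive_at_min] applies. The formula holds at every point, including the zeros of [u]
    where the positive part may have a corner. *)
Lemma rsqgradH_posE u p q r g : {for g, continuous u} -> grad_at g u p q r ->
  rsqgradH (u^\+)%R g = if 0 < u g then rsqgradH u g else 0.
Proof.
move=> cu gu; case: ifPn => [u0|]; last rewrite -leNgt => u0.
  have up : \forall x \near g, u x = (u^\+)%R x.
    have : \forall x \near g, 0 < u x by exact: (cvgr_gt (u g) cu _ u0).
    by apply: filterS => x ux; rewrite /funrpos max_l // ltW.
  rewrite /rsqgradH; have [_ _ -> ->] := X_val (grad_at_near up gu).
  by have [_ _ -> ->] := X_val gu.
have m y : (u^\+)%R g <= (u^\+)%R y by rewrite /funrpos (max_r u0) le_max lexx orbT.
have D v := @derive_at_min _ _ g v m.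
by rewrite /rsqgradH /rX1 /rX2 /dx /dy /ds !D !mulr0 subr0 addr0 expr0n addr0.
Qed.

(** The squared right-invariant gradient of [fcubic]. *)
Definition vright g : R :=
  (1 - 3 * g.1.1 ^+ 2 + 3 * g.1.2 ^+ 2) ^+ 2 + (6 * g.2 - 3 * g.1.1 * g.1.2) ^+ 2.

Lemma grad_fcubic g : grad_at g (@fcubic R) (1 - 3 * g.1.1 ^+ 2) (6 * g.2) (6 * g.1.2).
Proof. by rewrite /fcubic; grad; rewrite /=; ring. Qed.

Lemma continuous_fcubic : continuous (@fcubic R).
Proof.
have C k := @Ck_cst R k; have P2 : Ck 1 (fun g : heis R => 6 * g.1.2 * g.2).
  by apply: CkM; [apply: CkM; [exact: C|exact: Ck_y]|exact: Ck_s].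
have P3 : Ck 1 (fun g : heis R => -1 * (g.1.1 * (g.1.1 * g.1.1))).
  by apply: CkM; [exact: C|apply: CkM; [|apply: CkM]; exact: Ck_x].
have [c _] := CkD (CkD (Ck_x 1) P2) P3.
suff -> : @fcubic R =
    fun g => g.1.1 + 6 * g.1.2 * g.2 + -1 * (g.1.1 * (g.1.1 * g.1.1)) by exact: c.
by apply/funext => g; rewrite /fcubic; ring.
Qed.

Lemma rsqgradH_fcubic_pos g :
  rsqgradH (fcubic^\+)%R g = if 0 < fcubic g then vright g else 0.
Proof.
rewrite (rsqgradH_posE _ _ _ _ _ (continuous_fcubic g) (grad_fcubic g)).
case: ifP => // _; rewrite /rsqgradH; have [_ _ -> ->] := X_val (grad_fcubic g).
by rewrite /vright; field.
Qed.

Lemma rsqgradH_fcubic_neg g :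
  rsqgradH (fcubic^\-)%R g = if fcubic g < 0 then vright g else 0.
Proof.
have -> : (@fcubic R)^\-%R = ((fun g => - fcubic g)^\+)%R by [].
have cN : {for g, continuous (fun g : heis R => - fcubic g)}.
  by apply: continuousN; exact: continuous_fcubic.
have gN := grad_atN (grad_fcubic g).
rewrite (rsqgradH_posE _ _ _ _ _ cN gN) oppr_gt0.
case: ifP => // _; rewrite /rsqgradH; have [_ _ -> ->] := X_val gN.
by rewrite /vright; field.
Qed.

End PositivePart.

Section RightFunctional.
Context {R : realType}.
Local Notation leb := (@lebesgue_measure R).
Local Notation mR := (measurableTypeR R).
Local Notation H3 := (mR * mR * mR)%type.
Implicit Types (g : heis R) (u v : H3 -> R).

(** A map that preserves volume, [N4] and [zsq] preserves the unit gauge ball and the weight. *)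
Lemma gint_invariant (s : R) (tau : heis R -> heis R) u :
  measurable_fun setT u -> (forall g, 0 <= u g) ->
  (forall f : H3 -> \bar R, measurable_fun setT f -> (forall g, 0 <= f g)%E ->
    \int[leb3]_g f g = \int[leb3]_g f (tau g))%E ->
  (forall g, N4 (tau g) = N4 g) -> (forall g, zsq (tau g) = zsq g) ->
  gint s (fun g => u (tau g)) = gint s u.
Proof.
move=> mu u0 htau hN hz; rewrite /gint [LHS]integral_mkcond [RHS]integral_mkcond.
apply/esym; etransitivity; first apply: htau.
- apply/(measurable_restrictT _ _).1; first exact: measurable_gball.
  apply: measurable_funTS; apply/measurable_EFinP.
  by apply: (@measurable_funM _ H3 R) => //; exact: measurable_gweight.
- by move=> g; rewrite /patch; case: ifP => // _; rewrite lee_fin mulr_ge0 ?gweight_ge0.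
apply: eq_integral => g _; rewrite /patch /gweight hN hz; congr (if _ then _ else _).
by apply/idP/idP; rewrite !inE /gball /= hN.
Qed.

Lemma integral_supp1 (F : R -> \bar R) (a : R) : (forall x, x != a -> F x = 0%E) ->
  (\int[leb]_x F x = 0)%E.
Proof.
move=> F0; rewrite -(integral_set1 F a) [RHS]integral_mkcond.
apply: eq_integral => x _; rewrite /patch; case: ifPn => // /negP xa.
by apply: F0; apply: contra_notN xa => /eqP ->; rewrite inE.
Qed.

Lemma measurable_fcubic : measurable_fun setT (fcubic : H3 -> R).
Proof.
apply: (@measurable_funB _ H3 R).
  apply: (@measurable_funD _ H3 R); first exact: measurable_hx.
  apply: (@measurable_funM _ H3 R); last exact: measurable_hs.
  by apply: (@measurable_funM _ H3 R); [exact: measurable_cst|exact: measurable_hy].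
by apply: (@measurable_funX _ H3 R); exact: measurable_hx.
Qed.

Lemma measurable_vright : measurable_fun setT (vright : H3 -> R).
Proof.
have mZ (a : R) (u : H3 -> R) : measurable_fun setT u -> measurable_fun setT (fun g => a * u g).
  by move=> mu; apply: (@measurable_funM _ H3 R) => //; exact: measurable_cst.
have mX n (u : H3 -> R) : measurable_fun setT u -> measurable_fun setT (fun g => u g ^+ n).
  by move=> mu; exact: (@measurable_funX _ H3 R).
have mx := @measurable_hx R; have my := @measurable_hy R; have ms := @measurable_hs R.
apply: (@measurable_funD _ H3 R); apply: (mX 2).
  apply: (@measurable_funD _ H3 R); last exact: (mZ _ _ (mX 2 _ my)).
  by apply: (@measurable_funB _ H3 R); [exact: measurable_cst|exact: (mZ _ _ (mX 2 _ mx))].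
apply: (@measurable_funB _ H3 R); first exact: (mZ _ _ ms).
by apply: (@measurable_funM _ H3 R); [exact: (mZ _ _ mx)|].
Qed.

Lemma vright_ge0 g : 0 <= vright g.
Proof. by rewrite addr_ge0 ?sqr_ge0. Qed.

Definition vpos g : R := if 0 < fcubic g then vright g else 0.
Definition vneg g : R := if fcubic g < 0 then vright g else 0.
Definition vzero g : R := if fcubic g == 0 then vright g else 0.

Lemma vpos_ge0 g : 0 <= vpos g.
Proof. by rewrite /vpos; case: ifP => // _; exact: vright_ge0. Qed.
Lemma vneg_ge0 g : 0 <= vneg g.
Proof. by rewrite /vneg; case: ifP => // _; exact: vright_ge0. Qed.
Lemma vzero_ge0 g : 0 <= vzero g.
Proof. by rewrite /vzero; case: ifP => // _; exact: vright_ge0. Qed.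

Lemma measurable_vcut (i : interval R) :
  measurable_fun setT (fun g : H3 => if fcubic g \in i then vright g else 0).
Proof.
have mi : measurable_fun setT (fun g : H3 => \1_(fcubic @^-1` [set` i] : set H3) g : R).
  apply: measurable_indic; rewrite -[X in measurable X]setTI.
  by apply: measurable_fcubic => //; exact: measurable_itv.
have := @measurable_funM _ H3 R _ _ _ measurable_vright mi.
congr (measurable_fun _ _); apply/funext => g; rewrite /= indicE.
have -> : (g \in fcubic @^-1` [set` i]) = (fcubic g \in i) by apply/idP/idP => [/set_mem|/mem_set].
by case: ifP; rewrite ?mulr1 ?mulr0.
Qed.

Lemma measurable_vpos : measurable_fun setT (vpos : H3 -> R).
Proof.
have := measurable_vcut `]0, +oo[; congr (measurable_fun _ _).
by apply/funext => g; rewrite /vpos in_itv /= andbT.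
Qed.

Lemma measurable_vneg : measurable_fun setT (vneg : H3 -> R).
Proof. exact: measurable_vcut `]-oo, 0[. Qed.

Lemma measurable_vzero : measurable_fun setT (vzero : H3 -> R).
Proof.
have := measurable_vcut `[0, 0]; congr (measurable_fun _ _).
by apply/funext => g; rewrite /vzero in_itv /= -eq_le eq_sym.
Qed.

Lemma gint_vneg (s l : R) :
  gint s (fun g => vneg (dil l g)) = gint s (fun g => vpos (dil l g)).
Proof.
pose tau g : heis R := (- g.1.1, - g.1.2, g.2).
have -> : (fun g => vneg (dil l g)) = (fun g => vpos (dil l (tau g))).
  apply/funext => g; rewrite /vneg /vpos.
  have -> : fcubic (dil l (tau g)) = - fcubic (dil l g) by rewrite /fcubic /=; ring.
  have -> : vright (dil l (tau g)) = vright (dil l g) by rewrite /vright /=; ring.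
  by rewrite oppr_gt0.
apply: (gint_invariant s tau (fun g => vpos (dil l g))).
- exact: (measurableT_comp measurable_vpos (measurable_dil l)).
- by move=> g; exact: vpos_ge0.
- move=> f mf f0; rewrite (leb3_affine (-1) (-1) 1 0 0 0 0 0 f) ?oppr_eq0 ?oner_eq0 //.
  rewrite mulrNN !mulr1 normr1 mul1e; apply: eq_integral => g _; congr (f _).
  by rewrite /tau !mul0r !addr0 !mulN1r mul1r.
- by move=> g; rewrite /N4 /zsq /= !sqrrN.
- by move=> g; rewrite /zsq /= !sqrrN.
Qed.

(* The zero set of [fcubic] is negligible: off [y = 0] it is a graph in [sigma]. *)
Lemma gint_vzero (s l : R) : 0 < l -> gint s (fun g => vzero (dil l g)) = 0%E.
Proof.
move=> l0; rewrite /gint integral_mkcond; set F := (_ \_ _).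
have mF : measurable_fun setT F.
  apply/(measurable_restrictT _ _).1; first exact: measurable_gball.
  apply: measurable_funTS; apply/measurable_EFinP.
  apply: (@measurable_funM _ H3 R); last exact: measurable_gweight.
  exact: (measurableT_comp measurable_vzero (measurable_dil l)).
have F0 g : (0 <= F g)%E.
  rewrite /F /patch; case: ifP => // _; rewrite lee_fin.
  by rewrite mulr_ge0 ?gweight_ge0 ?vzero_ge0.
have supp g : fcubic (dil l g) != 0 -> F g = 0%E.
  by move=> fg; rewrite /F /patch /vzero (negbTE fg) mul0r; case: ifP.
etransitivity; first exact: (leb3E F mF F0).
apply: integral0_eq => x _; apply: (integral_supp1 _ 0) => y y0.
(* On the dilated point [fcubic] is affine in [sigma] with slope [6 l^3 y], nonzero off the slice
   [y = 0] just discarded; this is its only root. *)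
apply: (integral_supp1 _ ((l ^+ 3 * x ^+ 3 - l * x) / (6 * l ^+ 3 * y))) => t ht.
apply: supp; apply: contra_neq ht; rewrite /fcubic /= => h.
have l3 : l ^+ 3 != 0 by rewrite expf_neq0 // gt_eqF.
have m0 : 6 * l ^+ 3 * y != 0.
  by apply: mulf_neq0 => //; apply: mulf_neq0 => //; rewrite pnatr_eq0.
apply: (mulIf m0); rewrite divfK //.
by apply/eqP; rewrite -subr_eq0 -h; apply/eqP; ring.
Qed.

Lemma gint_vright (s l : R) : 0 < l ->
  gint s (fun g => vright (dil l g)) = (2%:E * gint s (fun g => vpos (dil l g)))%E.
Proof.
move=> l0.
have md := @measurable_dil R l.
have mp : measurable_fun setT (fun g : H3 => vpos (dil l g)) := measurableT_comp measurable_vpos md.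
have mn : measurable_fun setT (fun g : H3 => vneg (dil l g)) := measurableT_comp measurable_vneg md.
have mz : measurable_fun setT (fun g : H3 => vzero (dil l g)) := measurableT_comp measurable_vzero md.
have p0 g : 0 <= vpos (dil l g) by exact: vpos_ge0.
have n0 g : 0 <= vneg (dil l g) by exact: vneg_ge0.
have z0 g : 0 <= vzero (dil l g) by exact: vzero_ge0.
have pn0 g : 0 <= vpos (dil l g) + vneg (dil l g) by rewrite addr_ge0.
have mpn : measurable_fun setT (fun g : H3 => vpos (dil l g) + vneg (dil l g)).
  exact: (@measurable_funD _ H3 R).
transitivity (gint s (fun g => vpos (dil l g) + vneg (dil l g) + vzero (dil l g))).
  apply: eq_gint => g; rewrite /vpos /vneg /vzero.
  by case: ltgtP => _; rewrite ?addr0 ?add0r.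
etransitivity; first exact: gintD mpn mz pn0 z0.
rewrite gint_vzero // adde0.
etransitivity; first exact: gintD mp mn p0 n0.
by rewrite gint_vneg -mule2n; case: (gint _ _) => [r| |] //=;
  rewrite ?gt0_muley ?gt0_muleNy //; rewrite -EFinD -EFinM; congr _%:E; ring.
Qed.

(* The sum of [vright (dil l g)] over [g = (x, y, sigma)] and [(y, x, - sigma)], in
   which the terms of order [l^2] cancel. *)
Definition vsym (l : R) g : R :=
  2 + l ^+ 4 * (18 * (g.1.1 ^+ 2 - g.1.2 ^+ 2) ^+ 2 +
    (6 * g.2 - 3 * g.1.1 * g.1.2) ^+ 2 + (6 * g.2 + 3 * g.1.1 * g.1.2) ^+ 2).

Lemma gint_vsym (s l : R) : 0 < l ->
  gint s (vsym l) = (2%:E * gint s (fun g => vright (dil l g)))%E.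
Proof.
move=> l0; pose tau g : heis R := (g.1.2, g.1.1, - g.2).
have md := @measurable_dil R l.
have mv : measurable_fun setT (fun g : H3 => vright (dil l g)) := measurableT_comp measurable_vright md.
have v0 g : 0 <= vright (dil l g) by exact: vright_ge0.
have mtau : measurable_fun setT (fun g : H3 => tau g : H3).
  apply: measurable_heis; [exact: measurable_hy|exact: measurable_hx|].
  by apply: (@measurableT_comp _ _ _ H3 R R) => //; exact: measurable_hs.
have mvt : measurable_fun setT (fun g : H3 => vright (dil l (tau g))) := measurableT_comp mv mtau.
have vt0 g : 0 <= vright (dil l (tau g)) by exact: vright_ge0.
have e : gint s (fun g => vright (dil l (tau g))) = gint s (fun g => vright (dil l g)).
  apply: (gint_invariant s tau _ mv v0).
  - move=> f mf f0; rewrite (leb3_affine 1 1 (-1) 0 0 0 0 0 f) ?oppr_eq0 ?oner_eq0 //.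
    rewrite !mul1r normrN1 mul1e; etransitivity; first apply: leb3_swap.
    + have mm : measurable_fun setT (fun g : H3 => (1 * g.1.1 + 0, 1 * g.1.2 + 0, -1 * g.2 + (0 * g.1.1 + 0 * g.1.2 + 0)) : H3).
        rewrite (_ : (fun _ => _) = (fun g : H3 => (g.1.1, g.1.2, - g.2) : H3)).
          apply: measurable_heis; [exact: measurable_hx|exact: measurable_hy|].
          by apply: (@measurableT_comp _ _ _ H3 R R) => //; exact: measurable_hs.
        by apply/funext => g; rewrite !mul0r !addr0 !mul1r mulN1r.
      exact: (measurableT_comp mf mm).
    + by move=> g; exact: f0.
    by apply: eq_integral => g _; congr (f _); rewrite /tau /= !mul0r !addr0 !mul1r mulN1r.
  - by move=> g; rewrite /N4 /zsq /= sqrrN (addrC (g.1.2 ^+ 2)).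
  - by move=> g; rewrite /zsq /= addrC.
transitivity (gint s (fun g => vright (dil l g) + vright (dil l (tau g)))).
  by apply: eq_gint => g; rewrite /vsym /vright /=; ring.
etransitivity; first exact: gintD mv mvt v0 vt0.
by rewrite e; case: (gint _ _) => [r| |] //=;
  rewrite ?gt0_muley ?gt0_muleNy //; rewrite -EFinD -EFinM; congr _%:E; ring.
Qed.

(** Doubling reflects the order even for infinite values. Two doublings turn [vpos] into [vsym],
    which is pointwise nondecreasing in [l]. *)
Lemma gint_vpos_incr (s l1 l2 : R) : 0 < l1 -> l1 <= l2 ->
  (gint s (fun g => vpos (dil l1 g)) <= gint s (fun g => vpos (dil l2 g)))%E.
Proof.
move=> l10 l12; have l20 := lt_le_trans l10 l12.
have two : (0 < 2%:E :> \bar R)%E by rewrite lte_fin.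
rewrite -(lee_pmul2l _ two) // -!gint_vright // -(lee_pmul2l _ two) // -!gint_vsym //.
pose Q g : R := 18 * (g.1.1 ^+ 2 - g.1.2 ^+ 2) ^+ 2 +
    (6 * g.2 - 3 * g.1.1 * g.1.2) ^+ 2 + (6 * g.2 + 3 * g.1.1 * g.1.2) ^+ 2.
have Q0 g : 0 <= Q g.
  by rewrite !addr_ge0 ?sqr_ge0 //; exact: mulr_ge0 (ler0n _ _) (sqr_ge0 _).
have mv l : measurable_fun setT (vsym l : H3 -> R).
  have mx := @measurable_hx R; have my := @measurable_hy R; have ms := @measurable_hs R.
  have mZ (a : R) (u : H3 -> R) : measurable_fun setT u -> measurable_fun setT (fun g => a * u g).
    by move=> mu; apply: (@measurable_funM _ H3 R) => //; exact: measurable_cst.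
  have mX n (u : H3 -> R) : measurable_fun setT u -> measurable_fun setT (fun g => u g ^+ n).
    by move=> mu; exact: (@measurable_funX _ H3 R).
  have mxy : measurable_fun setT (fun g : H3 => 3 * g.1.1 * g.1.2).
    by apply: (@measurable_funM _ H3 R); [exact: (mZ _ _ mx)|].
  apply: (@measurable_funD _ H3 R); first exact: measurable_cst.
  apply: (mZ (l ^+ 4) (fun g => _)); apply: (@measurable_funD _ H3 R).
    apply: (@measurable_funD _ H3 R).
      apply: (mZ 18 (fun g => _)); apply: (mX 2).
      by apply: (@measurable_funB _ H3 R); apply: (mX 2).
    by apply: (mX 2); apply: (@measurable_funB _ H3 R) => //; exact: (mZ _ _ ms).
  by apply: (mX 2); apply: (@measurable_funD _ H3 R) => //; exact: (mZ _ _ ms).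
have v0 l g : 0 <= l -> 0 <= vsym l g.
  by move=> ?; rewrite addr_ge0 //; apply: mulr_ge0 (Q0 g); exact: exprn_ge0.
apply: le_gint => //.
- by move=> g; exact: v0 (ltW l10).
- by move=> g; exact: v0 (ltW l20).
move=> g _; rewrite lerD2l; apply: ler_wpM2r; first exact: Q0.
by rewrite ler_pXn2r ?nnegrE ?(ltW l10) ?(ltW l20).
Qed.

End RightFunctional.

Theorem proposition1p3 (R : realType) (Gam : R * R * R -> R)
    (hGam : fundamental_solution Gam) :
  [/\ harmonicH (@fcubic R),
      forall x y s : R, x ^+ 2 + y ^+ 2 <= 9^-1 ->
        laplH (sqgradH (@fcubic R)) (x, y, s) <= 0,
      forall alpha : R, 0 < alpha -> alpha < homdim%:R ->
        forall r1 r2 : R, 0 < r1 -> r1 <= r2 -> r2 < 3^-1 ->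
          (left_functional Gam alpha (@fcubic R) r2
             <= left_functional Gam alpha (@fcubic R) r1)%E
    & forall r1 r2 : R, 0 < r1 -> r1 <= r2 ->
        (D2 Gam (fcubic^\+)%R r1 * D2 Gam (fcubic^\-)%R r1
           <= D2 Gam (fcubic^\+)%R r2 * D2 Gam (fcubic^\-)%R r2)%E].
Proof.
have [C [C0 C2 GamE hC]] := fundamental_solutionE Gam hGam.
have k0 : 0 < C `^ (- 2^-1) by exact: powR_gt0.
have k2 : (C `^ (- 2^-1)) ^+ 2 = C^-1.
  by rewrite -powR_mulrn ?powR_ge0 // -powRrM mulNr mulVf // powR_inv1 // ltW.
split.
- exact: harmonicH_fcubic.
- move=> x y s xy; rewrite laplH_sqgradH_fcubic /zsq /=.
  by have := sqr_ge0 y; lra.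
- move=> alpha a0 a4 r1 r2 r10 r12 r23; have r20 := lt_le_trans r10 r12.
  rewrite /left_functional.
  have v0 g : 0 <= sqgradH (@fcubic R) g by rewrite addr_ge0 ?sqr_ge0.
  have E r (r0 : 0 < r) := pgauge_functional Gam C C0 GamE alpha r _ a4 r0
    measurable_sqgradH_fcubic v0.
  have le_cong (a b c d : \bar R) : a = b -> c = d -> (b <= d)%E -> (a <= c)%E by move=> -> ->.
  apply: (le_cong _ _ _ _ (E _ r20) (E _ r10)); apply: lee_wpmul2l; first by rewrite lee_fin ltW.
  apply: (gint_sqgradH_fcubic_decr C) => //.
  + by rewrite divr_gt0 // subr_gt0; move: a4; rewrite /homdim; lra.
  + by rewrite divr_gt0.
  + by rewrite ler_pM2r ?invr_gt0.
  (* The dilation factor is [r2 / k] with [k^2 = C^-1], so the requirement [l2^2 <= C / 9] reads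
     [r2^2 <= 1/9]. *)
  rewrite expr_div_n k2 invrK mulrC ler_pM2l //.
  have -> : 9^-1 = 3^-1 ^+ 2 :> R by field.
  by rewrite ler_pXn2r ?nnegrE ?invr_ge0 ?(ltW r20) ?(ltW r23).
move=> r1 r2 r10 r12; have r20 := lt_le_trans r10 r12.
(* [D2] is the case [alpha = 2] of [pgauge_functional]. Both parts of [fcubic] lead to the same [P],
   by [gint_vneg], so the product is the square of [C P]. *)
pose P r := gint ((6 - 2) / 4 : R) (fun g => vpos (dil (r / C `^ (- 2^-1)) g)).
have h2 : 2 < 4 :> R by rewrite ltr_nat.
have DP r : 0 < r -> D2 Gam (fcubic^\+)%R r = (C%:E * P r)%E.
  move=> r0; rewrite /D2.
  rewrite (_ : rsqgradH (fcubic^\+)%R = vpos); last first.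
    by apply/funext => g; exact: rsqgradH_fcubic_pos.
  have := pgauge_functional Gam C C0 GamE 2 r vpos h2 r0 measurable_vpos vpos_ge0.
  by rewrite powR_mulrn ?(ltW r0).
have DN r : 0 < r -> D2 Gam (fcubic^\-)%R r = (C%:E * P r)%E.
  move=> r0; rewrite /D2.
  rewrite (_ : rsqgradH (fcubic^\-)%R = vneg); last first.
    by apply/funext => g; exact: rsqgradH_fcubic_neg.
  have := pgauge_functional Gam C C0 GamE 2 r vneg h2 r0 measurable_vneg vneg_ge0.
  rewrite powR_mulrn ?(ltW r0) // => ->; congr (_ * _)%E; exact: gint_vneg.
have P0 r : (0 <= C%:E * P r)%E.
  by apply: mule_ge0; [rewrite lee_fin ltW|apply: gint_ge0 => g; exact: vpos_ge0].
have PP : (C%:E * P r1 <= C%:E * P r2)%E.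
  apply: lee_wpmul2l; first by rewrite lee_fin ltW.
  apply: gint_vpos_incr; first by rewrite divr_gt0.
  by rewrite ler_pM2r ?invr_gt0.
rewrite !DP // !DN //; exact: lee_pmul.
Qed.
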